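(* Let $a>0$, let $k\in\mathbb{N}^*$ and $k_b\in\mathbb{N}$, let $\lambda>0$, let $r,p\ge 1$ be integers, and let $a_{-r},\dots,a_p$ be real numbers with $a_{-r}\,a_p\neq 0$ satisfying $$\forall\, m=0,\dots,k,\quad \sum_{\ell=-r}^p \ell^m a_\ell=(-\lambda a)^m,\qquad\text{and}\qquad \sup_{\theta\in[0,2\pi]}\Big|\sum_{\ell=-r}^p a_\ell\, e^{i\ell\theta}\Big|\le 1 .$$ Then there exists $C>0$ such that for any $T>0$ and $J\in\mathbb{N}^*$, for any $L\ge 1$, and for any $u_0\in H^{k+1}((0,L))$ satisfying the compatibility requirements $$\forall\, m=0,\dots,k,\quad u_0^{(m)}(0)=0,$$ the following holds. Set $\Delta x=L/J$, $\Delta t=\lambda\,\Delta x$, $x_j=j\,\Delta x$ for $j\in\mathbb{Z}$, and $t^n=n\,\Delta t$ for $n\in\mathbb{N}$. The solution $(u_j^n)$ to the scheme $$\begin{cases} u_j^0=\dfrac{1}{\Delta x}\displaystyle\int_{x_{j-1}}^{x_j}u_0(y)\,dy, & j=1,\dots,J,\\[2mm] u_\ell^n=0, & n\in\mathbb{N},\ \ell=1-r,\dots,0,\\ (D_-^{k_b}u^n)_{J+\ell}=0, & n\in\mathbb{N},\ \ell=1,\dots,p,\\ u_j^{n+1}=\displaystyle\sum_{\ell=-r}^p a_\ell\,u_{j+\ell}^n, & n\in\mathbb{N},\ j=1,\dots,J, \end{cases}$$ satisfies $$\sup_{0\le n\le T/\Delta t}\ \sup_{j=1,\dots,J}\left|u_j^n-\frac{1}{\Delta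 x}\int_{x_{j-1}}^{x_j}u_0(y-a\,t^n)\,dy\right|\le C\,(\sqrt{T}+T)\,e^{C\,T/L}\,\Delta x^{\min(k,k_b)-1/2}\,\|u_0\|_{H^{k+1}((0,L))},$$ where $u_0$ is understood to be extended by $0$ to $(-\infty,0]$.
   Context: $\mathbb{N}=\{0,1,2,\dots\}$ and $\mathbb{N}^*=\mathbb{N}\setminus\{0\}$. For a vector $(v_j)_{j=1-r,\dots,J+p}$, $D_-$ denotes the backward difference operator $(D_-v)_j=v_j-v_{j-1}$, $j=2-r,\dots,J+p$; $D_-^m$ is its $m$-th iterate and $D_-^0$ is the identity. At each time level $n$, the values $u_j^n$ with $1\le j\le J$ being known, the ''ghost'' values $u_{1-r}^n,\dots,u_0^n$ are set to $0$ and the ghost values $u_{J+1}^n,\dots,u_{J+p}^n$ are determined successively by $(D_-^{k_b}u^n)_{J+\ell}=0$, $\ell=1,\dots,p$; then $u_j^{n+1}$, $1\le j\le J$, is computed. The pair $(J,k_b)$ is understood to be such that the expressions $(D_-^{k_b}u^n)_{J+\ell}$, $\ell=1,\dots,p$, only involve indices $\ge 1-r$, i.e. $J\ge k_b-r$. The constant $C$ may depend on $a,\lambda,k,k_b,r,p$ and the coefficients $a_\ell$, but not on $T,J,L,u_0$. *)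

(* Defs.v *)
From HB Require Import structures.
From mathcomp Require Import all_boot all_order all_algebra.
From mathcomp Require Import complex.
From mathcomp Require Import all_classical all_reals all_analysis.

Set Implicit Arguments.
Unset Strict Implicit.
Unset Printing Implicit Defensive.

Import Order.TTheory GRing.Theory Num.Theory.
Import numFieldNormedType.Exports.

Local Open Scope classical_set_scope.
Local Open Scope ring_scope.

Definition test_function (R : realType) (L : R) (phi : R -> R) : Prop :=
  [/\ forall (n : nat) (x : R), derivable (derive1n n phi) x 1,
      compact (closure [set x : R | phi x != 0])
    & closure [set x : R | phi x != 0] `<=` `]0, L[].

(* A function on (0, L) is represented by a total function, only the
   restriction of which to (0, L) matters. *)
Definition L2 (R : realType) (L : R) (f : R -> R) : Prop :=
  (f \_ `]0, L[) \in Lfun (@lebesgue_measure R) 2%:E.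

Definition L2_norm (R : realType) (L : R) (f : R -> R) : R :=
  fine (Lnorm (@lebesgue_measure R) 2%:E (EFin \o (f \_ `]0, L[))).

Definition is_weak_derivative (R : realType) (L : R) (m : nat)
    (f g : R -> R) : Prop :=
  forall phi : R -> R, test_function L phi ->
    \int[lebesgue_measure]_(x in `]0, L[) (f x * derive1n m phi x) =
    (-1) ^+ m * \int[lebesgue_measure]_(x in `]0, L[) (g x * phi x).

Definition sobolev (R : realType) (s : nat) (L : R) (f : R -> R) : Prop :=
  L2 L f /\
  forall m : nat, (m <= s)%N ->
    exists2 g : R -> R, L2 L g & is_weak_derivative L m f g.

(* The weak derivative is unique up to a.e. equality on (0, L); one
   representative is chosen, and 0 is taken if there is none. *)
Definition weak_derivative (R : realType) (L : R) (m : nat) (f : R -> R) :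
    R -> R :=
  xget (fun=> 0) [set g | L2 L g /\ is_weak_derivative L m f g].

Definition sobolev_norm (R : realType) (s : nat) (L : R) (f : R -> R) : R :=
  Num.sqrt (\sum_(0 <= m < s.+1) L2_norm L (weak_derivative L m f) ^+ 2).

(* The value at 0 of an a.e. class of functions on (0, L) is that of its
   representative that is continuous on [0, L]. *)
Definition trace0 (R : realType) (L : R) (f : R -> R) (v : R) : Prop :=
  exists g : R -> R,
    [/\ {within `[0, L], continuous g},
        {ae lebesgue_measure, forall x : R, x \in `]0, L[ -> g x = f x}
      & g 0 = v].

Definition extend0 (R : realType) (f : R -> R) (y : R) : R :=
  if y <= 0 then 0 else f y.

Definition cell_average (R : realType) (dx : R) (f : R -> R) (j : int) : R :=
  dx^-1 * \int[lebesgue_measure]_(y in `](j - 1)%:~R * dx, j%:~R * dx[) f y.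

Definition backward_diff (R : realType) (v : int -> R) (j : int) : R :=
  v j - v (j - 1).

(* \sum_(l = -r)^p F l *)
Definition stencil_sum (V : nmodType) (r p : nat) (F : int -> V) : V :=
  \sum_(0 <= i < (r + p).+1) F (i%:Z - r%:Z).

Definition expi (R : realType) (t : R) : R[i] := (cos t +i* sin t)%C.

Definition symbol (R : realType) (r p : nat) (a_ : int -> R) (theta : R) :
    R[i] :=
  stencil_sum r p (fun l => (a_ l)%:C%C * expi (l%:~R * theta)).

(* Only the values u n j with 1 - r <= j <= J + p are constrained. *)
Record scheme_solution (R : realType) (r p kb J : nat) (a_ : int -> R)
    (dx : R) (u0 : R -> R) (u : nat -> int -> R) : Prop := SchemeSolution {
  scheme_init : forall j : int, 1 <= j <= J%:Z ->
    u 0%N j = cell_average dx u0 j;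
  scheme_inflow : forall (n : nat) (l : int), 1 - r%:Z <= l <= 0 ->
    u n l = 0;
  scheme_outflow : forall (n : nat) (l : int), 1 <= l <= p%:Z ->
    iter kb (@backward_diff R) (u n) (J%:Z + l) = 0;
  scheme_step : forall (n : nat) (j : int), 1 <= j <= J%:Z ->
    u n.+1 j = stencil_sum r p (fun l => a_ l * u n (j + l))
}.

(* Main.v *)
Require Import Defs.
From HB Require Import structures.
From mathcomp Require Import all_boot all_order all_algebra.
From mathcomp Require Import complex.
From mathcomp Require Import all_classical all_reals all_analysis.
From mathcomp Require Import measurable_realfun.
From mathcomp Require Import ring lra zify.

Set Implicit Arguments.
Unset Strict Implicit.
Unset Printing Implicit Defensive.

Import Order.TTheory GRing.Theory Num.Theory.
Import numFieldNormedType.Exports.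

Local Open Scope classical_set_scope.
Local Open Scope ring_scope.

(** The scheme is compared with the exact cell averages [w n j] of the
    transported datum, which are difference quotients of a primitive [V 0] of
    the datum extended by zero.  The error [e n = u n - w n] solves the same
    scheme with a source, the truncation error, and with nonzero boundary data
    [iter kb backward_diff (e n) (J + l)] at the outflow; both are small because
    [w] is smooth, and the scheme is stable with respect to them.

    _Stability_ ([scheme_stability]) is an energy estimate on the squared
    [l2] norm over the cells.  On the whole line the stencil is a contraction,
    by Parseval's identity ([stencil_contraction]).  Since [a > 0], energy
    leaves through the outflow boundary: one step loses a positive multiple of
    the squares of the boundary values, up to a multiple of the squares of
    their first differences ([outflow_energy]); and it loses a positive multiple
    of them up to the squares of the ghost values ([dirichlet_energy], which
    uses that [a_ (- r)] does not vanish).  The first fact is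
    applied to the differences of order [m < kb], the second one to those of
    order [kb], whose ghost values are data.  The differences of order [m >= 1]
    are multiplied by a weight that vanishes at the inflow, where they do not
    satisfy the scheme; it varies by [O(1 / J)] from one cell to the next,
    hence the factor [expR (C * n / J)], that is [expR (C * T / L)].  In a
    linear combination of these [kb + 1] inequalities with geometric
    coefficients, each boundary term absorbs the one coming from the previous
    order.

    _Regularity_ ([sobolev_primitive_chain]).  As the traces at 0 vanish, the
    weak derivative of order [k + 1], extended by zero and integrated
    repeatedly from minus infinity, gives back on [(0, L)] the derivatives of
    lower order and the datum.  These primitives are defined on the whole line,
    vanish on the left of 0, are bounded by the Sobolev norm and
    [V k.+1] is Hoelder continuous of exponent 1/2, with a constant measured by
    the increments of the nondecreasing bounded function [E].  The passage
    from weak derivatives to primitives tests against smooth cut-offs of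
    intervals ([weak_primitive]).

    _Consistency_ ([energy_truncation_le]).  The moment conditions make the
    scheme exact on polynomials of degree [k].  The Taylor remainders are
    bounded by increments of [E], and so have a squared [l2] norm of order
    [dx ^ (2 * k + 1)].  The boundary data are differences of order
    [kb] of sampled values of [w], hence of order [dx ^ min(k, kb)].

    Adding up over [n <= T / dt] steps bounds the energy of the error by
    [(T + T ^ 2) * dx ^ (2 * min(k, kb) - 1)], up to constants and the
    exponential; the largest error is at most the square root of the energy,
    whence the half power of [dx] that is lost.  When [dx > 1] the numerical
    solution and the exact averages are bounded separately
    ([error_coarse]). *)

(** * Parseval's identity and the contraction property of the stencil *)

Arguments expi : simpl never.

Lemma expiD (R : realType) (x y : R) : expi (x + y) = expi x * expi y.
Proof.
rewrite /expi cosD sinD; apply/eqP; rewrite eq_complex /=.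
by apply/andP; split => //; apply/eqP; ring.
Qed.

Lemma expi0 (R : realType) : expi (0 : R) = 1.
Proof. by rewrite /expi cos0 sin0. Qed.

Lemma expiX (R : realType) (x : R) n : expi x ^+ n = expi (n%:R * x).
Proof.
elim: n => [|n IH]; first by rewrite expr0 mul0r expi0.
by rewrite exprS IH -expiD -natr1 mulrDl mul1r addrC.
Qed.

Lemma conjc_expi (R : realType) (x : R) : conjc (expi x) = expi (- x).
Proof. by rewrite /expi /= cosN sinN. Qed.

Lemma sqr_normc (R : rcfType) (z : R[i]) :
  ((Normc.normc z) ^+ 2)%:C%C = z * conjc z.
Proof.
case: z => x y /=; rewrite sqr_sqrtr ?addr_ge0 ?sqr_ge0 //.
by apply/eqP; rewrite eq_complex /=; apply/andP; split; apply/eqP; ring.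
Qed.

Lemma normc_expi (R : realType) (x : R) : Normc.normc (expi x) = 1.
Proof. by rewrite /expi /= cos2Dsin2 sqrtr1. Qed.

Lemma expi_2pi_nat (R : realType) n : expi (n%:R * (2 * pi)) = 1 :> R[i].
Proof.
rewrite -expiX /expi.
by rewrite (_ : 2 * pi = pi *+ 2) ?cos2pi ?sin2pi ?expr1n // mulr_natl.
Qed.

Lemma expi_neq1 (R : realType) (x : R) : 0 < x < 2 * pi -> expi x != 1.
Proof.
move=> /andP[x0 xpi]; rewrite /expi eq_complex /= negb_and; apply/orP; left.
have xE : x = (x / 2) *+ 2 by rewrite -mulr_natr divfK.
have s0 : 0 < sin (x / 2) by apply: sin_gt0_pi; lra.
have s2 : 0 < sin (x / 2) ^+ 2 by rewrite exprn_gt0.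
have := cos2Dsin2 (x / 2); rewrite xE cos_mulr2n -xE => cs.
by apply/eqP => c1; move: c1 cs; rewrite mulr2n; lra.
Qed.

(** The characters of a cyclic group are orthogonal. *)
Lemma sum_expi_eq0 (R : realType) (N i j : nat) :
  (i < N)%N -> (j < N)%N -> i != j ->
  \sum_(k < N) (expi (- (i%:R * (2 * pi / N%:R))) *
                expi (j%:R * (2 * pi / N%:R))) ^+ k = 0 :> R[i].
Proof.
have pi0 : 0 < pi :> R := pi_gt0 R.
wlog lt_ij : i j / (i < j)%N => [hw iN jN|iN jN _].
  case: ltngtP => // lt_ij _; first by apply: hw => //; rewrite neq_ltn lt_ij.
  have := hw j i lt_ij jN iN; rewrite neq_ltn lt_ij => /(_ isT) /eqP.
  rewrite -conjc_eq0 rmorph_sum => /eqP {2}<-; apply: eq_bigr => k _.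
  rewrite rmorphXn rmorphM [in RHS]mulrC; congr ((_ * _) ^+ k);
    by apply/esym; apply: etrans (conjc_expi _) _; rewrite ?opprK.
have N0 : 0 < N%:R :> R by rewrite ltr0n; lia.
rewrite -expiD; set y := (X in expi X).
have yE : y = (j - i)%:R * (2 * pi / N%:R).
  by rewrite /y natrB ?(ltnW lt_ij) //; ring.
have zN : expi y ^+ N = 1.
  rewrite expiX yE (_ : _ * _ = (j - i)%:R * (2 * pi)) ?expi_2pi_nat //.
  by field; rewrite gt_eqF.
have z1 : expi y != 1.
  apply: expi_neq1; rewrite yE; apply/andP; split.
    by rewrite mulr_gt0 ?ltr0n ?subn_gt0 ?divr_gt0 ?mulr_gt0.
  rewrite mulrA ltr_pdivrMr // [ltRHS]mulrC ltr_pM2r ?mulr_gt0 //.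
  by rewrite ltr_nat; lia.
by have /eqP := subrX1 (expi y) N;
  rewrite zN subrr eq_sym mulf_eq0 subr_eq0 (negPf z1) => /eqP.
Qed.

Lemma parseval (R : realType) (P : {poly R}) (N : nat) : (size P <= N)%N ->
  \sum_(k < N) Normc.normc
     (map_poly (real_complex R) P).[expi (- (k%:R * (2 * pi / N%:R)))] ^+ 2 =
  N%:R * \sum_(i < N) P`_i ^+ 2.
Proof.
pose cj : {rmorphism R[i] -> R[i]} := conjc.
have cj_expi (x : R) : cj (expi x) = expi (- x) := conjc_expi x.
have cj_real (x : R) : cj x%:C%C = x%:C%C := conjc_real x.
have cj_norm z : ((Normc.normc z) ^+ 2)%:C%C = z * cj z := sqr_normc z.
move=> sP; apply: (@complexI R); rewrite rmorph_sum rmorphM rmorph_nat.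
rewrite rmorph_sum big_distrr /=.
transitivity (\sum_(k < N) \sum_(i < N) \sum_(j < N)
   ((P`_i * P`_j)%:C%C * (expi (- (i%:R * (2 * pi / N%:R))) *
                expi (j%:R * (2 * pi / N%:R))) ^+ k)).
  apply: eq_bigr => k _; rewrite cj_norm.
  rewrite (@horner_coef_wide _ N) ?size_map_poly // rmorph_sum big_distrlr /=.
  apply: eq_bigr => i _; apply: eq_bigr => j _; rewrite !coef_map /=.
  rewrite rmorphM rmorphXn cj_expi opprK cj_real exprMn.
  have -> : (- (k%:R * (2 * pi / N%:R))) = k%:R * (- (2 * pi / N%:R)) :> R.
    by rewrite mulrN.
  have -> : (- (i%:R * (2 * pi / N%:R))) = i%:R * (- (2 * pi / N%:R)) :> R.
    by rewrite mulrN.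
  rewrite -!expiX !(exprAC _ k) rmorphM; ring.
rewrite exchange_big /=; apply: eq_bigr => i _.
rewrite exchange_big /= (bigD1 i) //= [X in _ + X]big1 ?addr0.
  rewrite -big_distrr /= -expiD addNr expi0.
  under eq_bigr do rewrite expr1n.
  by rewrite sumr_const card_ord mulrC expr2.
move=> j ji; rewrite -big_distrr /= sum_expi_eq0 ?mulr0 ?ltn_ord //.
by rewrite eq_sym; apply: contra_neq ji => /val_inj.
Qed.

Lemma poly_mul_contraction (R : realType) (P Q : {poly R}) (N : nat) :
  (size (Q * P)%R <= N)%N -> (size P <= N)%N ->
  (forall theta : R, 0 <= theta <= 2 * pi ->
     Normc.normc (map_poly (real_complex R) Q).[expi (- theta)] <= 1) ->
  \sum_(i < N) (Q * P)`_i ^+ 2 <= \sum_(i < N) P`_i ^+ 2.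
Proof.
move=> sQP sP hQ.
have [N0|N0] := posnP N; first by rewrite N0 !big_ord0.
have NR : 0 < N%:R :> R by rewrite ltr0n.
have pi0 : 0 < pi :> R := pi_gt0 R.
rewrite -(ler_pM2l NR) -!parseval //; apply: ler_sum => k _.
rewrite rmorphM hornerM Normc.normcM exprMn ler_piMl ?sqr_ge0 //.
have := hQ (k%:R * (2 * pi / N%:R)).
set z := Normc.normc _ => hz.
have z0 : 0 <= z by rewrite /z; case: (_.[_]) => x y; exact: sqrtr_ge0.
rewrite expr_le1 // hz // mulr_ge0 ?divr_ge0 ?mulr_ge0 ?(ltW pi0) ?(ltW NR) //=.
rewrite mulrA ler_pdivrMr // mulrC ler_pM2l ?mulr_gt0 // ler_nat.
exact: ltnW.
Qed.

(** The stencil acts on finitely supported sequences as the multiplication of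
    their generating polynomials by a polynomial of modulus at most 1 on the
    unit circle, so that it does not increase the sum of squares. *)
Lemma stencil_contraction (R : realType) (r p : nat) (a_ : int -> R)
    (v : int -> R) (M M' : nat) :
  (forall theta : R, 0 <= theta <= 2 * pi ->
     Normc.normc (symbol r p a_ theta) <= 1) ->
  (forall j : int, j <= 0 -> v j = 0) ->
  (forall j : int, M%:Z < j -> v j = 0) ->
  \sum_(0 <= i < M')
     (stencil_sum r p (fun l => a_ l * v (1 + i%:Z + l))) ^+ 2 <=
  \sum_(0 <= i < M) v (1 + i%:Z) ^+ 2.
Proof.
move=> hs v0 vM.
(* [Q * V] has the outputs of the stencil as coefficients, shifted by [p]. *)
pose V := \poly_(i < M) v (1 + i%:Z).
pose Q := \poly_(i < (r + p).+1) a_ (p%:Z - i%:Z).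
have VE (i : nat) : V`_i = v (1 + i%:Z).
  by rewrite coef_poly; case: ltnP => // Mi; rewrite vM //; lia.
have QVE (i : nat) : (Q * V)`_(i + p) =
    stencil_sum r p (fun l => a_ l * v (1 + i%:Z + l)).
  rewrite coefM /stencil_sum big_mkord.
  rewrite [RHS](reindex_inj rev_ord_inj) /=.
  transitivity (\sum_(j < (r + p).+1) Q`_j * v (1 + (i + p)%:Z - j%:Z)).
    rewrite (big_ord_widen_cond (i + p + r).+1 xpredT
        (fun j : nat => Q`_j * V`_(i + p - j))) /=; last by lia.
    rewrite [RHS](big_ord_widen_cond (i + p + r).+1 xpredT
        (fun j : nat => Q`_j * v (1 + (i + p)%:Z - j%:Z))) /=; last by lia.
    rewrite big_mkcond [RHS]big_mkcond /=; apply: eq_bigr => j _.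
    case: ltnP => h1; case: ltnP => h2 //.
    - by rewrite VE; congr (_ * v _); lia.
    - by rewrite /Q coef_poly ltnNge h2 /= mul0r.
    - by rewrite v0 ?mulr0 //; lia.
  apply: eq_bigr => j _; rewrite coef_poly ltn_ord.
  have jr : (j <= r + p)%N by rewrite -ltnS.
  by congr (a_ _ * v _); lia.
have hQ (theta : R) : 0 <= theta <= 2 * pi ->
    Normc.normc (map_poly (real_complex R) Q).[expi (- theta)] <= 1.
  move=> /hs; congr (_ <= _).
  have -> : symbol r p a_ theta =
      (map_poly (real_complex R) Q).[expi (- theta)] * expi (p%:R * theta).
    rewrite /symbol (@horner_coef_wide _ (r + p).+1); last first.
      by rewrite size_map_poly size_poly.
    rewrite big_distrl /stencil_sum big_mkord.
    rewrite [LHS](reindex_inj rev_ord_inj) /=.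
    apply: eq_bigr => j _; rewrite coef_map coef_poly ltn_ord /=.
    have jr : (j <= r + p)%N by rewrite -ltnS.
    rewrite expiX -mulrA -expiD; congr ((a_ _)%:C%C * expi _); first by lia.
    have -> : ((r + p).+1 - j.+1)%N%:Z - r%:Z = p%:Z - j%:Z by lia.
    by rewrite intrB; ring.
  by rewrite Normc.normcM normc_expi mulr1.
pose N := (size Q + size V + M + M' + p)%N.
have sQV : (size (Q * V)%R <= N)%N.
  apply: leq_trans (size_polyMleq _ _) _; apply: leq_trans (leq_pred _) _.
  by rewrite /N -!addnA addnA leq_addr.
have sV : (size V <= N)%N.
  by rewrite /N -!addnA addnCA leq_addr.
have := poly_mul_contraction sQV sV hQ.
have -> : \sum_(i < N) V`_i ^+ 2 = \sum_(0 <= i < M) v (1 + i%:Z) ^+ 2.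
  rewrite big_mkord [RHS](big_ord_widen N (fun i : nat => v (1 + i%:Z) ^+ 2)) /=;
    last by rewrite /N; lia.
  rewrite [RHS]big_mkcond /=; apply: eq_bigr => i _; rewrite VE.
  by case: ltnP => // Mi; rewrite vM ?expr0n //=; lia.
apply: le_trans.
rewrite -(big_mkord xpredT (fun i => (Q * V)`_i ^+ 2)).
rewrite [leRHS](@big_cat_nat _ _ _ p) //=; last by rewrite /N leq_addl.
rewrite -[leLHS]add0r lerD ?sumr_ge0 // => [i _|]; first exact: sqr_ge0.
have -> : \sum_(p <= i < N) (Q * V)`_i ^+ 2 =
    \sum_(0 <= i < N - p) (Q * V)`_(i + p) ^+ 2.
  by rewrite -{1}[p]add0n big_addn.
rewrite [leRHS](@big_cat_nat _ _ _ M') //=; last first.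
  by rewrite /N addnK leq_addl.
rewrite -[leLHS]addr0 lerD ?sumr_ge0 // => [|i _]; last exact: sqr_ge0.
by apply: ler_sum => i _; rewrite QVE.
Qed.

(** The preprocessing of [lia] scans the whole context; discarding the
    hypotheses about real numbers keeps it fast. *)
Ltac int_lia :=
  try match goal with R : realType |- _ =>
    repeat match goal with H : context [R] |- _ => clear H end
  end; lia.

(** * Sums over windows of consecutive integers *)

Definition wsum (R : realType) (f : int -> R) (x : int) (n : nat) : R :=
  \sum_(0 <= i < n) f (x + i%:Z).

Definition energy (R : realType) (v : int -> R) (x : int) (n : nat) : R :=
  wsum (fun j => v j ^+ 2) x n.

Section WindowSums.
Context (R : realType).
Implicit Types (f g v : int -> R) (x y j : int) (n m : nat).

Lemma wsum0 f x : wsum f x 0 = 0.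
Proof. by rewrite /wsum big_geq. Qed.

Lemma wsumS f x n : wsum f x n.+1 = wsum f x n + f (x + n%:Z).
Proof. by rewrite /wsum big_nat_recr. Qed.

Lemma wsum_cat f x m n :
  wsum f x (m + n) = wsum f x m + wsum f (x + m%:Z) n.
Proof.
elim: n => [|n IH]; first by rewrite addn0 wsum0 addr0.
by rewrite addnS !wsumS IH addrA; congr (_ + f _); lia.
Qed.

Lemma wsumSl f x n : wsum f x n.+1 = f x + wsum f (x + 1) n.
Proof. by rewrite -[n.+1]add1n wsum_cat wsumS wsum0 add0r addr0. Qed.

Lemma le_wsum f g x n : (forall j, x <= j < x + n%:Z -> f j <= g j) ->
  wsum f x n <= wsum g x n.
Proof.
move=> fg; elim: n fg => [|n IH] fg; first by rewrite !wsum0.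
rewrite !wsumS lerD ?IH ?fg //; last by lia.
by move=> j jn; apply: fg; lia.
Qed.

Lemma eq_wsum f g x n : (forall j, x <= j < x + n%:Z -> f j = g j) ->
  wsum f x n = wsum g x n.
Proof.
by move=> fg; apply/eqP; rewrite eq_le !le_wsum // => j jn; rewrite fg.
Qed.

Lemma wsum_cst (c : R) x n : wsum (fun=> c) x n = n%:R * c.
Proof.
elim: n => [|n IH]; first by rewrite wsum0 mul0r.
by rewrite wsumS IH -natr1 mulrDl mul1r.
Qed.

Lemma wsumD f g x n :
  wsum (fun j => f j + g j) x n = wsum f x n + wsum g x n.
Proof. exact: big_split. Qed.

Lemma wsumZ (c : R) f x n : wsum (fun j => c * f j) x n = c * wsum f x n.
Proof. by rewrite /wsum -big_distrr. Qed.

Lemma wsum_ge0 f x n : (forall j, 0 <= f j) -> 0 <= wsum f x n.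
Proof. by move=> f0; apply: sumr_ge0. Qed.

Lemma energy_ge0 v x n : 0 <= energy v x n.
Proof. by apply: wsum_ge0 => j; exact: sqr_ge0. Qed.

Lemma wsum_subwindow f x y n m : (forall j, 0 <= f j) ->
  y <= x -> x + n%:Z <= y + m%:Z -> wsum f x n <= wsum f y m.
Proof.
move=> f0 yx nm.
have [d xE] : exists d : nat, x = y + d%:Z by exists `|x - y|%N; lia.
have -> : m = (d + (n + (m - (d + n))))%N by lia.
rewrite !wsum_cat -xE addrCA -[leLHS]addr0 lerD2l addr_ge0 //; exact: wsum_ge0.
Qed.

Lemma wsum_window f x y n m : (forall j, 0 <= f j) ->
  (forall j, j < y -> f j = 0) -> x + n%:Z <= y + m%:Z ->
  wsum f x n <= wsum f y m.
Proof.
move=> f0 fy nm; case: (lerP y x) => yx; first exact: wsum_subwindow.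
have [d yE] : exists d : nat, y = x + d%:Z by exists `|y - x|%N; lia.
have f0x : wsum f x d = 0.
  rewrite -(mulr0 d%:R) -(wsum_cst 0 x) ; apply: eq_wsum => j jd.
  by apply: fy; lia.
rewrite -[leRHS]add0r -f0x yE -wsum_cat.
have -> : (d + m)%N = (n + (d + m - n))%N by lia.
by rewrite wsum_cat -[leLHS]addr0 lerD2l wsum_ge0.
Qed.

Lemma le_wsum_term f x n j : (forall i, 0 <= f i) -> x <= j < x + n%:Z ->
  f j <= wsum f x n.
Proof.
move=> f0 jn; have -> : f j = wsum f j 1 by rewrite wsumS wsum0 add0r addr0.
by apply: wsum_subwindow => //; lia.
Qed.

Lemma sqr_sum_le (F : nat -> R) n :
  (\sum_(0 <= i < n) F i) ^+ 2 <= n%:R * \sum_(0 <= i < n) F i ^+ 2.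
Proof.
elim: n => [|n IH]; first by rewrite !big_geq // expr0n /= mulr0.
rewrite !big_nat_recr //= -natr1.
move: IH; set S := \sum_(_ <= _ < _) _; set Q := \sum_(_ <= _ < _) _ => IH.
have [n0|n0] := posnP n.
  rewrite /S /Q n0 !big_geq //=; nra.
have nR : 0 < n%:R :> R by rewrite ltr0n.
have h : n%:R * (2 * S * F n) <= n%:R * (Q + n%:R * F n ^+ 2).
  have := sqr_ge0 (S - n%:R * F n); nra.
by rewrite ler_pM2l // in h; nra.
Qed.

Lemma sqr_wsum_le f x n : wsum f x n ^+ 2 <= n%:R * energy f x n.
Proof. exact: sqr_sum_le. Qed.

Lemma dist_wsum_backward_diff v x n j j' :
  x - 1 <= j < x + n%:Z -> x - 1 <= j' < x + n%:Z ->
  `|v j - v j'| <= wsum (fun i => `|backward_diff v i|) x n.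
Proof.
wlog jj : j j' / j <= j' => [hw jx j'x|jx j'x].
  case: (lerP j j') => jj'; first exact: hw.
  by rewrite distrC; apply: hw => //; exact: ltW.
have [d j'E] : exists d : nat, j' = j + d%:Z by exists `|j' - j|%N; lia.
apply: le_trans (_ : wsum (fun i => `|backward_diff v i|) (j + 1) d <= _).
  rewrite {j'x jj}j'E; elim: d => [|d IH]; first by rewrite addr0 subrr normr0 wsum0.
  rewrite wsumS; have -> : v j - v (j + d.+1%:Z) =
      (v j - v (j + d%:Z)) - backward_diff v (j + 1 + d%:Z).
    rewrite /backward_diff.
    have -> : j + 1 + d%:Z - 1 = j + d%:Z by lia.
    have -> : j + 1 + d%:Z = j + d.+1%:Z by lia.
    by ring.
  by apply: le_trans (ler_normB _ _) _; rewrite lerD2r.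
by apply: wsum_subwindow => //; lia.
Qed.

End WindowSums.

(** * Energy estimates for one step of the scheme near the outflow boundary *)

Definition stencil (R : realType) (r p : nat) (a_ : int -> R) (v : int -> R)
    (j : int) : R :=
  stencil_sum r p (fun l => a_ l * v (j + l)).

Section StencilSums.
Context (R : realType) (r p : nat).
Implicit Types F G : int -> R.

Lemma le_stencil_sum F G :
  (forall l : int, - r%:Z <= l <= p%:Z -> F l <= G l) ->
  stencil_sum r p F <= stencil_sum r p G.
Proof.
move=> FG; rewrite /stencil_sum !big_mkord; apply: ler_sum => i _.
by apply: FG; have := ltn_ord i; lia.
Qed.

Lemma eq_stencil_sum F G :
  (forall l : int, - r%:Z <= l <= p%:Z -> F l = G l) ->
  stencil_sum r p F = stencil_sum r p G.
Proof.
by move=> FG; apply/eqP; rewrite eq_le !le_stencil_sum // => l hl; rewrite FG.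
Qed.

Lemma stencil_sumD F G :
  stencil_sum r p (fun l => F l + G l) = stencil_sum r p F + stencil_sum r p G.
Proof. exact: big_split. Qed.

Lemma stencil_sumZ (c : R) F :
  stencil_sum r p (fun l => c * F l) = c * stencil_sum r p F.
Proof. by rewrite /stencil_sum -big_distrr. Qed.

Lemma stencil_sum_ge0 F : (forall l, 0 <= F l) -> 0 <= stencil_sum r p F.
Proof. by move=> F0; apply: sumr_ge0. Qed.

Lemma ler_norm_stencil_sum F :
  `|stencil_sum r p F| <= stencil_sum r p (fun l => `|F l|).
Proof. exact: ler_norm_sum. Qed.

Lemma sqr_stencil_sum_le F :
  stencil_sum r p F ^+ 2 <= (r + p).+1%:R * stencil_sum r p (fun l => F l ^+ 2).
Proof. exact: sqr_sum_le. Qed.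

Lemma wsum_stencil_sum (F : int -> int -> R) (x : int) (n : nat) :
  wsum (fun j => stencil_sum r p (F j)) x n =
  stencil_sum r p (fun l => wsum (fun j => F j l) x n).
Proof. exact: exchange_big. Qed.

Lemma wsum_shift (f : int -> R) (x l : int) n :
  wsum (fun j => f (j + l)) x n = wsum f (x + l) n.
Proof. by apply: eq_bigr => i _; congr f; lia. Qed.

Lemma stencil_ext (a_ v v' : int -> R) (j : int) :
  (forall i, j - r%:Z <= i <= j + p%:Z -> v i = v' i) ->
  stencil r p a_ v j = stencil r p a_ v' j.
Proof.
by move=> vv'; apply: eq_stencil_sum => l hl; rewrite vv' //; lia.
Qed.

End StencilSums.
Section BoundaryEnergy.
Context (R : realType) (r p : nat) (a_ : int -> R).
Hypothesis stable : forall theta : R, 0 <= theta <= 2 * pi ->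
  Normc.normc (symbol r p a_ theta) <= 1.
Local Notation A := (stencil r p a_).
Local Notation q := (r + p)%N.

Lemma energy_stencil_le (v : int -> R) (M M' : nat) :
  (forall j : int, j <= 0 -> v j = 0) ->
  (forall j : int, M%:Z < j -> v j = 0) ->
  energy (A v) 1 M' <= energy v 1 M.
Proof. by move=> v0 vM; exact: stencil_contraction. Qed.

(** What a sequence, once prolonged so as to vanish far beyond [J], gains there
    bounds what the original one loses up to [J]. *)
Lemma energy_stencil_prolong (v w : int -> R) (J n : nat) :
  (forall j : int, j <= 0 -> w j = 0) ->
  (forall j : int, (J + n)%:Z < j -> w j = 0) ->
  (forall j : int, j <= J%:Z + p%:Z -> w j = v j) ->
  energy (A v) 1 J <=
  energy v 1 J + (energy w (J%:Z + 1) n - energy (A w) (J%:Z + 1) n).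
Proof.
move=> w0 wn wv.
have := energy_stencil_le (J + n) w0 wn.
rewrite /energy !wsum_cat [1 + J%:Z]addrC.
have -> : wsum (fun j => A w j ^+ 2) 1 J = wsum (fun j => A v j ^+ 2) 1 J.
  apply: eq_wsum => j jJ; congr (_ ^+ 2).
  by apply: stencil_ext => i ij; apply: wv; lia.
have -> : wsum (fun j => w j ^+ 2) 1 J = wsum (fun j => v j ^+ 2) 1 J.
  by apply: eq_wsum => j jJ; rewrite wv //; lia.
lra.
Qed.

(** Only the sign of the square of [A w j - w j] is used, which makes the bound
    a sum of quantities that telescope and of squared differences. *)
Lemma sqr_stencil_ge (w : int -> R) (j : int) :
  stencil_sum r p a_ = 1 ->
  w j ^+ 2 - A w j ^+ 2 <=
  stencil_sum r p (fun l => - a_ l * (w (j + l) ^+ 2 - w j ^+ 2)) +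
  stencil_sum r p (fun l => a_ l * (w (j + l) - w j) ^+ 2).
Proof.
move=> a1; rewrite -stencil_sumD.
have -> : stencil_sum r p (fun l => - a_ l * (w (j + l) ^+ 2 - w j ^+ 2) +
    a_ l * (w (j + l) - w j) ^+ 2) =
  stencil_sum r p (fun l => - (2 * w j) * (a_ l * w (j + l)) +
     2 * w j ^+ 2 * a_ l).
  by apply: eq_stencil_sum => l _; ring.
rewrite stencil_sumD !stencil_sumZ a1 -/(stencil r p a_ w j).
have := sqr_ge0 (A w j - w j); nra.
Qed.

(** The flux of the squares through [J]: moving a window by [l] changes the
    energy by [l] times the squared boundary value, up to the oscillation. *)
Lemma energy_shift (w : int -> R) (J n : nat) (c d : R) :
  (r <= n)%N ->
  (forall j : int, (J + n)%:Z - r%:Z < j -> w j = 0) ->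
  (forall j : int, J%:Z - r%:Z < j <= J%:Z + p%:Z -> `|w j - c| <= d) ->
  forall l : int, - r%:Z <= l <= p%:Z ->
  `|energy w (J%:Z + 1 + l) n - energy w (J%:Z + 1) n + l%:~R * c ^+ 2| <=
  `|l|%:~R * (2 * `|c| * d + d ^+ 2).
Proof.
move=> rn wn wc.
set eta := 2 * `|c| * d + d ^+ 2.
have sqE (j : int) : J%:Z - r%:Z < j <= J%:Z + p%:Z ->
    `|w j ^+ 2 - c ^+ 2| <= eta.
  move=> /wc hw; have d0 : 0 <= d := le_trans (normr_ge0 _) hw.
  have -> : w j ^+ 2 - c ^+ 2 = 2 * c * (w j - c) + (w j - c) ^+ 2 by ring.
  apply: le_trans (ler_normD _ _) _.
  rewrite (normrX 2 (w j - c)) 2!normrM normr_nat.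
  have := normr_ge0 c; have := normr_ge0 (w j - c); rewrite /eta; nra.
have step (l : int) : - r%:Z < l <= p%:Z ->
    energy w (J%:Z + 1 + l) n =
    energy w (J%:Z + 1 + (l - 1)) n - w (J%:Z + l) ^+ 2.
  move=> hl; have := wsumSl (fun j => w j ^+ 2) (J%:Z + 1 + (l - 1)) n.
  rewrite wsumS [w (J%:Z + 1 + (l - 1) + n%:Z)]wn ?expr0n /= ?addr0; last by lia.
  rewrite /energy => ->.
  have -> : J%:Z + 1 + (l - 1) + 1 = J%:Z + 1 + l by lia.
  have -> : J%:Z + 1 + (l - 1) = J%:Z + l by lia.
  by ring.
have pos (m : nat) : (m <= p)%N ->
    `|energy w (J%:Z + 1 + m%:Z) n - energy w (J%:Z + 1) n + m%:R * c ^+ 2| <=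
    m%:R * eta.
  elim: m => [|m IH] mp; first by rewrite addr0 subrr mul0r mul0r add0r normr0.
  rewrite step; last by lia.
  have -> : J%:Z + 1 + (m.+1%:Z - 1) = J%:Z + 1 + m%:Z by lia.
  set e := energy _ _ _; set e' := energy _ _ _; rewrite -natr1.
  have -> : e - w (J%:Z + m.+1%:Z) ^+ 2 - e' + (m%:R + 1) * c ^+ 2 =
    (e - e' + m%:R * c ^+ 2) - (w (J%:Z + m.+1%:Z) ^+ 2 - c ^+ 2) by ring.
  apply: le_trans (ler_normB _ _) _; rewrite mulrDl mul1r lerD ?IH ?(ltnW mp) //.
  by apply: sqE; lia.
have neg (m : nat) : (m <= r)%N ->
    `|energy w (J%:Z + 1 - m%:Z) n - energy w (J%:Z + 1) n - m%:R * c ^+ 2| <=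
    m%:R * eta.
  elim: m => [|m IH] mp; first by rewrite subr0 subrr mul0r mul0r subr0 normr0.
  have := step (- m%:Z); rewrite (_ : _ + 1 + (- _ - 1) = J%:Z + 1 - m.+1%:Z);
    last by lia.
  set e := energy _ _ _; set e' := energy _ _ _ => h.
  have -> : e' = energy w (J%:Z + 1 - m%:Z) n + w (J%:Z - m%:Z) ^+ 2.
    by rewrite -/e h ?subrK //; lia.
  move: (IH (ltnW mp)); rewrite -/e; set e2 := energy _ _ _ => {}IH.
  rewrite -natr1.
  have -> : e + w (J%:Z - m%:Z) ^+ 2 - e2 - (m%:R + 1) * c ^+ 2 =
    (e - e2 - m%:R * c ^+ 2) + (w (J%:Z - m%:Z) ^+ 2 - c ^+ 2) by ring.
  apply: le_trans (ler_normD _ _) _; rewrite mulrDl mul1r lerD ?IH ?(ltnW mp) //.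
  by apply: sqE; lia.
move=> [m|m] hl; first by apply: pos; lia.
have -> : Negz m = - m.+1%:Z by lia.
by rewrite normrN mulrNz mulNr; apply: neg; lia.
Qed.

Definition ramp (M : nat) (x : int) : R :=
  Num.max 0 (Num.min 1 (1 - x%:~R / M%:R)).

Lemma ramp_lipschitz (M : nat) (x y : int) : (0 < M)%N ->
  `|ramp M x - ramp M y| <= `|x - y|%:~R / M%:R.
Proof.
move=> M0; have MR : 0 < M%:R :> R by rewrite ltr0n.
have cut (s t : R) :
    `|Num.max 0 (Num.min 1 s) - Num.max 0 (Num.min 1 t)| <= `|s - t|.
  have h1 := ler_norm (s - t).
  have h2 : t - s <= `|s - t| by rewrite distrC ler_norm.
  rewrite /Order.max /Order.min.
  case: (ltP 1 s) => hs; case: (ltP 1 t) => ht; rewrite ?ltr01;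
    [|case: (ltP 0 t) => ?|case: (ltP 0 s) => ?
     |case: (ltP 0 s) => ?; case: (ltP 0 t) => ?]; rewrite ler_norml; lra.
apply: le_trans (cut _ _) _.
have -> : 1 - x%:~R / M%:R - (1 - y%:~R / M%:R) = - ((x - y)%:~R / M%:R) :> R.
  by rewrite intrB; ring.
by rewrite normrN normrM normfV -intr_norm (ger0_norm (ltW MR)).
Qed.

Lemma ramp_eq1 M (x : int) : x <= 0 -> ramp M x = 1.
Proof.
move=> x0; rewrite /ramp min_l ?max_r // lerBrDr -lerBrDl subrr.
by rewrite mulr_le0_ge0 ?invr_ge0 // lerz0.
Qed.

Lemma ramp_eq0 M (x : int) : (0 < M)%N -> M%:Z <= x -> ramp M x = 0.
Proof.
move=> M0 Mx; have MR : 0 < M%:R :> R by rewrite ltr0n.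
rewrite /ramp max_l // ge_min; apply/orP; right.
rewrite subr_le0 ler_pdivlMr // mul1r.
by rewrite -[M%:R]/(M%:Z%:~R) ler_int.
Qed.

(** Because [mu > 0], the energy flows out through [J], so that the boundary
    values are controlled as soon as the sequence is nearly constant there.  The
    sequence is prolonged by its boundary value times a slowly decreasing ramp:
    up to the oscillation near [J], the sums of shifted squares telescope to
    [- mu * v J ^+ 2], and the slope of the ramp only costs a fraction [O(1 / M)]
    of it. *)
Lemma outflow_energy (mu : R) : (0 < r)%N -> 0 < mu ->
  stencil_sum r p a_ = 1 ->
  stencil_sum r p (fun l => l%:~R * a_ l) = - mu ->
  exists c C : R, [/\ 0 < c, 0 < C & forall (J : nat) (v : int -> R),
    (forall j : int, j <= 0 -> v j = 0) ->
    energy (A v) 1 J <= energy v 1 J - c * energy v (J%:Z + 1 - r%:Z) q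
       + C * energy (backward_diff v) (J%:Z + 1 - r%:Z) q].
Proof.
move=> r0 mu0 a1 amu.
set A0 := stencil_sum r p (fun l => `|a_ l|).
set A1 := stencil_sum r p (fun l => `|a_ l| * `|l|%:~R).
have A0_ge0 : 0 <= A0 by apply: stencil_sum_ge0.
have A1_ge0 : 0 <= A1.
  by apply: stencil_sum_ge0 => l; rewrite mulr_ge0 // ler0z.
have qR : 0 < q%:R :> R by rewrite ltr0n; int_lia.
(* The length of the ramp is such that its cost is at most [mu / 4]. *)
have [M M0 [qM hM]] : exists2 M : nat, (0 < M)%N &
    q%:R <= M%:R :> R /\ 16 * A0 * q%:R ^+ 2 <= mu * M%:R.
  exists (maxn q (Num.truncn (16 * A0 * q%:R ^+ 2 / mu)).+1).
    by rewrite leq_max orbT.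
  split; first by rewrite ler_nat leq_maxl.
  rewrite [leRHS]mulrC -ler_pdivrMr //; apply: ltW.
  by apply: lt_le_trans (truncnS_gt _) _; rewrite ler_nat leq_maxr.
have MR : 0 < M%:R :> R by rewrite ltr0n.
pose n := (p + M + r)%N.
pose C3 := A1 + 4 * A1 ^+ 2 / mu + 8 * A0 * n%:R.
have C3_ge0 : 0 <= C3.
  apply: addr_ge0; last by rewrite !mulr_ge0.
  apply: addr_ge0 => //; apply: divr_ge0; last exact: ltW.
  by rewrite mulr_ge0 ?sqr_ge0.
exists (mu / (4 * q%:R)), (q%:R * (C3 + mu)); split.
- by rewrite divr_gt0 ?mulr_gt0.
- by rewrite mulr_gt0 // ltr_wpDl.
move=> J v v0.
set c := v J%:Z.
set d := wsum (fun i => `|backward_diff v i|) (J%:Z + 1 - r%:Z) q.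
have d0 : 0 <= d by apply: wsum_ge0.
have d2 : d ^+ 2 <= q%:R * energy (backward_diff v) (J%:Z + 1 - r%:Z) q.
  apply: le_trans (sqr_wsum_le _ _ _) _; rewrite ler_pM2l //.
  by apply: le_wsum => j _; rewrite real_normK ?num_real.
have vc (j : int) : J%:Z - r%:Z <= j <= J%:Z + p%:Z -> `|v j - c| <= d.
  by move=> hj; apply: dist_wsum_backward_diff; int_lia.
pose s (j : int) := ramp M (j - J%:Z - p%:Z).
pose w (j : int) := if j <= J%:Z + p%:Z then v j else c * s j.
have wv (j : int) : j <= J%:Z + p%:Z -> w j = v j by rewrite /w => ->.
have w0 (j : int) : j <= 0 -> w j = 0 by move=> j0; rewrite wv ?v0 //; int_lia.
have wn (j : int) : (J + n)%:Z - r%:Z < j -> w j = 0.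
  by move=> jn; rewrite /w ifF; [rewrite /s ramp_eq0 ?mulr0 //; int_lia|int_lia].
have ws (j : int) : J%:Z - r%:Z <= j -> `|w j - c * s j| <= d.
  move=> jJ; rewrite /w; case: ifP => jp; last by rewrite subrr normr0.
  by rewrite /s ramp_eq1 ?mulr1 ?vc //; int_lia.
have wc (j : int) : J%:Z - r%:Z < j <= J%:Z + p%:Z -> `|w j - c| <= d.
  by move=> /andP[jr jp]; rewrite wv ?vc //; int_lia.
set eta := 2 * `|c| * d + d ^+ 2.
have wD (j l : int) : J%:Z + 1 <= j -> - r%:Z <= l <= p%:Z ->
    (w (j + l) - w j) ^+ 2 <= 2 * (c ^+ 2 * q%:R ^+ 2 / M%:R ^+ 2) + 8 * d ^+ 2.
  move=> hj hl.
  have h : `|w (j + l) - w j| <= `|c| * (q%:R / M%:R) + 2 * d.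
    have -> : w (j + l) - w j = c * (s (j + l) - s j) +
       ((w (j + l) - c * s (j + l)) - (w j - c * s j)) by ring.
    apply: le_trans (ler_normD _ _) _; apply: lerD.
      rewrite normrM ler_wpM2l //; apply: le_trans (ramp_lipschitz _ _ M0) _.
      rewrite ler_pM2r ?invr_gt0 // -[q%:R]/(q%:Z%:~R) ler_int; int_lia.
    apply: le_trans (ler_normB _ _) _; rewrite mulrDl mul1r lerD ?ws //; int_lia.
  have -> : c ^+ 2 * q%:R ^+ 2 / M%:R ^+ 2 = (`|c| * (q%:R / M%:R)) ^+ 2.
    by rewrite -[c ^+ 2]real_normK ?num_real // !exprMn exprVn mulrA.
  move: h; set x := `|c| * _ => h.
  have x0 : 0 <= x by rewrite mulr_ge0 ?divr_ge0.
  rewrite -[_ ^+ 2]real_normK ?num_real //.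
  apply: le_trans (_ : (x + 2 * d) ^+ 2 <= _).
    by rewrite ler_sqr ?nnegrE ?addr_ge0 ?mulr_ge0.
  have := sqr_ge0 (x - 2 * d); nra.
have gain : energy w (J%:Z + 1) n - energy (A w) (J%:Z + 1) n <=
    - mu * c ^+ 2 + A1 * eta +
    A0 * (n%:R * (2 * (c ^+ 2 * q%:R ^+ 2 / M%:R ^+ 2) + 8 * d ^+ 2)).
  rewrite -[X in _ - X]mul1r -mulNr -wsumZ -wsumD.
  apply: le_trans (_ : wsum (fun j =>
      stencil_sum r p (fun l => - a_ l * (w (j + l) ^+ 2 - w j ^+ 2)) +
      stencil_sum r p (fun l => a_ l * (w (j + l) - w j) ^+ 2)) (J%:Z + 1) n <= _).
    by apply: le_wsum => j _; rewrite mulN1r sqr_stencil_ge.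
  rewrite wsumD !wsum_stencil_sum; apply: lerD.
    have -> : - mu * c ^+ 2 + A1 * eta =
       stencil_sum r p (fun l => c ^+ 2 * (l%:~R * a_ l) +
          eta * (`|a_ l| * `|l|%:~R)).
      by rewrite stencil_sumD !stencil_sumZ amu -/A1; ring.
    apply: le_stencil_sum => l hl.
    rewrite wsumZ.
    have -> : wsum (fun j => w (j + l) ^+ 2 - w j ^+ 2) (J%:Z + 1) n =
        energy w (J%:Z + 1 + l) n - energy w (J%:Z + 1) n.
      rewrite /energy -(wsum_shift (fun j => w j ^+ 2)).
      by rewrite -[X in _ - X]mul1r -mulNr -wsumZ -wsumD;
        apply: eq_wsum => j _; rewrite mulN1r.
    have rn : (r <= n)%N by rewrite /n; int_lia.
    have := energy_shift rn wn wc hl; set D := _ - _ => hD.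
    have -> : - a_ l * D = c ^+ 2 * (l%:~R * a_ l) - a_ l * (D + l%:~R * c ^+ 2).
      by ring.
    rewrite lerD2l; apply: le_trans (ler_norm _) _; rewrite normrN normrM.
    by rewrite [leRHS]mulrCA ler_wpM2l // [leRHS]mulrC.
  rewrite mulrC -stencil_sumZ; apply: le_stencil_sum => l hl.
  rewrite wsumZ mulrC; apply: le_trans (ler_norm _) _; rewrite normrM.
  rewrite ler_wpM2r // ger0_norm; last by apply: wsum_ge0 => j; exact: sqr_ge0.
  by rewrite -(wsum_cst _ (J%:Z + 1)); apply: le_wsum => j jn; apply: wD; int_lia.
apply: le_trans (energy_stencil_prolong (n := n) w0 _ wv) _.
  by move=> j jn; apply: wn; int_lia.
rewrite -addrA lerD2l; apply: le_trans gain _.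
have slope : A0 * (n%:R * (2 * (c ^+ 2 * q%:R ^+ 2 / M%:R ^+ 2))) <=
    mu / 4 * c ^+ 2.
  rewrite !mulrA ler_pdivrMr ?exprn_gt0 //.
  have nM : n%:R <= 2 * M%:R :> R.
    have -> : n%:R = q%:R + M%:R :> R by rewrite -natrD; congr _%:R; rewrite /n; int_lia.
    by rewrite mulrDl mul1r lerD2r.
  have c2 := sqr_ge0 c.
  have h1 : A0 * n%:R <= A0 * (2 * M%:R) by rewrite ler_wpM2l.
  have h2 : (A0 * q%:R ^+ 2) * (n%:R) <= (A0 * q%:R ^+ 2) * (2 * M%:R).
    by rewrite ler_wpM2l // mulr_ge0 // sqr_ge0.
  have h3 : 16 * (A0 * q%:R ^+ 2) * M%:R <= mu * M%:R * M%:R.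
    by rewrite ler_wpM2r ?(ltW MR) // mulrA.
  have h4 : 2 * ((A0 * q%:R ^+ 2) * n%:R) <= mu / 4 * M%:R ^+ 2.
    by rewrite expr2; lra.
  have := ler_wpM2r c2 h4; congr (_ <= _); ring.
have cross : A1 * eta <= mu / 4 * c ^+ 2 + (A1 + 4 * A1 ^+ 2 / mu) * d ^+ 2.
  have -> : c ^+ 2 = `|c| ^+ 2 by rewrite real_normK ?num_real.
  rewrite /eta.
  have := sqr_ge0 (mu / 4 * `|c| - A1 * d) => sq.
  have : 0 <= (mu / 4 * `|c| - A1 * d) ^+ 2 * (4 / mu).
    by rewrite mulr_ge0 ?divr_ge0 ?(ltW mu0).
  have -> : (mu / 4 * `|c| - A1 * d) ^+ 2 * (4 / mu) =
     mu / 4 * `|c| ^+ 2 - 2 * A1 * `|c| * d + 4 * A1 ^+ 2 / mu * d ^+ 2.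
    by field; rewrite gt_eqF.
  lra.
have trace : energy v (J%:Z + 1 - r%:Z) q <= q%:R * (2 * c ^+ 2 + 2 * d ^+ 2).
  rewrite -(wsum_cst _ (J%:Z + 1 - r%:Z)); apply: le_wsum => j jq.
  have /ler_normlP [h1 h2] : `|v j - c| <= d by apply: vc; int_lia.
  have := sqr_ge0 (v j - 2 * c); nra.
have trace' : mu / (4 * q%:R) * energy v (J%:Z + 1 - r%:Z) q <=
    mu / 2 * c ^+ 2 + mu / 2 * d ^+ 2.
  have k0 : 0 <= mu / (4 * q%:R) by rewrite divr_ge0 ?mulr_ge0 ?(ltW mu0).
  have := ler_wpM2l k0 trace; congr (_ <= _).
  by field; rewrite -natrD gt_eqF.
have := ler_wpM2l (addr_ge0 C3_ge0 (ltW mu0)) d2.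
set E' := energy (backward_diff v) _ _.
have -> : q%:R * (C3 + mu) * E' = (C3 + mu) * (q%:R * E') by ring.
have -> : (C3 + mu) * d ^+ 2 = (A1 + 4 * A1 ^+ 2 / mu) * d ^+ 2 +
    A0 * (n%:R * (8 * d ^+ 2)) + mu * d ^+ 2 by rewrite /C3; ring.
rewrite [n%:R * (_ + _)]mulrDr [A0 * (_ + _)]mulrDr.
have : 0 <= mu * d ^+ 2 by rewrite mulr_ge0 ?sqr_ge0 ?ltW.
move: (A0 * (n%:R * (8 * _))) (A0 * _) slope (A1 * _) cross trace'.
by move=> X Y hY Z hZ; lra.
Qed.

End BoundaryEnergy.
Section DirichletEnergy.
Context (R : realType) (r p : nat) (a_ : int -> R).
Hypothesis stable : forall theta : R, 0 <= theta <= 2 * pi ->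
  Normc.normc (symbol r p a_ theta) <= 1.
Hypothesis r_gt0 : (0 < r)%N.
Hypothesis ar_neq0 : a_ (- r%:Z) != 0.
Local Notation A := (stencil r p a_).
Local Notation q := (r + p)%N.

(** The outputs beyond [J] of a sequence that vanishes beyond [J + p] form a
    triangular system, with [a_ (- r)] on the diagonal, for its last values. *)
Lemma energy_le_outputs (i : nat) : (i <= r)%N ->
  exists2 K : R, 0 < K & forall (J : nat) (w : int -> R),
    (forall j : int, (J + p)%:Z < j -> w j = 0) ->
    energy w (J%:Z + 1 - i%:Z) (p + i) <=
    K * (energy (A w) (J%:Z + 1) q + energy w (J%:Z + 1) p).
Proof.
elim: i => [|i IH] ir.
  exists 1 => // J w wJ; rewrite subr0 addn0 mul1r lerDr; exact: energy_ge0.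
have [K K0 hK] := IH (ltnW ir).
set S2 := stencil_sum r p (fun l => a_ l ^+ 2).
have S2_ge0 : 0 <= S2 by apply: stencil_sum_ge0 => l; exact: sqr_ge0.
set b := a_ (- r%:Z) ^+ 2.
have b0 : 0 < b by rewrite exprn_even_gt0.
exists (K + 2 / b * (1 + q%:R * (S2 * K))).
  rewrite ltr_wpDr //; apply: mulr_ge0; first by rewrite divr_ge0 ?(ltW b0).
  by rewrite addr_ge0 // !mulr_ge0 // ltW.
move=> J w wJ; move: (hK J w wJ).
set X := energy (A w) _ _; set G := energy w (J%:Z + 1) p.
set Y := energy w _ _ => hY.
have X0 : 0 <= X := energy_ge0 _ _ _; have G0 : 0 <= G := energy_ge0 _ _ _.
have Y0 : 0 <= Y := energy_ge0 _ _ _.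
have -> : energy w (J%:Z + 1 - i.+1%:Z) (p + i.+1) = w (J%:Z - i%:Z) ^+ 2 + Y.
  rewrite addnS /energy wsumSl.
  have -> : J%:Z + 1 - i.+1%:Z + 1 = J%:Z + 1 - i%:Z by int_lia.
  by have -> : J%:Z + 1 - i.+1%:Z = J%:Z - i%:Z by int_lia.
set x := w (J%:Z - i%:Z).
pose rest := \sum_(0 <= s < q) a_ (s.+1%:Z - r%:Z) * w (J%:Z - i%:Z + s.+1%:Z).
have AE : A w (J%:Z - i%:Z + r%:Z) = a_ (- r%:Z) * x + rest.
  rewrite /stencil /stencil_sum big_nat_recl //; congr (_ + _).
    by rewrite sub0r addrK.
  by apply: eq_bigr => s _; congr (_ * w _); int_lia.
have rest2 : rest ^+ 2 <= q%:R * (S2 * Y).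
  apply: le_trans (sqr_sum_le _ _) _; rewrite ler_wpM2l //.
  apply: le_trans (_ : \sum_(0 <= s < q) a_ (s.+1%:Z - r%:Z) ^+ 2 * Y <= _).
    apply: ler_sum => s _; rewrite exprMn ler_wpM2l ?sqr_ge0 //.
    case: (lerP (J%:Z - i%:Z + s.+1%:Z) (J + p)%:Z) => hs; last first.
      by rewrite wJ // expr0n.
    by apply: (le_wsum_term (f := fun j => w j ^+ 2)) => [j|];
      [exact: sqr_ge0|int_lia].
  rewrite -big_distrl ler_wpM2r //= /S2 /stencil_sum big_nat_recl //=.
  by rewrite lerDr sqr_ge0.
have AX : A w (J%:Z - i%:Z + r%:Z) ^+ 2 <= X.
  by apply: (le_wsum_term (f := fun j => A w j ^+ 2)) => [j|];
    [exact: sqr_ge0|int_lia].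
have x2 : b * x ^+ 2 <= 2 * (X + q%:R * (S2 * Y)).
  have -> : b * x ^+ 2 = (A w (J%:Z - i%:Z + r%:Z) - rest) ^+ 2.
    by rewrite AE /b; ring.
  have := sqr_ge0 (A w (J%:Z - i%:Z + r%:Z) + rest); lra.
have h1 : q%:R * (S2 * Y) <= q%:R * (S2 * K) * (X + G).
  by rewrite -!mulrA ler_wpM2l // ler_wpM2l.
rewrite mulrDl [leRHS]addrC lerD //.
rewrite (_ : 2 / b * _ * _ = 2 * ((1 + q%:R * (S2 * K)) * (X + G)) / b);
  last by ring.
rewrite ler_pdivlMr // mulrC.
by apply: le_trans x2 _; rewrite ler_pM2l // mulrDl mul1r lerD // lerDl.
Qed.

(** The sequence is cut off beyond its ghost values.  The contraction on the
    whole line then also counts the outputs beyond [J], and these control the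
    last values. *)
Lemma dirichlet_energy :
  exists c C : R, [/\ 0 < c, 0 < C & forall (J : nat) (v : int -> R),
    (forall j : int, j <= 0 -> v j = 0) ->
    energy (A v) 1 J <= energy v 1 J - c * energy v (J%:Z + 1 - r%:Z) q
       + C * energy v (J%:Z + 1) p].
Proof.
have [K K0 hK] := energy_le_outputs (leqnn r).
exists K^-1, 2; split; rewrite ?invr_gt0 // => J v v0.
pose w (j : int) := if j <= (J + p)%:Z then v j else 0.
have wv (j : int) : j <= J%:Z + p%:Z -> w j = v j.
  by move=> jJ; rewrite /w ifT //; int_lia.
have wJ (j : int) : (J + p)%:Z < j -> w j = 0.
  by move=> jJ; rewrite /w ifF //; int_lia.
have w0 (j : int) : j <= 0 -> w j = 0.
  by move=> j0; rewrite wv ?v0 //; int_lia.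
have wJq (j : int) : (J + q)%:Z < j -> w j = 0 by move=> jJ; apply: wJ; int_lia.
apply: le_trans (energy_stencil_prolong stable w0 wJq wv) _.
move: (hK J w wJ); set X := energy (A w) _ _.
have -> : energy w (J%:Z + 1) p = energy v (J%:Z + 1) p.
  by apply: eq_wsum => j jp; rewrite wv //; int_lia.
have -> : energy w (J%:Z + 1 - r%:Z) (p + r) = energy v (J%:Z + 1 - r%:Z) q.
  by rewrite addnC; apply: eq_wsum => j jp; rewrite wv //; int_lia.
have -> : energy w (J%:Z + 1) q = energy v (J%:Z + 1) p.
  rewrite addnC /energy wsum_cat [X in _ + X](_ : _ = 0) ?addr0.
    by apply: eq_wsum => j jp; rewrite wv //; int_lia.
  rewrite -(mulr0 r%:R) -(wsum_cst _ (J%:Z + 1 + p%:Z)).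
  by apply: eq_wsum => j jp; rewrite wJ ?expr0n //; int_lia.
rewrite mulrC -ler_pdivrMr // mulrC.
have := energy_ge0 v (J%:Z + 1) p; lra.
Qed.

End DirichletEnergy.

(** * Iterated backward differences *)

Section BackwardDifferences.
Context (R : realType).
Implicit Types (v : int -> R) (j : int) (m n : nat).
Local Notation D := (@backward_diff R).

Lemma iter_backward_diffS m v j :
  iter m.+1 D v j = iter m D v j - iter m D v (j - 1).
Proof. by []. Qed.

Lemma iter_backward_diff_local m v v' j :
  (forall i, j - m%:Z <= i <= j -> v i = v' i) ->
  iter m D v j = iter m D v' j.
Proof.
elim: m j => [|m IH] j vv'; first by apply: vv'; lia.
by rewrite !iter_backward_diffS !IH // => i hi; apply: vv'; lia.
Qed.

Lemma iter_backward_diff0 m v : (forall j, j <= 0 -> v j = 0) ->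
  forall j, j <= 0 -> iter m D v j = 0.
Proof.
move=> v0; elim: m => [|m IH] j j0; first exact: v0.
by rewrite iter_backward_diffS !IH ?subrr //; lia.
Qed.

Lemma iter_backward_diffD m v v' j :
  iter m D (fun i => v i + v' i) j = iter m D v j + iter m D v' j.
Proof.
by elim: m j => [//|m IH] j; rewrite !iter_backward_diffS !IH; ring.
Qed.

Lemma iter_backward_diff_stencil r p a_ m v j :
  iter m D (stencil r p a_ v) j = stencil r p a_ (iter m D v) j.
Proof.
elim: m j => [//|m IH] j; rewrite iter_backward_diffS !IH /stencil.
rewrite -[X in _ - X]mul1r -mulNr -stencil_sumZ -stencil_sumD.
apply: eq_stencil_sum => l _; rewrite iter_backward_diffS.
by rewrite (_ : j - 1 + l = j + l - 1); [ring|lia].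
Qed.

Lemma le_iter_backward_diff m v j (B : R) :
  (forall i, j - m%:Z <= i <= j -> `|v i| <= B) ->
  `|iter m D v j| <= 2 ^+ m * B.
Proof.
elim: m j => [|m IH] j hv; first by rewrite mul1r hv //; lia.
rewrite iter_backward_diffS exprS -mulrA mulr_natl mulr2n.
by apply: le_trans (ler_normB _ _) _; apply: lerD; apply: IH => i hi;
  apply: hv; lia.
Qed.

Lemma energy_iter_backward_diff m v n : (forall j, j <= 0 -> v j = 0) ->
  energy (iter m D v) 1 n <= 4 ^+ m * energy v 1 n.
Proof.
move=> v0; elim: m => [|m IH]; first by rewrite mul1r.
have w0 := iter_backward_diff0 m v0.
rewrite exprS -mulrA; apply: le_trans (_ : 4 * energy (iter m D v) 1 n <= _);
  last by rewrite ler_pM2l.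
set w := iter m D v.
apply: le_trans (_ : wsum (fun j => 2 * w j ^+ 2 + 2 * w (j + -1) ^+ 2) 1 n <= _).
  apply: le_wsum => j _; rewrite iter_backward_diffS -/w.
  by have := sqr_ge0 (w j + w (j - 1)); lra.
rewrite wsumD !wsumZ (wsum_shift (fun j => w j ^+ 2)).
have : wsum (fun j => w j ^+ 2) (1 + -1) n <= energy w 1 n.
  apply: wsum_window; [|move=> j j1|lia].
    by move=> j; exact: sqr_ge0.
  by rewrite /w w0 ?expr0n //; lia.
by rewrite -/(energy w 1 n); lra.
Qed.

End BackwardDifferences.
(** * Stability of the scheme with extrapolated outflow values *)

(** Young's inequality; with [t] of order [1 / J] or [1 / N], the factor
    [1 + t] may be repeated at every time step. *)
Lemma sqr_addr_le (R : realType) (t x y : R) : 0 < t ->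
  (x + y) ^+ 2 <= (1 + t) * x ^+ 2 + (1 + t^-1) * y ^+ 2.
Proof.
move=> t0; have h : 0 <= (t * x - y) ^+ 2 * t^-1.
  by rewrite mulr_ge0 ?sqr_ge0 ?invr_ge0 ?ltW.
rewrite (_ : _ * t^-1 = t * x ^+ 2 - 2 * x * y + t^-1 * y ^+ 2) in h; first lra.
by field; rewrite gt_eqF.
Qed.

(** The differences of order [m >= 1] are multiplied by a weight that vanishes
    near the inflow boundary, where they do not satisfy the scheme, is close to
    [1] near the outflow boundary, and varies by [O(1 / J)] between neighbours. *)
Definition weight (R : realType) (J kb m : nat) (j : int) : R :=
  if m is 0%N then 1 else (Num.max 0 (j - kb%:Z))%:~R / J%:R.

Definition weighted_diff (R : realType) (J kb m : nat) (v : int -> R)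
    (j : int) : R :=
  weight R J kb m j * iter m (@backward_diff R) v j.

Section Stability.
Context (R : realType) (r p : nat) (a_ : int -> R) (kb : nat).
Local Notation A := (stencil r p a_).
Local Notation q := (r + p)%N.
Local Notation D := (@backward_diff R).
Local Notation W := (weight R).
Local Notation wdiff J := (@weighted_diff R J kb).

Section Weight.
Context (J : nat) (J_gt0 : (0 < J)%N).
Let JR : 0 < J%:R :> R. Proof. by rewrite ltr0n. Qed.

Lemma weight_lipschitz m (i j : int) :
  `|W J kb m i - W J kb m j| <= `|i - j|%:~R / J%:R.
Proof.
case: m => [|m]; first by rewrite subrr normr0 divr_ge0 ?ler0z.
rewrite /weight -mulrBl normrM normfV (gtr0_norm JR) ler_pM2r ?invr_gt0 //.
by rewrite -intrB -intr_norm ler_int; lia.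
Qed.

Lemma weight_ge0 m j : 0 <= W J kb m j.
Proof. by case: m => [|m] //=; rewrite divr_ge0 // ler0z; lia. Qed.

Lemma weight_le1 m (j : int) : j <= J%:Z -> W J kb m j <= 1.
Proof.
case: m => [//|m] jJ; rewrite /weight ler_pdivrMr // mul1r.
by rewrite -[J%:R]/(J%:Z%:~R) ler_int; lia.
Qed.

Lemma weight_le m (j : int) : j <= J%:Z + p%:Z -> W J kb m j <= 1 + p%:R.
Proof.
case: m => [|m] jJ; first by rewrite lerDl.
rewrite /weight ler_pdivrMr //.
apply: le_trans (_ : (J + p)%:R <= _).
  by rewrite -[(J + p)%:R]/((J + p)%:Z%:~R) ler_int; lia.
rewrite natrD mulrDl mul1r lerD2l -[leLHS]mulr1 ler_wpM2l // ler1n //.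
Qed.

Lemma weight_eq0 m (j : int) : (0 < m)%N -> j <= kb%:Z -> W J kb m j = 0.
Proof. by case: m => [//|m] _ jk; rewrite /weight max_l ?mul0r //; lia. Qed.

Lemma weight_near1 m (j : int) : J%:Z + 1 - r%:Z <= j <= J%:Z + p%:Z ->
  `|1 - W J kb m j| <= (kb + q)%:R / J%:R.
Proof.
move=> hj; case: m => [|m]; first by rewrite subrr normr0 divr_ge0.
rewrite /weight -[X in X - _](@divff _ J%:R) ?gt_eqF // -mulrBl normrM normfV.
rewrite (gtr0_norm JR) ler_pM2r ?invr_gt0 //.
rewrite -[J%:R]/(J%:Z%:~R) -intrB -intr_norm -[(kb + q)%:R]/((kb + q)%:Z%:~R).
by rewrite ler_int; lia.
Qed.

Lemma energy_weighted_diff_le m v n : (n <= J)%N ->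
  energy (wdiff J m v) 1 n <= energy (iter m D v) 1 n.
Proof.
move=> nJ; apply: le_wsum => j hj; rewrite exprMn ler_piMl ?sqr_ge0 //.
by rewrite expr_le1 ?weight_ge0 // weight_le1 //; lia.
Qed.

End Weight.

(** The differences of order [kb] beyond [J] being data, those of lower order
    are recovered by summing at most [p] terms, starting from the interior. *)
Lemma energy_ghost_le : exists2 C : R, 1 <= C & forall (J : nat) (v : int -> R) (b : R),
  (forall j, j <= 0 -> v j = 0) ->
  (forall l : int, 1 <= l <= p%:Z -> `|iter kb D v (J%:Z + l)| <= b) ->
  0 <= b -> energy v 1 (J + p) <= C * (energy v 1 J + b ^+ 2).
Proof.
pose K : R := (1 + p%:R) ^+ kb.
have K0 : 0 <= K by rewrite exprn_ge0 // addr_ge0.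
exists (1 + p%:R * (2 * (K ^+ 2) * (4 ^+ kb + 1))).
  by rewrite lerDl !mulr_ge0 ?addr_ge0 ?exprn_ge0.
move=> J v b v0 vb b0.
set E := energy v 1 J; pose B := Num.sqrt E.
have E0 : 0 <= E := energy_ge0 _ _ _.
have B0 : 0 <= B := sqrtr_ge0 _.
have B2 : B ^+ 2 = E by rewrite sqr_sqrtr.
have vB (j : int) : j <= J%:Z -> `|v j| <= B.
  move=> jJ; case: (lerP j 0) => j0; first by rewrite v0 // normr0.
  rewrite -ler_sqr ?nnegrE // B2 real_normK ?num_real //.
  by apply: (le_wsum_term (f := fun j => v j ^+ 2)) => [i|];
    [exact: sqr_ge0|int_lia].
set X := 2 ^+ kb * B + b.
have X0 : 0 <= X by rewrite addr_ge0 ?mulr_ge0 ?exprn_ge0.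
have key (d : nat) : (d <= kb)%N -> forall j : int, j <= J%:Z + p%:Z ->
    `|iter (kb - d) D v j| <= (1 + p%:R) ^+ d * X.
  elim: d => [|d IH] dk j jJ.
    rewrite subn0 mul1r; case: (lerP j J%:Z) => jJ'.
      apply: le_trans (_ : 2 ^+ kb * B <= _); last by rewrite lerDl.
      by apply: le_iter_backward_diff => i hi; apply: vB; int_lia.
    have -> : j = J%:Z + (j - J%:Z) by int_lia.
    apply: le_trans (vb _ _) _; first by int_lia.
    by rewrite lerDr mulr_ge0 ?exprn_ge0.
  have base (i : int) : i <= J%:Z -> `|iter (kb - d.+1) D v i| <= X.
    move=> iJ; apply: le_trans (_ : 2 ^+ (kb - d.+1) * B <= _).
      by apply: le_iter_backward_diff => i' hi; apply: vB; int_lia.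
    apply: le_trans (_ : 2 ^+ kb * B <= _); last by rewrite lerDl.
    by rewrite ler_wpM2r // ler_weXn2l ?ler1n // leq_subr.
  have P1 : 1 <= (1 + p%:R) ^+ d :> R by rewrite exprn_ege1 // lerDl.
  have step (n : nat) : (n <= p)%N ->
      `|iter (kb - d.+1) D v (J%:Z + n%:Z)| <=
      X + n%:R * ((1 + p%:R) ^+ d * X).
    elim: n => [|n IHn] np; first by rewrite mul0r !addr0 base.
    have -> : iter (kb - d.+1) D v (J%:Z + n.+1%:Z) =
        iter (kb - d.+1) D v (J%:Z + n%:Z) + iter (kb - d) D v (J%:Z + n.+1%:Z).
      have -> : (kb - d)%N = (kb - d.+1).+1 by int_lia.
      rewrite iter_backward_diffS.
      by rewrite (_ : J%:Z + n.+1%:Z - 1 = J%:Z + n%:Z); [ring|int_lia].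
    apply: le_trans (ler_normD _ _) _; rewrite -natr1 mulrDl mul1r addrA lerD //.
      by apply: IHn; int_lia.
    by apply: IH; int_lia.
  have PX : X <= (1 + p%:R) ^+ d * X by rewrite ler_peMl.
  rewrite exprS -mulrA mulrDl mul1r.
  case: (lerP j J%:Z) => jJ'.
    by apply: le_trans (base _ jJ') _; rewrite ler_wpDr // mulr_ge0 // (le_trans X0).
  have -> : j = J%:Z + `|j - J%:Z|%N%:Z by int_lia.
  apply: le_trans (step _ _) _; first by int_lia.
  by rewrite lerD // ler_wpM2r ?(le_trans X0) // ler_nat; int_lia.
rewrite /energy wsum_cat -/(energy v 1 J) -/E mulrDl mul1r -addrA lerD2l.
apply: le_trans (_ : p%:R * (K * X) ^+ 2 <= _).
  rewrite -(wsum_cst _ (1 + J%:Z)); apply: le_wsum => j hj.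
  rewrite -[v j ^+ 2]real_normK ?num_real // ler_sqr ?nnegrE ?mulr_ge0 //.
  by have := key kb (leqnn _) j; rewrite subnn /=; apply; int_lia.
rewrite -mulrA; apply: ler_wpDl; first exact: sqr_ge0.
rewrite ler_wpM2l // exprMn.
have -> : 4 ^+ kb = (2 ^+ kb) ^+ 2 :> R by rewrite exprAC; congr (_ ^+ _); ring.
rewrite [leRHS](_ : _ = K ^+ 2 * (2 * ((2 ^+ kb) ^+ 2 + 1) * (E + b ^+ 2)));
  last by ring.
rewrite ler_wpM2l ?sqr_ge0 // -B2 /X; move: (2 ^+ kb) => t.
have := sqr_ge0 (t * B - b); have := sqr_ge0 (t * b); have := sqr_ge0 B.
by have := sqr_ge0 b; nra.
Qed.

(** The commutator of the stencil with the weights, applied to the differences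
    of order [m]. *)
Definition weight_commutator (J m : nat) (v : int -> R) (j : int) : R :=
  stencil_sum r p (fun l =>
    a_ l * ((W J kb m j - W J kb m (j + l)) * iter m D v (j + l))).

(** The differences of order [m] at [j] involve the cells from [j - m] on, where
    the scheme holds if [j > kb]; elsewhere the weight vanishes
    if [m > 0]. *)
Lemma weighted_diff_step (J m : nat) (v v' F : int -> R) :
  (0 < J)%N -> (m <= kb)%N ->
  (forall j : int, 1 <= j <= J%:Z -> v' j = A v j + F j) ->
  forall j : int, 1 <= j <= J%:Z ->
  wdiff J m v' j = A (wdiff J m v) j + weight_commutator J m v j +
    W J kb m j * iter m D F j.
Proof.
move=> J0 mk hv j hj.
transitivity (W J kb m j * (A (iter m D v) j + iter m D F j)); last first.
  rewrite mulrDr; congr (_ + _).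
  rewrite /stencil /weight_commutator -stencil_sumZ -stencil_sumD.
  by apply: eq_stencil_sum => l _; rewrite /weighted_diff; ring.
case: (posnP m) => [m0|m0].
  by rewrite /weighted_diff m0 /= !mul1r hv.
case: (lerP j kb%:Z) => jk.
  by rewrite /weighted_diff weight_eq0 // !mul0r.
rewrite /weighted_diff; congr (_ * _).
rewrite -iter_backward_diff_stencil -iter_backward_diffD.
by apply: iter_backward_diff_local => i hi; apply: hv; int_lia.
Qed.

Lemma energy_weight_commutator (J m : nat) (v : int -> R) :
  (0 < J)%N -> (m <= kb)%N -> (forall j : int, j <= 0 -> v j = 0) ->
  energy (weight_commutator J m v) 1 J <=
  q.+1%:R * stencil_sum r p (fun l => (a_ l * l%:~R) ^+ 2) * 4 ^+ kb *
    energy v 1 (J + p) / J%:R ^+ 2.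
Proof.
move=> J0 mk v0; have JR : 0 < J%:R :> R by rewrite ltr0n.
have w0 := iter_backward_diff0 m v0.
apply: le_trans (_ : wsum (fun j => q.+1%:R * stencil_sum r p (fun l =>
    (a_ l * l%:~R) ^+ 2 / J%:R ^+ 2 * iter m D v (j + l) ^+ 2)) 1 J <= _).
  apply: le_wsum => j _; apply: le_trans (sqr_stencil_sum_le _ _ _) _.
  rewrite ler_wpM2l //; apply: le_stencil_sum => l _.
  set w := W J kb m j - _; set y := iter m D v _.
  have w2 : w ^+ 2 <= l%:~R ^+ 2 / J%:R ^+ 2.
    rewrite -[leLHS]real_normK ?num_real // -exprVn -exprMn.
    rewrite -[leRHS]real_normK ?num_real // ler_sqr ?nnegrE //.
    apply: le_trans (weight_lipschitz J0 _ _ _) _.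
    rewrite normrM normfV (gtr0_norm JR) ler_pM2r ?invr_gt0 // -intr_norm ler_int.
    by int_lia.
  rewrite [leLHS](_ : _ = a_ l ^+ 2 * w ^+ 2 * y ^+ 2); last by ring.
  rewrite [leRHS](_ : _ = a_ l ^+ 2 * (l%:~R ^+ 2 / J%:R ^+ 2) * y ^+ 2).
    by rewrite ler_wpM2r ?sqr_ge0 // ler_wpM2l ?sqr_ge0.
  by ring.
set X := 4 ^+ kb * energy v 1 (J + p).
rewrite wsumZ wsum_stencil_sum.
rewrite [leRHS](_ : _ = q.+1%:R * stencil_sum r p (fun l =>
    X / J%:R ^+ 2 * (a_ l * l%:~R) ^+ 2)); last first.
  by rewrite stencil_sumZ /X; ring.
rewrite ler_wpM2l //; apply: le_stencil_sum => l hl.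
rewrite wsumZ -mulrA [leRHS]mulrC ler_wpM2l ?sqr_ge0 //.
rewrite [leLHS]mulrC ler_wpM2r ?invr_ge0 ?exprn_ge0 //.
rewrite (wsum_shift (fun j => iter m D v j ^+ 2)).
apply: le_trans (_ : energy (iter m D v) 1 (J + p) <= _).
  apply: wsum_window => [j|j j1|]; first exact: sqr_ge0.
    by rewrite w0 ?expr0n //; int_lia.
  by int_lia.
apply: le_trans (energy_iter_backward_diff _ _ v0) _.
by rewrite ler_wpM2r ?energy_ge0 // ler_weXn2l // ler1n.
Qed.

(** Near the outflow boundary the weights are close to [1], and nearly constant:
    differencing a level yields the next one, up to [O(1 / J)]. *)
Lemma energy_backward_diff_weighted (J m : nat) (v : int -> R) :
  (0 < J)%N -> (0 < r)%N -> (m < kb)%N -> (forall j : int, j <= 0 -> v j = 0) ->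
  energy (D (wdiff J m v)) (J%:Z + 1 - r%:Z) q <=
  2 * energy (wdiff J m.+1 v) (J%:Z + 1 - r%:Z) q +
  4 * (kb + q)%:R ^+ 2 * 4 ^+ kb * energy v 1 (J + p) / J%:R ^+ 2.
Proof.
move=> J0 r0 mk v0; have JR : 0 < J%:R :> R by rewrite ltr0n.
set k2 : R := (kb + q)%:R ^+ 2 / J%:R ^+ 2.
have k20 : 0 <= k2 by rewrite divr_ge0 ?sqr_ge0.
set E := energy v 1 (J + p).
have E0 : 0 <= E := energy_ge0 _ _ _.
have win (n : nat) (e : int) : (n <= kb)%N -> e <= 0 ->
    wsum (fun j => iter n D v (j + e) ^+ 2) (J%:Z + 1 - r%:Z) q <= 4 ^+ kb * E.
  move=> nk e0; rewrite (wsum_shift (fun j => iter n D v j ^+ 2)).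
  apply: le_trans (_ : energy (iter n D v) 1 (J + p) <= _).
    apply: wsum_window => [j|j j1|]; first exact: sqr_ge0.
      by rewrite iter_backward_diff0 ?expr0n //; int_lia.
    by int_lia.
  apply: le_trans (energy_iter_backward_diff _ _ v0) _.
  by rewrite ler_wpM2r // ler_weXn2l // ler1n.
have sq_le (x y : R) : `|x| <= (kb + q)%:R / J%:R -> (x * y) ^+ 2 <= k2 * y ^+ 2.
  move=> hx; rewrite exprMn ler_wpM2r ?sqr_ge0 // -[x ^+ 2]real_normK ?num_real //.
  by rewrite /k2 -exprVn -exprMn ler_sqr ?nnegrE ?divr_ge0.
apply: le_trans (_ : wsum (fun j => 2 * wdiff J m.+1 v j ^+ 2 +
   2 * (k2 * (iter m D v (j + -1) ^+ 2 + iter m.+1 D v (j + 0) ^+ 2)))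
   (J%:Z + 1 - r%:Z) q <= _).
  apply: le_wsum => j hj.
  have [z -> hz] : exists2 z, D (wdiff J m v) j = wdiff J m.+1 v j + z &
      z ^+ 2 <= k2 * (iter m D v (j + -1) ^+ 2 + iter m.+1 D v (j + 0) ^+ 2).
    case: m {mk} => [|m].
      exists ((1 - W J kb 1 j) * D v j).
        by rewrite /weighted_diff /backward_diff /= /backward_diff; ring.
      rewrite addr0 [k2 * _]mulrDr ler_wpDl ?(mulr_ge0 k20 (sqr_ge0 _)) //.
      by apply: sq_le; apply: weight_near1 => //; int_lia.
    exists ((W J kb m.+1 j - W J kb m.+1 (j - 1)) * iter m.+1 D v (j - 1)).
      rewrite /weighted_diff [D _ _]/backward_diff (iter_backward_diffS m.+1).
      by rewrite [W J kb m.+2 j](_ : _ = W J kb m.+1 j) //; ring.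
    rewrite [k2 * _]mulrDr ler_wpDr ?(mulr_ge0 k20 (sqr_ge0 _)) //.
    apply: sq_le; apply: le_trans (weight_lipschitz J0 _ _ _) _.
    rewrite ler_pM2r ?invr_gt0 // -[(kb + q)%:R]/((kb + q)%:Z%:~R) ler_int.
    by int_lia.
  by have := sqr_ge0 (wdiff J m.+1 v j - z); lra.
rewrite wsumD wsumZ lerD2l wsumZ wsumZ wsumD.
have h1 := win m (-1) (ltnW mk) isT; have h2 := win m.+1 0 mk isT.
rewrite [leRHS](_ : _ = 2 * (k2 * (4 ^+ kb * E + 4 ^+ kb * E))); last first.
  by rewrite /k2; ring.
by rewrite ler_pM2l // ler_wpM2l // lerD.
Qed.
Hypothesis stable : forall theta : R, 0 <= theta <= 2 * pi ->
  Normc.normc (symbol r p a_ theta) <= 1.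
Hypothesis r_gt0 : (0 < r)%N.
Hypothesis ar_neq0 : a_ (- r%:Z) != 0.
Variable mu : R.
Hypothesis mu_gt0 : 0 < mu.
Hypothesis sum_a : stencil_sum r p a_ = 1.
Hypothesis sum_la : stencil_sum r p (fun l => l%:~R * a_ l) = - mu.

Definition boundary_trace (J m : nat) (v : int -> R) : R :=
  if (m <= kb)%N then energy (wdiff J m v) (J%:Z + 1 - r%:Z) q else 0.

Lemma boundary_trace_ge0 J m v : 0 <= boundary_trace J m v.
Proof. by rewrite /boundary_trace; case: ifP => // _; exact: energy_ge0. Qed.

(** The boundary values of a level are paid for by its energy, up to those of
    the next level; at the last level the values beyond [J] are data. *)
Lemma level_energy : exists c C : R, [/\ 0 < c, 0 < C &
  forall (J m : nat) (v : int -> R) (b : R), (0 < J)%N -> (m <= kb)%N ->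
    (forall j : int, j <= 0 -> v j = 0) ->
    (forall l : int, 1 <= l <= p%:Z -> `|iter kb D v (J%:Z + l)| <= b) ->
    energy (A (wdiff J m v)) 1 J <=
    energy (wdiff J m v) 1 J - c * boundary_trace J m v
      + C * (boundary_trace J m.+1 v + energy v 1 (J + p) / J%:R + b ^+ 2)].
Proof.
have [c1 [C1 [c10 C10 hC1]]] := outflow_energy stable r_gt0 mu_gt0 sum_a sum_la.
have [c2 [C2 [c20 C20 hC2]]] := dirichlet_energy stable r_gt0 ar_neq0.
set K : R := 4 * (kb + q)%:R ^+ 2 * 4 ^+ kb.
have K0 : 0 <= K by rewrite !mulr_ge0 ?exprn_ge0.
set P : R := p%:R * (1 + p%:R) ^+ 2.
have P0 : 0 <= P by rewrite mulr_ge0 ?exprn_ge0 ?addr_ge0.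
exists (Num.min c1 c2), (C1 * (2 + K) + C2 * P + 1); split.
- by rewrite lt_min c10.
- have t1 : 0 <= C1 * (2 + K) by rewrite mulr_ge0 ?addr_ge0 // ltW.
  have t2 : 0 <= C2 * P by rewrite mulr_ge0 // ltW.
  by rewrite ltr_wpDl ?addr_ge0.
move=> J m v b J0 mk v0 vb.
have JR : 1 <= J%:R :> R by rewrite ler1n.
have T0 := boundary_trace_ge0 J m v; have T1 := boundary_trace_ge0 J m.+1 v.
set Q := energy v 1 (J + p); have Q0 : 0 <= Q := energy_ge0 _ _ _.
have w0 (j : int) : j <= 0 -> wdiff J m v j = 0.
  by move=> j0; rewrite /weighted_diff iter_backward_diff0 ?mulr0.
have QJ : Q / J%:R ^+ 2 <= Q / J%:R.
  rewrite ler_wpM2l // lef_pV2 ?posrE ?exprn_gt0 ?(lt_le_trans ltr01) //.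
  by rewrite expr2 ler_peMl // (le_trans ler01).
have QJ0 : 0 <= Q / J%:R by rewrite divr_ge0.
have b2 := sqr_ge0 b.
have C12K : 0 <= C1 * (2 + K) by rewrite mulr_ge0 ?addr_ge0 // ltW.
have C1K : 0 <= C1 * K by rewrite mulr_ge0 // ltW.
have C2P : 0 <= C2 * P by rewrite mulr_ge0 // ltW.
have [mk'|mk'] := ltnP m kb.
  apply: le_trans (hC1 J _ w0) _.
  have := energy_backward_diff_weighted J0 r_gt0 mk' v0; rewrite -/Q -/K => h.
  have {}h := ler_wpM2l (ltW C10) h.
  have hc : Num.min c1 c2 * boundary_trace J m v <= c1 * boundary_trace J m v.
    by rewrite ler_wpM2r // ge_min lexx.
  move: h hc T0 T1; rewrite /boundary_trace mk mk'.
  set T := energy (wdiff J m v) _ q; set T' := energy (wdiff J m.+1 v) _ q.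
  set DT := energy (D _) _ _; move=> h hc T0 T1.
  have h2 : C1 * K * (Q / J%:R ^+ 2) <= C1 * K * (Q / J%:R) by rewrite ler_wpM2l.
  have h3 : 0 <= C1 * K * T' by rewrite mulr_ge0.
  have h4 : 0 <= (C2 * P + 1) * (T' + Q / J%:R + b ^+ 2).
    by rewrite mulr_ge0 ?addr_ge0.
  have h5 : 0 <= C1 * (2 + K) * b ^+ 2.
    by rewrite mulr_ge0.
  have h6 : 0 <= C1 * 2 * (Q / J%:R).
    by rewrite mulr_ge0 // mulr_ge0 // ltW.
  rewrite [C1 * (2 * T' + _)](_ : _ = C1 * 2 * T' + C1 * K * (Q / J%:R ^+ 2)) in h;
    last by ring.
  rewrite [X in _ <= _ + X](_ : _ = C1 * 2 * T' + C1 * K * (Q / J%:R) +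
    C1 * K * T' + (C2 * P + 1) * (T' + Q / J%:R + b ^+ 2) +
    C1 * (2 + K) * b ^+ 2 + C1 * 2 * (Q / J%:R)); last by ring.
  by lra.
have mE : m = kb by apply/eqP; rewrite eqn_leq mk.
apply: le_trans (hC2 J _ w0) _.
have hc : Num.min c1 c2 * boundary_trace J m v <= c2 * boundary_trace J m v.
  by rewrite ler_wpM2r // ge_min lexx orbT.
have ghost : energy (wdiff J m v) (J%:Z + 1) p <= P * b ^+ 2.
  rewrite /P -mulrA -(wsum_cst _ (J%:Z + 1)); apply: le_wsum => j hj.
  rewrite exprMn; apply: ler_pM; rewrite ?sqr_ge0 //.
    rewrite ler_sqr ?nnegrE ?addr_ge0 ?weight_ge0 ?weight_le //.
    by int_lia.
  have := vb (j - J%:Z); rewrite [J%:Z + _]addrC subrK mE => h.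
  have {}h : `|iter kb D v j| <= b by apply: h; int_lia.
  rewrite -[leLHS]real_normK ?num_real // ler_sqr ?nnegrE //.
  exact: le_trans h.
have {}ghost := ler_wpM2l (ltW C20) ghost.
have TE : boundary_trace J m v = energy (wdiff J m v) (J%:Z + 1 - r%:Z) q.
  by rewrite /boundary_trace mk.
rewrite TE in hc *.
have h4 : 0 <= (C1 * (2 + K) + 1) * (boundary_trace J m.+1 v + Q / J%:R + b ^+ 2).
  by apply: mulr_ge0; rewrite !addr_ge0.
have h5 : 0 <= C2 * P * (boundary_trace J m.+1 v + Q / J%:R).
  by apply: mulr_ge0 => //; rewrite !addr_ge0.
rewrite [X in _ <= _ + X](_ : _ = C2 * (P * b ^+ 2) +
  (C1 * (2 + K) + 1) * (boundary_trace J m.+1 v + Q / J%:R + b ^+ 2) +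
  C2 * P * (boundary_trace J m.+1 v + Q / J%:R)); last by ring.
by lra.
Qed.

(** The commutator, of size [O(1 / J)], is split off at the cost of a factor
    [1 + 1 / J], and the source at the cost of a factor [1 + 1 / N]. *)
Lemma level_step : exists c C : R, [/\ 0 < c, 0 < C &
  forall (J N m : nat) (v v' F : int -> R) (b : R),
    (0 < J)%N -> (0 < N)%N -> (m <= kb)%N ->
    (forall j : int, j <= 0 -> v j = 0) -> (forall j : int, j <= 0 -> F j = 0) ->
    (forall j : int, 1 <= j <= J%:Z -> v' j = A v j + F j) ->
    (forall l : int, 1 <= l <= p%:Z -> `|iter kb D v (J%:Z + l)| <= b) ->
    energy (wdiff J m v') 1 J <= (1 + N%:R^-1) *
      (energy (wdiff J m v) 1 J - c * boundary_trace J m v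
       + C * (boundary_trace J m.+1 v + energy v 1 (J + p) / J%:R + b ^+ 2))
      + C * (N%:R * energy F 1 J)].
Proof.
have [c [C [c0 C0 hC]]] := level_energy.
set K := q.+1%:R * stencil_sum r p (fun l => (a_ l * l%:~R) ^+ 2) * 4 ^+ kb.
have K0 : 0 <= K.
  rewrite !mulr_ge0 ?exprn_ge0 //; apply: stencil_sum_ge0 => l; exact: sqr_ge0.
set k4 : R := 4 ^+ kb; have k40 : 0 <= k4 by rewrite exprn_ge0.
exists c, (2 * C + 2 * k4 + 2 * K); split => //.
  rewrite -addrA ltr_wpDr ?mulr_gt0 // addr_ge0 // mulr_ge0 //.
move=> J N m v v' F b J0 N0 mk v0 F0 hv vb.
have JR : 1 <= J%:R :> R by rewrite ler1n.
have NR : 1 <= N%:R :> R by rewrite ler1n.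
have Jp : 0 < J%:R :> R by apply: lt_le_trans JR.
have Np : 0 < N%:R :> R by apply: lt_le_trans NR.
have J1 : J%:R^-1 <= 1 :> R by rewrite invf_le1.
set Q := energy v 1 (J + p); have Q0 : 0 <= Q := energy_ge0 _ _ _.
set E := energy (wdiff J m v) 1 J; have E0 : 0 <= E := energy_ge0 _ _ _.
have T0 := boundary_trace_ge0 J m v; have T1 := boundary_trace_ge0 J m.+1 v.
move: (hC J m v b J0 mk v0 vb); rewrite -/Q -/E.
set X := energy (A _) 1 J; set Z := boundary_trace J m.+1 v + _ + _ => hX.
have Z0 : 0 <= Z by rewrite !addr_ge0 ?divr_ge0 ?sqr_ge0.
have QZ : Q / J%:R <= Z by rewrite /Z -addrA ler_wpDl // lerDl sqr_ge0.
have EQ : E <= k4 * Q.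
  apply: le_trans (energy_weighted_diff_le J0 _ _ (leqnn _)) _.
  apply: le_trans (energy_iter_backward_diff _ _ v0) _.
  apply: ler_pM; rewrite ?exprn_ge0 ?energy_ge0 //.
    by rewrite ler_weXn2l // ler1n.
  by apply: wsum_subwindow => //; [move=> j; exact: sqr_ge0|int_lia].
set G := energy (weight_commutator J m v) 1 J.
have GQ : G <= K * Q / J%:R ^+ 2 := energy_weight_commutator J0 mk v0.
set H := energy (fun j => W J kb m j * iter m D F j) 1 J.
have HF : H <= k4 * energy F 1 J.
  apply: le_trans (energy_weighted_diff_le J0 _ _ (leqnn _)) _.
  apply: le_trans (energy_iter_backward_diff _ _ F0) _.
  by rewrite ler_wpM2r ?energy_ge0 // ler_weXn2l // ler1n.
have split3 : energy (wdiff J m v') 1 J <=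
    (1 + N%:R^-1) * ((1 + J%:R^-1) * X + (1 + J%:R) * G) + (1 + N%:R) * H.
  rewrite /X /G /H /energy -!wsumZ -wsumD -wsumZ -wsumD.
  apply: le_wsum => j hj; rewrite (weighted_diff_step J0 mk hv); last by int_lia.
  apply: le_trans (sqr_addr_le (t := N%:R^-1) _ _ _) _; first by rewrite invr_gt0.
  rewrite invrK lerD2r ler_wpM2l ?addr_ge0 ?invr_ge0 //.
  apply: le_trans (sqr_addr_le (t := J%:R^-1) _ _ _) _; first by rewrite invr_gt0.
  by rewrite invrK.
apply: le_trans split3 _; apply: lerD.
  rewrite ler_wpM2l ?addr_ge0 ?invr_ge0 //.
  have hG : (1 + J%:R) * G <= 2 * K * Z.
    apply: le_trans (_ : (2 * J%:R) * (K * Q / J%:R ^+ 2) <= _).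
      by apply: ler_pM; rewrite ?addr_ge0 ?energy_ge0 //; lra.
    rewrite (_ : _ * (_ / _) = 2 * K * (Q / J%:R)); last first.
      by field; rewrite gt_eqF.
    by rewrite ler_wpM2l // mulr_ge0.
  have hX2 : (1 + J%:R^-1) * X <= E - c * boundary_trace J m v + (2 * C + k4) * Z.
    apply: le_trans (ler_wpM2l _ hX) _; first by rewrite addr_ge0 ?invr_ge0.
    have i0 : 0 <= J%:R^-1 :> R by rewrite invr_ge0 ltW.
    have t1 : J%:R^-1 * E <= k4 * Z.
      apply: le_trans (_ : J%:R^-1 * (k4 * Q) <= _); first by rewrite ler_wpM2l.
      by rewrite mulrCA ler_wpM2l // mulrC.
    have t2 : 0 <= J%:R^-1 * (c * boundary_trace J m v).
      by rewrite !mulr_ge0 // ltW.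
    have t3 : J%:R^-1 * (C * Z) <= C * Z.
      by rewrite ler_piMl // mulr_ge0 // ltW.
    lra.
  have t4 : 0 <= k4 * Z by rewrite mulr_ge0.
  lra.
have hN : (1 + N%:R) * H <= (2 * N%:R) * (k4 * energy F 1 J).
  by apply: ler_pM; rewrite ?addr_ge0 ?energy_ge0 //; lra.
apply: le_trans hN _.
have t5 : 0 <= (2 * C + 2 * K) * (N%:R * energy F 1 J).
  apply: mulr_ge0; last by rewrite mulr_ge0 ?energy_ge0.
  by rewrite addr_ge0 // mulr_ge0 // ltW.
lra.
Qed.

(** The levels are added up with weights chosen so that the boundary values of
    each level absorb what the previous level owes to them. *)
Theorem scheme_stability : exists2 C : R, 0 < C &
  forall (J N : nat) (e F : nat -> int -> R) (b : nat -> R),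
    (0 < J)%N -> (0 < N)%N ->
    (forall n (j : int), j <= 0 -> e n j = 0) ->
    (forall n (j : int), j <= 0 -> F n j = 0) ->
    (forall n (j : int), 1 <= j <= J%:Z -> e n.+1 j = A (e n) j + F n j) ->
    (forall n (l : int), 1 <= l <= p%:Z -> `|iter kb D (e n) (J%:Z + l)| <= b n) ->
    (forall n, 0 <= b n) ->
    forall n : nat, (n <= N)%N ->
    energy (e n) 1 J <= C * expR (C * (n%:R / J%:R)) *
      (energy (e 0%N) 1 J +
       \sum_(0 <= i < n) (b i ^+ 2 + N%:R * energy (F i) 1 J)).
Proof.
have [c [C [c0 C0 hC]]] := level_step.
have [Q [Q1 hQ]] : exists Q : R, 1 <= Q /\ forall J (v : int -> R) (b : R),
    (forall j : int, j <= 0 -> v j = 0) ->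
    (forall l : int, 1 <= l <= p%:Z -> `|iter kb D v (J%:Z + l)| <= b) ->
    0 <= b -> energy v 1 (J + p) <= Q * (energy v 1 J + b ^+ 2).
  by have [Q] := energy_ghost_le; exists Q.
(* With [K * c = C], the sum over [m] of [K ^+ m * (C * T m.+1 - c * T m)]
   telescopes. *)
pose K := C / c; have K0 : 0 < K by rewrite divr_gt0.
pose S := \sum_(0 <= m < kb.+1) K ^+ m.
have S1 : 1 <= S.
  rewrite /S big_nat_recl // expr0 lerDl sumr_ge0 // => i _.
  by rewrite exprn_ge0 // ltW.
have S0 : 0 < S by apply: lt_le_trans S1.
have Q0 : 0 < Q by apply: lt_le_trans Q1.
pose k4 : R := 4 ^+ kb; have k41 : 1 <= k4 by rewrite exprn_ege1 // ler1n.
pose G := C * S * Q; have G0 : 0 < G by rewrite !mulr_gt0.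
pose Z := expR 1 * (S * k4 + 4 * G) + G.
have Z0 : 0 < Z.
  by rewrite ltr_wpDl // !mulr_ge0 ?addr_ge0 ?mulr_ge0 ?expR_ge0 // ltW // (lt_le_trans ltr01).
exists Z => // J N e F b J0 N0 e0 F0 he hb b0.
have JR : 1 <= J%:R :> R by rewrite ler1n.
have NR : 1 <= N%:R :> R by rewrite ler1n.
have Jp : 0 < J%:R :> R by apply: lt_le_trans JR.
have Np : 0 < N%:R :> R by apply: lt_le_trans NR.
pose total n := \sum_(0 <= m < kb.+1) K ^+ m * energy (wdiff J m (e n)) 1 J.
pose y n := b n ^+ 2 + N%:R * energy (F n) 1 J.
have y0 n : 0 <= y n by rewrite addr_ge0 ?sqr_ge0 // mulr_ge0 ?energy_ge0 // ltW.
have le_total n : energy (e n) 1 J <= total n.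
  rewrite /total big_nat_recl // expr0 mul1r.
  rewrite (_ : energy (wdiff J 0 (e n)) 1 J = energy (e n) 1 J); last first.
    by apply: eq_wsum => j _; rewrite /weighted_diff mul1r.
  rewrite lerDl sumr_ge0 // => i _.
  by rewrite mulr_ge0 ?energy_ge0 // exprn_ge0 // ltW.
have total0 n : 0 <= total n := le_trans (energy_ge0 _ _ _) (le_total n).
have total_init : total 0%N <= S * k4 * energy (e 0%N) 1 J.
  rewrite /total /S -mulrA big_distrl.
  apply: ler_sum_nat => m /andP[_ hm]; rewrite ler_wpM2l ?exprn_ge0 ?(ltW K0) //.
  apply: le_trans (energy_weighted_diff_le J0 _ _ (leqnn _)) _.
  apply: le_trans (energy_iter_backward_diff _ _ (e0 _)) _.
  by rewrite ler_wpM2r ?energy_ge0 // ler_weXn2l // ler1n.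
pose alpha := (1 + N%:R^-1) * (1 + G / J%:R).
have alpha1 : 1 <= alpha.
  by rewrite mulr_ege1 // lerDl ?invr_ge0 ?divr_ge0 // ltW.
have step n : total n.+1 <= alpha * total n + 4 * G * y n.
  pose T m := boundary_trace J m (e n).
  pose X := energy (e n) 1 (J + p) / J%:R + b n ^+ 2.
  pose Phi := N%:R * energy (F n) 1 J.
  have levels : total n.+1 <= \sum_(0 <= m < kb.+1) K ^+ m * ((1 + N%:R^-1) *
      (energy (wdiff J m (e n)) 1 J - c * T m + C * (T m.+1 + X)) + C * Phi).
    apply: ler_sum_nat => m /andP[_ mk].
    rewrite ler_wpM2l ?exprn_ge0 ?(ltW K0) // /X addrA.
    by apply: hC => //; [exact: e0|exact: F0|exact: he|exact: hb].
  have telescope : \sum_(0 <= m < kb.+1) (K ^+ m * (C * T m.+1 - c * T m)) <= 0.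
    rewrite (eq_bigr (fun m => c * (K ^+ m.+1 * T m.+1 - K ^+ m * T m))); last first.
      by move=> m _; rewrite exprS {2}/K; field; rewrite gt_eqF.
    rewrite -big_distrr telescope_sumr //= pmulr_rle0 // {1}/T /boundary_trace.
    by rewrite ltnn mulr0 sub0r oppr_le0 mulr_ge0 ?boundary_trace_ge0 // exprn_ge0 ?ltW.
  have sumE : \sum_(0 <= m < kb.+1) K ^+ m * ((1 + N%:R^-1) *
      (energy (wdiff J m (e n)) 1 J - c * T m + C * (T m.+1 + X)) + C * Phi) =
    (1 + N%:R^-1) * (total n +
      \sum_(0 <= m < kb.+1) (K ^+ m * (C * T m.+1 - c * T m)) + C * S * X) +
    C * S * Phi.
    rewrite -!mulrA [S * X]mulrC [S * Phi]mulrC /total /S.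
    rewrite [in RHS]mulrCA; rewrite !big_distrr /= -!big_split /= big_distrr -big_split /=.
    by apply: eq_bigr => m _; ring.
  apply: le_trans levels _; rewrite sumE.
  have XQ : X <= Q / J%:R * total n + 2 * Q * b n ^+ 2.
    have h := hQ J (e n) (b n) (e0 n) (hb n) (b0 n).
    have {}h : energy (e n) 1 (J + p) <= Q * (total n + b n ^+ 2).
      by apply: le_trans h _; rewrite ler_pM2l // lerD2r.
    have i1 : J%:R^-1 <= 1 :> R by rewrite invf_le1.
    have i0 : 0 < J%:R^-1 :> R by rewrite invr_gt0.
    have h1 : energy (e n) 1 (J + p) / J%:R <= Q * (total n + b n ^+ 2) / J%:R.
      by rewrite ler_pM2r.
    have h2 : Q * b n ^+ 2 / J%:R <= Q * b n ^+ 2.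
      by rewrite ler_piMr // mulr_ge0 ?sqr_ge0 // ltW.
    have h3 : b n ^+ 2 <= Q * b n ^+ 2 by rewrite ler_peMl // sqr_ge0.
    by rewrite /X; lra.
  have CSX : C * S * X <= G / J%:R * total n + 2 * G * b n ^+ 2.
    have := ler_wpM2l (ltW (mulr_gt0 C0 S0)) XQ; congr (_ <= _).
    by rewrite /G; ring.
  have Phi0 : 0 <= Phi by rewrite mulr_ge0 ?energy_ge0 // ltW.
  have CSP : C * S * Phi <= 4 * G * Phi.
    rewrite ler_wpM2r // /G; have := mulr_gt0 C0 S0; set cs := C * S => cs0.
    by rewrite mulrCA ler_peMr ?(ltW cs0) //; lra.
  have n2 : 1 + N%:R^-1 <= 2 :> R.
    by rewrite -[2]/(1 + 1) lerD2l invf_le1.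
  have n0 : 0 <= 1 + N%:R^-1 :> R by rewrite addr_ge0 // invr_ge0 ltW.
  have h1 : (1 + N%:R^-1) * (total n +
      \sum_(0 <= m < kb.+1) (K ^+ m * (C * T m.+1 - c * T m)) + C * S * X) <=
      alpha * total n + 4 * G * b n ^+ 2.
    apply: le_trans (ler_wpM2l n0 (_ : _ <=
      (1 + G / J%:R) * total n + 2 * G * b n ^+ 2)) _; first by lra.
    rewrite mulrDr mulrA lerD2l mulrA.
    have g0 : 0 <= G * b n ^+ 2 by rewrite mulr_ge0 ?sqr_ge0 // ltW.
    have := ler_wpM2r g0 n2; lra.
  by rewrite /y [4 * G * (_ + _)]mulrDr addrA lerD.
have grow n : total n <= alpha ^+ n * (total 0%N + 4 * G * \sum_(0 <= i < n) y i).
  elim: n => [|n IH]; first by rewrite big_geq // mulr0 addr0 mul1r.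
  apply: le_trans (step n) _; rewrite big_nat_recr //=.
  set Y := \sum_(_ <= _ < _) _ in IH *.
  rewrite [leRHS](_ : _ = alpha * (alpha ^+ n * (total 0%N + 4 * G * Y)) +
    alpha ^+ n.+1 * (4 * G * y n)); last by rewrite exprS; ring.
  rewrite lerD //; first by rewrite ler_wpM2l // (le_trans ler01).
  by rewrite ler_peMl ?exprn_ege1 // mulr_ge0 // mulr_ge0 // ltW.
have alphaX n : (n <= N)%N -> alpha ^+ n <= expR 1 * expR (G * (n%:R / J%:R)).
  move=> nN; have n0 : 0 <= 1 + N%:R^-1 :> R by rewrite addr_ge0 ?invr_ge0.
  have j0 : 0 <= 1 + G / J%:R by rewrite addr_ge0 // divr_ge0 // ltW.
  rewrite exprMn; apply: ler_pM; rewrite ?exprn_ge0 //.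
  - apply: le_trans (_ : expR (N%:R^-1) ^+ n <= _).
      by rewrite lerXn2r ?nnegrE ?expR_ge0 ?expR_ge1Dx.
    by rewrite -expRM_natl ler_expR ler_pdivrMr // mul1r ler_nat.
  - apply: le_trans (_ : expR (G / J%:R) ^+ n <= _).
      by rewrite lerXn2r ?nnegrE ?expR_ge0 ?expR_ge1Dx.
    by rewrite -expRM_natl ler_expR mulrCA.
move=> n nN; apply: le_trans (le_total n) _; apply: le_trans (grow n) _.
set Y := \sum_(0 <= i < n) y i.
have Y0 : 0 <= Y by apply: sumr_ge0.
set E0 := energy (e 0%N) 1 J; have E00 : 0 <= E0 := energy_ge0 _ _ _.
have G4 : 0 <= 4 * G by rewrite mulr_ge0 // ltW.
have Sk : 0 <= S * k4 by rewrite mulr_ge0 // ltW // (lt_le_trans ltr01).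
have h : total 0%N + 4 * G * Y <= (S * k4 + 4 * G) * (E0 + Y).
  have t1 : 0 <= S * k4 * Y by rewrite mulr_ge0.
  have t2 : 0 <= 4 * G * E0 by rewrite mulr_ge0.
  by move: total_init; rewrite -/E0; lra.
apply: le_trans (ler_pM _ _ (alphaX n nN) h) _.
- by rewrite exprn_ge0 // (le_trans ler01).
- by rewrite addr_ge0 // mulr_ge0.
have -> : expR 1 * expR (G * (n%:R / J%:R)) * ((S * k4 + 4 * G) * (E0 + Y)) =
  (expR 1 * (S * k4 + 4 * G)) * expR (G * (n%:R / J%:R)) * (E0 + Y) by ring.
apply: ler_pM; rewrite ?addr_ge0 ?mulr_ge0 ?expR_ge0 ?addr_ge0 //.
apply: ler_pM; rewrite ?mulr_ge0 ?expR_ge0 ?addr_ge0 //.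
  by rewrite /Z lerDl ltW.
rewrite ler_expR ler_wpM2r ?divr_ge0 //.
by rewrite /Z lerDr mulr_ge0 ?expR_ge0 // addr_ge0.
Qed.

End Stability.

(** * A smooth step *)

Section Smooth.
Context (R : realType).
Implicit Types (f g : R -> R) (n : nat) (x : R).

(** Derivability up to order [n], by recursion on the derivative, so that the
    stability under algebraic operations goes by induction. *)
Fixpoint ntimes_derivable n f : Prop :=
  if n is n'.+1 then (forall x, derivable f x 1) /\ ntimes_derivable n' (derive1 f)
  else True.

Lemma derive1_is_derive f g : (forall x, is_derive x 1 f (g x)) -> derive1 f = g.
Proof. by move=> fg; apply/funext => x; rewrite derive1E derive_val. Qed.

Lemma ntimes_derivable_is_derive n f g : (forall x, is_derive x 1 f (g x)) ->
  ntimes_derivable n g -> ntimes_derivable n.+1 f.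
Proof.
by move=> fg gn; split => [x|]; [exact: ex_derive|rewrite (derive1_is_derive fg)].
Qed.

Lemma ntimes_derivable_is_deriveE n f : ntimes_derivable n.+1 f ->
  forall x, is_derive x 1 f (derive1 f x).
Proof. by move=> [fd _] x; rewrite derive1E; exact/derivableP. Qed.

Lemma ntimes_derivableW n f : ntimes_derivable n.+1 f -> ntimes_derivable n f.
Proof. by elim: n f => [//|n IH] f [fd /IH]. Qed.

Lemma ntimes_derivable_cst n (c : R) : ntimes_derivable n (cst c).
Proof.
by elim: n c => [//|n IH] c; apply: (ntimes_derivable_is_derive (g := cst 0)).
Qed.

Lemma ntimes_derivableD n f g : ntimes_derivable n f -> ntimes_derivable n g ->
  ntimes_derivable n (fun x => f x + g x).
Proof.
elim: n f g => [//|n IH] f g fn gn.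
apply: (ntimes_derivable_is_derive (g := fun x => derive1 f x + derive1 g x)).
  move=> x; apply: is_deriveD;
    [exact: ntimes_derivable_is_deriveE fn _|exact: ntimes_derivable_is_deriveE gn _].
have [[_ f'n] [_ g'n]] := (fn, gn).
exact: IH.
Qed.

Lemma ntimes_derivableM n f g : ntimes_derivable n f -> ntimes_derivable n g ->
  ntimes_derivable n (fun x => f x * g x).
Proof.
elim: n f g => [//|n IH] f g fn gn.
apply: (ntimes_derivable_is_derive
  (g := fun x => f x * derive1 g x + g x * derive1 f x)).
  move=> x; apply: is_deriveM;
    [exact: ntimes_derivable_is_deriveE fn _|exact: ntimes_derivable_is_deriveE gn _].
have [[_ f'n] [_ g'n]] := (fn, gn).
by apply: ntimes_derivableD; apply: IH => //; exact: ntimes_derivableW.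
Qed.

Lemma is_derive_affine (c d x : R) : is_derive x 1 (fun y => c * y + d) c.
Proof.
have h : is_derive x 1 (c *: (id : R -> R) + cst d) (c *: (1 : R) + 0).
  exact: is_deriveD.
by rewrite addr0 [c *: 1]mulr1 in h.
Qed.

Lemma is_derive_comp_affine f (c d x df : R) :
  is_derive (c * x + d) 1 f df -> is_derive x 1 (fun y => f (c * y + d)) (c * df).
Proof.
move=> fd; rewrite mulrC.
exact: (is_derive1_comp (f := f) (g := fun y => c * y + d) fd (is_derive_affine _ _ _)).
Qed.

Lemma ntimes_derivable_comp_affine n f (c d : R) : ntimes_derivable n f ->
  ntimes_derivable n (fun x => f (c * x + d)).
Proof.
elim: n f => [//|n IH] f fn.
apply: (ntimes_derivable_is_derive (g := fun x => c * derive1 f (c * x + d))).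
  move=> x; apply: is_derive_comp_affine.
  exact: ntimes_derivable_is_deriveE fn _.
apply: (@ntimes_derivableM n (cst c)); first exact: ntimes_derivable_cst.
by apply: IH; have [] := fn.
Qed.

Lemma ntimes_derivableP f : (forall n, ntimes_derivable n f) ->
  forall n x, derivable (derive1n n f) x 1.
Proof.
move=> fn n; elim: n f fn => [|n IH] f fn x; first by have [] := fn 1%N.
rewrite /derive1n iterSr; apply: IH => m.
by have [] := fn m.+1.
Qed.

(** The products of [expR (- x^-1)] by powers of [x^-1] form a family whose
    derivatives are combinations of members of the family, so that its smoothness
    follows by induction. *)
Definition flat n x : R := if x <= 0 then 0 else x^-1 ^+ n * expR (- x^-1).

Lemma flat_le n x : `|flat n x| <= n.+1%:R ^+ n.+1 * `|x|.
Proof.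
rewrite /flat; case: (lerP x 0) => x0; first by rewrite normr0 mulr_ge0 ?exprn_ge0.
set t := x^-1; have t0 : 0 < t by rewrite invr_gt0.
have h : t ^+ n.+1 <= n.+1%:R ^+ n.+1 * expR t.
  have -> : expR t = expR (t / n.+1%:R) ^+ n.+1.
    by rewrite -expRM_natl mulrC divfK.
  rewrite -exprMn lerXn2r ?nnegrE ?mulr_ge0 ?expR_ge0 ?(ltW t0) //.
  rewrite mulrC -ler_pdivrMr //; apply: le_trans (expR_ge1Dx _).
  by rewrite lerDr.
rewrite (gtr0_norm x0) ger0_norm ?mulr_ge0 ?exprn_ge0 ?expR_ge0 ?(ltW t0) //.
rewrite expRN ler_pdivrMr ?expR_gt0 // mulrAC.
have -> : t ^+ n = t ^+ n.+1 * x.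
  by rewrite exprS mulrAC mulVf ?mul1r // gt_eqF.
by rewrite ler_pM2r.
Qed.

Lemma flat_cvg0 n : {for 0, continuous (flat n)}.
Proof.
set K := (n.+1%:R : R) ^+ n.+1.
have K0 : 0 < K by rewrite exprn_gt0.
apply/cvgrPdist_lt => e e0; near=> x.
rewrite {1}/flat lexx sub0r normrN; apply: le_lt_trans (flat_le n x) _.
rewrite -/K mulrC -ltr_pdivlMr //.
near: x; exists (e / K) => /=; first by rewrite divr_gt0.
by move=> y /=; rewrite sub0r normrN.
Unshelve. all: by end_near. Qed.

Lemma is_derive_flat n x :
  is_derive x 1 (flat n) (flat n.+2 x - n%:R * flat n.+1 x).
Proof.
have [x0|x0|->] := ltrgtP x 0.
- have -> : flat n.+2 x - n%:R * flat n.+1 x = 0.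
    by rewrite /flat (ltW x0) mulr0 subr0.
  apply: (@near_eq_is_derive _ _ _ (cst 0)).
  near=> y; rewrite /flat ifT //; apply: ltW; near: y; exact: lt_nbhsl.
- have xV : is_derive x 1 (fun y : R => y^-1) (- x ^- 2).
    have := @is_deriveV R id x 1 1 (lt0r_neq0 x0) (is_derive_id _ _).
    by rewrite [_ *: _]mulr1.
  have xVn : is_derive x 1 (fun y : R => y^-1 ^+ n) (n%:R * x^-1 ^+ n.-1 * - x ^- 2).
    have := is_derive1_comp (is_derive_poly 'X^n x^-1) xV.
    rewrite derivXn hornerMn hornerXn -mulr_natl.
    by congr (is_derive _ _ _ _); apply/funext => y; rewrite /= hornerXn.
  have xE : is_derive x 1 (fun y : R => expR (- y^-1)) (expR (- x^-1) * x ^- 2).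
    have := is_derive1_comp (f := expR) (g := fun y => - y^-1)
      (is_derive_expR (- x^-1)) (is_deriveN xV).
    by rewrite opprK.
  have xM := is_deriveM xVn xE.
  have -> : flat n.+2 x - n%:R * flat n.+1 x =
      x^-1 ^+ n *: (expR (- x^-1) * x ^- 2) +
      expR (- x^-1) *: (n%:R * x^-1 ^+ n.-1 * - x ^- 2).
    rewrite /flat leNgt x0 /= -![_ *: _]/(_ * _) -exprVn.
    by case: (n) => [|m] /=; rewrite ?mul0r ?exprS ?expr0; ring.
  apply: (near_eq_is_derive _ xM).
  near=> y; rewrite /flat ifF //; apply/negbTE; rewrite -ltNge; near: y.
  exact: lt_nbhsr.
- have -> : flat n.+2 0 - n%:R * flat n.+1 0 = flat n.+1 0 :> R.
    by rewrite /flat lexx mulr0 subr0.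
  apply/is_derive1_caratheodory; exists (flat n.+1); split => // z.
    rewrite subr0 {2}/flat lexx subr0 /flat; case: ifPn => [|z0].
      by rewrite mul0r.
    rewrite -ltNge in z0.
    have zz : z * z^-1 = 1 by rewrite divff ?gt_eqF.
    by rewrite exprS -[LHS]mul1r -zz; ring.
  exact: flat_cvg0.
Unshelve. all: by end_near. Qed.

Lemma ntimes_derivable_flat m n : ntimes_derivable m (flat n).
Proof.
elim: m n => [//|m IH] n.
apply: (ntimes_derivable_is_derive (is_derive_flat n)).
rewrite (_ : (fun x => _) = (fun x => flat n.+2 x + (- n%:R) * flat n.+1 x)).
  apply: ntimes_derivableD => //; apply: (@ntimes_derivableM m (cst (- n%:R))) => //.
  exact: ntimes_derivable_cst.
by apply/funext => x; rewrite mulNr.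
Qed.

Definition bump x := flat 0 x * flat 0 (-1 * x + 1).

Lemma ntimes_derivable_bump n : ntimes_derivable n bump.
Proof.
apply: ntimes_derivableM; first exact: ntimes_derivable_flat.
by apply: ntimes_derivable_comp_affine; exact: ntimes_derivable_flat.
Qed.

Lemma bump_ge0 x : 0 <= bump x.
Proof.
by rewrite /bump /flat !expr0 !mul1r mulr_ge0 //; case: ifP => // _;
  exact: expR_ge0.
Qed.

Lemma bump_gt0 x : 0 < x < 1 -> 0 < bump x.
Proof.
move=> /andP[x0 x1]; rewrite /bump /flat ifF; last by apply/negbTE; rewrite -ltNge.
rewrite ifF; last by apply/negbTE; rewrite -ltNge; lra.
by rewrite !expr0 !mul1r mulr_gt0 ?expR_gt0.
Qed.

Lemma bump_eq0 x : x <= 0 \/ 1 <= x -> bump x = 0.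
Proof.
move=> [x0|x1]; rewrite /bump /flat; first by rewrite x0 mul0r.
by rewrite [X in _ * X]ifT ?mulr0 //; lra.
Qed.

Lemma ntimes_derivable_continuous f : ntimes_derivable 1 f -> continuous f.
Proof. by move=> [fd _] x; apply/differentiable_continuous/derivable1_diffP. Qed.

End Smooth.

(** * Primitives from minus infinity *)

Section Primitive.
Context (R : realType).
Notation mu := (@lebesgue_measure R).
Implicit Types (f : R -> R) (x y : R).

Definition primitive f x : R := \int[mu]_(t in `]-oo, x]) f t.

Definition left_integrable f : Prop :=
  forall u : R, mu.-integrable `]-oo, u] (EFin \o f).

Lemma left_integrable_continuous f : continuous f -> (forall x, x <= 0 -> f x = 0) ->
  left_integrable f.
Proof.
move=> fc f0 u.
have int0u : mu.-integrable `[0, u] (EFin \o f).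
  apply: continuous_compact_integrable; first exact: segment_compact.
  exact: continuous_subspaceT.
have : mu.-integrable `]-oo, u] ((EFin \o f) \_ `[0, u]).
  apply/integrable_restrict => //.
  by apply: integrableS int0u => //; exact: measurableI.
apply: eq_integrable => // x; rewrite inE /= in_itv /= => xu.
rewrite patchE; case: ifPn => // /negP; rewrite inE /= in_itv /= xu andbT.
by move=> /negP; rewrite -ltNge => x0 ; rewrite f0 // ltW.
Qed.

Lemma is_derive_primitive f x : continuous f -> left_integrable f ->
  is_derive x 1 (primitive f) (f x).
Proof.
move=> fc fi; have xu : x < x + 1 by rewrite ltrDl.
have [] := continuous_FTC1 xu (fi (x + 1)) (ltNyr _) (fc x).
by move=> dF; rewrite derive1E => <-; exact/derivableP.
Qed.

Lemma primitive_eq0 f x : (forall y, y <= x -> f y = 0) -> primitive f x = 0.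
Proof.
move=> f0; transitivity (\int[mu]_(t in `]-oo, x]) (0 : R)).
  by apply: eq_Rintegral => y; rewrite inE /= in_itv /= => /f0.
by rewrite Rintegral_cst // mul0r.
Qed.

Lemma primitiveB f x y : left_integrable f -> x <= y ->
  primitive f y - primitive f x = \int[mu]_(t in `]x, y[) f t.
Proof.
move=> fi xy; rewrite /primitive Rintegral_itvB ?bnd_simp //.
rewrite Rintegral_itv_bndo_bndc //.
by apply: integrableS (fi y) => //; apply: subset_itv; rewrite bnd_simp.
Qed.

End Primitive.

Lemma MVT_le (R : realType) (f df : R -> R) (x y : R) :
  (forall z : R, is_derive z 1 f (df z)) -> x <= y ->
  exists2 z, x <= z <= y & f y - f x = df z * (y - x).
Proof.
move=> fd; rewrite le_eqVlt => /predU1P[->|xy].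
  by exists y; rewrite ?lexx // !subrr mulr0.
have [|z] := MVT xy (fun z _ => fd z).
  by apply: derivable_within_continuous => z _.
by rewrite in_itv /= => /andP[xz zy] h; exists z => //; rewrite !ltW.
Qed.

(** The primitive of a bump function, divided by its value at [1]. *)
Lemma smooth_step (R : realType) : exists eta rho : R -> R,
  [/\ forall x : R, is_derive x 1 eta (rho x),
      forall n, ntimes_derivable n rho,
      forall x, 0 <= rho x,
      forall x, x <= 0 \/ 1 <= x -> rho x = 0
    & (forall x, x <= 0 -> eta x = 0) /\ (forall x, 1 <= x -> eta x = 1)].
Proof.
pose b := @bump R; have bn := @ntimes_derivable_bump R.
have bc : continuous b := ntimes_derivable_continuous (bn 1%N).
have b0 (x : R) : x <= 0 -> b x = 0 by move=> x0; apply: bump_eq0; left.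
have bi := left_integrable_continuous bc b0.
have Pd (x : R) := is_derive_primitive x bc bi.
have P0 (x : R) : x <= 0 -> primitive b x = 0.
  by move=> x0; apply: primitive_eq0 => y /le_trans yx; rewrite b0 ?yx.
set c := primitive b 1.
have c0 : 0 < c.
  have [|z] := @MVT _ (primitive b) b 0 1 ltr01 (fun z _ => Pd z).
    by apply: derivable_within_continuous => z _; have [] := Pd z.
  rewrite in_itv /= (P0 0) // !subr0 mulr1 -/c => z01 ->; exact: bump_gt0.
exists (fun x => c^-1 * primitive b x), (fun x => c^-1 * b x); split => //.
- by move=> x; exact: (is_deriveZ c^-1 (Pd x)).
- by move=> n; apply: (@ntimes_derivableM R n (cst c^-1)) => //;
    exact: ntimes_derivable_cst.
- by move=> x; rewrite mulr_ge0 ?invr_ge0 ?(ltW c0) ?bump_ge0.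
- by move=> x hx; rewrite [b x]bump_eq0 ?mulr0.
- split=> x hx; first by rewrite P0 ?mulr0.
  have [z /andP[z1 _]] := MVT_le Pd hx.
  rewrite [b z]bump_eq0 ?mul0r; last by right.
  by move=> /eqP; rewrite subr_eq0 => /eqP ->; rewrite mulVf ?gt_eqF.
Qed.
(** * Testing against smooth cut-off functions *)

Section CutOff.
Context (R : realType).
Notation mu := (@lebesgue_measure R).
Implicit Types (f g h phi psi : R -> R).

Lemma continuous_itv_integrable g (L : R) : {within `[0, L], continuous g} ->
  mu.-integrable `]0, L[ (EFin \o g).
Proof.
move=> gc; apply: (@integrableS _ _ _ mu `[0, L]%classic) => //.
  by apply: subset_itv; rewrite bnd_simp.
by apply: continuous_compact_integrable => //; exact: segment_compact.
Qed.

Lemma Rintegral_is_derive f g (x y : R) : (forall z : R, is_derive z 1 g (f z)) ->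
  continuous f -> left_integrable f -> x <= y ->
  \int[mu]_(t in `]x, y[) f t = g y - g x.
Proof.
move=> gf fc fi xy; rewrite -primitiveB //.
have dd (z : R) : is_derive z 1 (fun t => g t - primitive f t) 0.
  have := is_deriveB (gf z) (is_derive_primitive z fc fi).
  by rewrite subrr.
have [z _] := MVT_le dd xy; rewrite mul0r => /eqP; rewrite subr_eq0 => /eqP h.
by have : g y - primitive f y = g x - primitive f x by []; lra.
Qed.

Lemma test_function_supported phi (s t L : R) : 0 < s -> t < L ->
  (forall n, ntimes_derivable n phi) -> (forall x, ~ s <= x <= t -> phi x = 0) ->
  test_function L phi.
Proof.
move=> s0 tL phin phi0.
have sub : closure [set x | phi x != 0] `<=` `[s, t].
  rewrite closureE => x; apply; split; first exact: itv_closed.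
  move=> y /= /eqP y0; rewrite in_itv /=; apply: contrapT => /negP hy.
  by apply: y0; apply: phi0; exact/negP.
split; first exact: ntimes_derivableP.
- apply: (subclosed_compact _ (@segment_compact _ s t)) => //.
  exact: closed_closure.
- apply: subset_trans sub _ => x; rewrite /= !in_itv /= => /andP[sx xt].
  by rewrite (lt_le_trans s0 sx) (le_lt_trans xt tL).
Qed.

(** [phi] is a smooth approximation of the indicator of [`]x, y[]; its
    derivative is the difference of two densities of mass 1 concentrated near
    [x] and near [y]. *)
Definition cutoff (L x y e : R) phi (psi1 psi2 : R -> R) : Prop :=
  [/\ test_function L phi /\ test_function L (derive1 phi),
      [/\ continuous phi, continuous psi1 & continuous psi2],
      derive1 phi = (fun t => psi1 t - psi2 t),
      [/\ forall t, 0 <= phi t <= 1, forall t, ~ x < t < y -> phi t = 0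
        & forall t, x + 2 * e <= t <= y - 2 * e -> phi t = 1]
    & [/\ forall t, 0 <= psi1 t, forall t, 0 <= psi2 t,
          forall t, ~ x <= t <= x + 2 * e -> psi1 t = 0,
          forall t, ~ y - 2 * e <= t <= y -> psi2 t = 0 &
          \int[mu]_(t in `]0, L[) psi1 t = 1 /\ \int[mu]_(t in `]0, L[) psi2 t = 1]].

Lemma cutoff_exists (L x y e : R) : 0 <= x -> y <= L -> 0 < e -> 4 * e <= y - x ->
  exists phi psi1 psi2, cutoff L x y e phi psi1 psi2.
Proof.
move=> x0 yL e0 exy.
have [eta [rho [eta_rho rho_n rho_ge0 rho_eq0 [eta0 eta1]]]] := smooth_step R.
have eta_mono (s t : R) : s <= t -> eta s <= eta t.
  move=> st; have [z _ h] := MVT_le eta_rho st.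
  by rewrite -subr_ge0 h mulr_ge0 // subr_ge0.
have eta01 (t : R) : 0 <= eta t <= 1.
  apply/andP; split.
    have [t0|t0] := lerP t 0; first by rewrite eta0.
    by rewrite -(eta0 0) // eta_mono // ltW.
  have [t1|t1] := lerP 1 t; first by rewrite eta1.
  by rewrite -(eta1 1) // eta_mono // ltW.
have ei : 0 < e^-1 by rewrite invr_gt0.
pose st (s t : R) := eta (e^-1 * t + (- (e^-1 * s))).
pose ps (s t : R) := e^-1 * rho (e^-1 * t + (- (e^-1 * s))).
have argE (s t : R) : e^-1 * t + - (e^-1 * s) = (t - s) / e.
  by rewrite -mulrBr mulrC.
have st_ps (s t : R) : is_derive t 1 (st s) (ps s t).
  exact: is_derive_comp_affine.
have eta_n n : ntimes_derivable n eta.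
  case: n => [//|n]; apply: (ntimes_derivable_is_derive eta_rho); exact: rho_n.
have st_n s n : ntimes_derivable n (st s).
  exact: ntimes_derivable_comp_affine.
have ps_n s n : ntimes_derivable n (ps s).
  apply: (@ntimes_derivableM R n (cst e^-1)); first exact: ntimes_derivable_cst.
  exact: ntimes_derivable_comp_affine.
have ps_ge0 (s t : R) : 0 <= ps s t by rewrite mulr_ge0 // ltW.
have ps_eq0 (s t : R) : t <= s \/ s + e <= t -> ps s t = 0.
  move=> hst; rewrite /ps argE rho_eq0 ?mulr0 //.
  by rewrite pmulr_lle0 // ler_pdivlMr //; case: hst => hst; [left|right]; lra.
have st0 (s t : R) : t <= s -> st s t = 0.
  by move=> ts; rewrite /st argE eta0 // pmulr_lle0 //; lra.
have st1 (s t : R) : s + e <= t -> st s t = 1.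
  by move=> ts; rewrite /st argE eta1 // ler_pdivlMr //; lra.
have st01 (s t : R) : 0 <= st s t <= 1 by exact: eta01.
have ps_c s : continuous (ps s) := ntimes_derivable_continuous (ps_n s 1%N).
have ps_int s : 0 <= s -> s + e <= L -> \int[mu]_(t in `]0, L[) ps s t = 1.
  move=> s0 sL; rewrite (Rintegral_is_derive (g := st s)) //.
  - by rewrite st1 // st0 // subr0.
  - apply: left_integrable_continuous => // t t0; apply: ps_eq0; left; lra.
  - lra.
pose phi t := st (x + e) t - st (y - 2 * e) t.
have phi_d (t : R) : is_derive t 1 phi (ps (x + e) t - ps (y - 2 * e) t).
  exact: is_deriveB.
have phi_n n : ntimes_derivable n phi.
  rewrite (_ : phi = (fun t => st (x + e) t + (-1) * st (y - 2 * e) t)).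
    apply: ntimes_derivableD => //; apply: (@ntimes_derivableM R n (cst (-1))) => //.
    exact: ntimes_derivable_cst.
  by apply/funext => t; rewrite mulN1r.
have phi'E := derive1_is_derive phi_d.
have phi'_n n : ntimes_derivable n (derive1 phi) by have [] := phi_n n.+1.
have phi0 (t : R) : ~ x + e <= t <= y - e -> phi t = 0.
  move=> ht; have [tx|tx] := lerP t (x + e); first by rewrite /phi !st0 ?subrr //; lra.
  have yt : y - e < t by rewrite ltNge; apply/negP => ty; case: ht; rewrite (ltW tx).
  by rewrite /phi !st1 ?subrr //; lra.
exists phi, (ps (x + e)), (ps (y - 2 * e)); split.
- split; apply: (@test_function_supported _ (x + e) (y - e)) => //; try lra.
  move=> t ht; rewrite phi'E; have [tx|tx] := lerP t (x + e).
    by rewrite !ps_eq0 ?subrr //; left; lra.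
  have yt : y - e < t by rewrite ltNge; apply/negP => ty; case: ht; rewrite (ltW tx).
  by rewrite !ps_eq0 ?subrr //; right; lra.
- by split; [exact: ntimes_derivable_continuous (phi_n 1%N)|exact: ps_c|exact: ps_c].
- exact: phi'E.
- split.
  + move=> t; have [ty|ty] := lerP t (y - 2 * e).
      by rewrite /phi (st0 (y - 2 * e)) // subr0.
    rewrite /phi (st1 (x + e)); last lra.
    by have /andP[] := st01 (y - 2 * e) t; lra.
  + move=> t ht; apply: phi0 => /andP[t1 t2]; apply: ht; lra.
  + by move=> t /andP[t1 t2]; rewrite /phi st1 ?st0 ?subr0 //; lra.
- split=> //.
  + move=> t ht; apply: ps_eq0; have [t1|t1] := lerP t (x + e); [by left|right].
    by rewrite leNgt; apply/negP => t2; apply: ht; lra.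
  + move=> t ht; apply: ps_eq0; have [t1|t1] := lerP t (y - 2 * e); [by left|right].
    by rewrite leNgt; apply/negP => t2; apply: ht; lra.
  + by split; apply: ps_int; lra.
Qed.

(** Averaging against a density concentrated where [g] is close to [c]. *)
Lemma mean_dist_le g psi (L c d : R) : {within `[0, L], continuous g} ->
  continuous psi -> (forall t, 0 <= psi t) -> \int[mu]_(t in `]0, L[) psi t = 1 ->
  0 <= d -> (forall t, 0 <= t <= L -> psi t != 0 -> `|g t - c| <= d) ->
  `|\int[mu]_(t in `]0, L[) (g t * psi t) - c| <= d.
Proof.
move=> gc pc p0 p1 d0 gd.
have psic : {within `[0, L], continuous psi} by exact: continuous_subspaceT.
have pi := continuous_itv_integrable psic.
have cp (b : R) : {within `[0, L], continuous (fun t => b * psi t)}.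
  by apply: continuous_subspaceT => t; apply: cvgMr; exact: pc.
have gpc : {within `[0, L], continuous (fun t => g t * psi t)}.
  by move=> t; apply: cvgM; [exact: gc|exact: psic].
rewrite -[X in _ - X]mulr1 -p1 -RintegralZl // -RintegralB //; last 2 first.
- exact: continuous_itv_integrable.
- exact: (continuous_itv_integrable (cp c)).
have dc : {within `[0, L], continuous (fun t => g t * psi t - c * psi t)}.
  by move=> t; apply: cvgB; [exact: gpc|exact: cp].
have di := continuous_itv_integrable dc.
apply: le_trans (le_normr_Rintegral _ di) _ => //.
rewrite -[leRHS]mulr1 -p1 -RintegralZl //; apply: le_Rintegral => //.
- exact: (integrable_norm di).
- exact: (continuous_itv_integrable (cp d)).
- move=> t; rewrite /= in_itv /= => /andP[t0 tL].
  rewrite -mulrBl normrM [`|psi t|]ger0_norm //.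
  have [->|pt] := eqVneq (psi t) 0; first by rewrite !mulr0.
  by rewrite ler_wpM2r // gd // !ltW.
Qed.

(** Dominated convergence, as the cut-offs are bounded by [1] and tend to the
    indicator of the interval. *)
Lemma cutoff_cvg h (L x y : R) (e : nat -> R) (phi psi1 psi2 : nat -> R -> R) :
  mu.-integrable `]0, L[ (EFin \o h) -> 0 <= x -> y <= L ->
  e @ \oo --> (0 : R) -> (forall n, 0 < e n) ->
  (forall n, cutoff L x y (e n) (phi n) (psi1 n) (psi2 n)) ->
  \int[mu]_(t in `]0, L[) (h t * phi n t) @[n --> \oo] -->
  \int[mu]_(t in `]x, y[) h t.
Proof.
move=> hi x0 yL e0 en cut.
have mh : measurable_fun `]0, L[ h by apply/measurable_EFinP; case/integrableP: hi.
have xyS : `]x, y[%classic `<=` `]0, L[%classic.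
  by apply: subset_itv; rewrite bnd_simp.
have -> : \int[mu]_(t in `]x, y[) h t = \int[mu]_(t in `]0, L[) (h \_ `]x, y[) t.
  by rewrite -Rintegral_mkcondr setIidr.
pose f_ n := EFin \o (fun t => h t * phi n t).
pose f := EFin \o (h \_ `]x, y[).
pose g := EFin \o (fun t => `|h t|).
have [] := @dominated_convergence _ _ _ mu `]0, L[ _ f_ f g.
- exact: measurable_itv.
- move=> n; apply/measurable_EFinP; apply: measurable_funM => //.
  have [_ [pc _ _] _ _ _] := cut n.
  by apply: measurable_funTS; exact: continuous_measurable_fun.
- apply/measurable_EFinP.
  apply: (measurable_restrict h (measurable_itv _) (measurable_itv _)).1.
  by rewrite setIidr //; exact: measurable_funS mh.
- apply: aeW => t /=; rewrite in_itv /= => /andP[t0 tL].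
  apply/fine_cvgP => /=; split; first by near=> n.
  rewrite /comp /= patchE; case: ifPn => [|].
    rewrite inE /= in_itv /= => /andP[xt ty].
    apply: cvg_near_cst; near=> n.
    have [_ _ _ [_ _ ph1] _] := cut n.
    suff [h1 h2] : x + 2 * e n <= t /\ t <= y - 2 * e n.
      by rewrite ph1 ?mulr1 // h1.
    have : `|0 - e n| < Num.min (t - x) (y - t) / 2.
      near: n; move/cvgrPdist_lt: e0; apply.
      by rewrite divr_gt0 // lt_min !subr_gt0 xt.
    rewrite sub0r normrN gtr0_norm // ltr_pdivlMr // lt_min => /andP[h1 h2].
    by split; lra.
  move=> /negP; rewrite inE /= in_itv /= => ht.
  apply: cvg_near_cst; near=> n.
  have [_ _ _ [_ ph0 ph1] _] := cut n.
  by rewrite ph0 ?mulr0 //; exact/negP.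
- exact: (integrable_norm hi).
- apply: aeW => t n _ /=; rewrite lee_fin normrM ler_piMr //.
  have [_ _ _ [ph01 _ _] _] := cut n.
  by have /andP[p0 p1] := ph01 t; rewrite ger0_norm.
move=> fi _.
have -> : (\int[mu]_(t in `]0%R, L[) f t)%E =
    (\int[mu]_(t in `]0, L[) (h \_ `]x, y[) t)%:E.
  by rewrite /Rintegral fineK //; exact: integrable_fin_num.
by move/fine_cvgP => [_].
Unshelve. all: by end_near. Qed.

End CutOff.
(** * Weak derivatives of continuous functions *)

Section WeakPrimitive.
Context (R : realType).
Notation mu := (@lebesgue_measure R).
Implicit Types (f g h phi : R -> R) (L x y : R).

Lemma cutoff_sequence L x y : 0 <= x -> x < y -> y <= L ->
  exists (e : nat -> R) (phi psi1 psi2 : nat -> R -> R),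
    [/\ e @ \oo --> (0 : R), forall n, 0 < e n &
        forall n, cutoff L x y (e n) (phi n) (psi1 n) (psi2 n)].
Proof.
move=> x0 xy yL; pose e (n : nat) := (y - x) / 4 * n.+1%:R^-1.
have e0 n : 0 < e n by rewrite mulr_gt0 ?invr_gt0 ?divr_gt0 // subr_gt0.
have ee n : 4 * e n <= y - x.
  rewrite (_ : 4 * e n = (y - x) * n.+1%:R^-1); last first.
    by rewrite /e; move: (n.+1%:R^-1) => w; field.
  by rewrite ler_piMr ?subr_ge0 ?(ltW xy) // invf_le1 // ler1n.
have /choice[F hF] : forall n, exists F : (R -> R) * ((R -> R) * (R -> R)),
    cutoff L x y (e n) F.1 F.2.1 F.2.2.
  move=> n; have [phi [psi1 [psi2 h]]] := cutoff_exists x0 yL (e0 n) (ee n).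
  by exists (phi, (psi1, psi2)).
exists e, (fun n => (F n).1), (fun n => (F n).2.1), (fun n => (F n).2.2).
split=> //; rewrite -(mulr0 ((y - x) / 4)); apply: cvgMr; exact: cvg_harmonic.
Qed.

Lemma within_continuous_dist g L x (d : R) : {within `[0, L], continuous g} ->
  0 <= x <= L -> 0 < d -> exists2 s : R, 0 < s &
  forall t, 0 <= t <= L -> `|t - x| < s -> `|g t - g x| < d.
Proof.
move=> /subspace_continuousP gc xL d0.
have xI : [set` `[0, L]] x by rewrite /= in_itv.
have := gc x xI; move/cvgrPdist_lt => /(_ d d0).
rewrite near_withinE => /nbhs_ballP[s s0 hs]; exists s => // t tL ts.
rewrite distrC; apply: hs; last by rewrite /= in_itv.
by rewrite /ball /= distrC.
Qed.

(** A continuous function whose weak derivative is integrable is a primitive of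
    it: test against the cut-offs of intervals and let their slopes steepen. *)
Lemma weak_primitive g h L : {within `[0, L], continuous g} ->
  mu.-integrable `]0, L[ (EFin \o h) ->
  (forall phi, test_function L phi -> test_function L (derive1 phi) ->
     \int[mu]_(t in `]0, L[) (g t * derive1 phi t) =
     - \int[mu]_(t in `]0, L[) (h t * phi t)) ->
  forall x y, 0 <= x -> x < y -> y <= L ->
  g y - g x = \int[mu]_(t in `]x, y[) h t.
Proof.
move=> gc hi gh x y x0 xy yL.
have [e [phi [psi1 [psi2 [e0 en cut]]]]] := cutoff_sequence x0 xy yL.
have lim1 := cutoff_cvg hi x0 yL e0 en cut.
suff lim2 : \int[mu]_(t in `]0, L[) (h t * phi n t) @[n --> \oo] --> g y - g x.
  exact: cvg_unique lim2 lim1.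
apply/cvgrPdist_le => d d0; have d2 : 0 < d / 2 by rewrite divr_gt0.
have xL : 0 <= x <= L by rewrite x0; lra.
have yL' : 0 <= y <= L by rewrite yL andbT; lra.
have [s1 s10 hs1] := within_continuous_dist gc xL d2.
have [s2 s20 hs2] := within_continuous_dist gc yL' d2.
near=> n.
have [[tp tp'] [pc p1c p2c] pE _ [p10 p20 p1S p2S [i1 i2]]] := cut n.
have hphi : \int[mu]_(t in `]0, L[) (h t * phi n t) =
    \int[mu]_(t in `]0, L[) (g t * psi2 n t) -
    \int[mu]_(t in `]0, L[) (g t * psi1 n t).
  have gpi psi : continuous psi ->
      mu.-integrable `]0, L[ (EFin \o (fun t => g t * psi t)).
    move=> pc'; apply: continuous_itv_integrable => t.
    by apply: cvgM; [exact: gc|exact: (continuous_subspaceT pc')].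
  rewrite -RintegralB; [|exact: measurable_itv|exact: gpi|exact: gpi].
  have := gh _ tp tp'; rewrite pE => /eqP; rewrite -eqr_oppLR => /eqP <-.
  rewrite -[LHS]mulN1r -RintegralZl //; last first.
    by apply: gpi => t; apply: cvgB; [exact: p1c|exact: p2c].
  by apply: eq_Rintegral => t _; ring.
have sn : `|0 - e n| < Num.min s1 s2 / 2.
  near: n; move/cvgrPdist_lt: e0; apply.
  by rewrite divr_gt0 // lt_min s10.
move: sn; rewrite sub0r normrN gtr0_norm // ltr_pdivlMr // lt_min => /andP[h1 h2].
have m1 : `|\int[mu]_(t in `]0, L[) (g t * psi1 n t) - g x| <= d / 2.
  apply: mean_dist_le => //; first exact: ltW.
  move=> t tL /eqP pt; apply: ltW; apply: hs1 => //.
  have /andP[xt tx] : x <= t <= x + 2 * e n.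
    by apply: contrapT => /p1S.
  by rewrite ger0_norm; lra.
have m2 : `|\int[mu]_(t in `]0, L[) (g t * psi2 n t) - g y| <= d / 2.
  apply: mean_dist_le => //; first exact: ltW.
  move=> t tL /eqP pt; apply: ltW; apply: hs2 => //.
  have /andP[yt ty] : y - 2 * e n <= t <= y.
    by apply: contrapT => /p2S.
  by rewrite ler0_norm; lra.
rewrite hphi; move: m1 m2; set a := Rintegral _ _ _; set b := Rintegral _ _ _.
move=> m1 m2; have -> : g y - g x - (b - a) = (a - g x) - (b - g y) by ring.
by apply: le_trans (ler_normB _ _) _; lra.
Unshelve. all: by end_near. Qed.

(** The cut-offs separate integrable functions, through their integrals over
    intervals. *)
Lemma weak_eq_Rintegral u g L : mu.-integrable `]0, L[ (EFin \o u) ->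
  mu.-integrable `]0, L[ (EFin \o g) ->
  (forall phi, test_function L phi ->
     \int[mu]_(t in `]0, L[) (u t * phi t) = \int[mu]_(t in `]0, L[) (g t * phi t)) ->
  forall x y, 0 <= x -> x < y -> y <= L ->
  \int[mu]_(t in `]x, y[) u t = \int[mu]_(t in `]x, y[) g t.
Proof.
move=> ui gi ug x y x0 xy yL.
have [e [phi [psi1 [psi2 [e0 en cut]]]]] := cutoff_sequence x0 xy yL.
have h1 := cutoff_cvg ui x0 yL e0 en cut.
have h2 := cutoff_cvg gi x0 yL e0 en cut.
rewrite (_ : (fun n => \int[mu]_(t in `]0, L[) (u t * phi n t)) =
  (fun n => \int[mu]_(t in `]0, L[) (g t * phi n t))) in h1.
  exact: cvg_unique h1 h2.
by apply/funext => n; have [[tp _] _ _ _ _] := cut n; rewrite ug.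
Qed.

End WeakPrimitive.

(** * Square-integrable functions on an interval *)

Section SquareIntegrable.
Context (R : realType).
Notation mu := (@lebesgue_measure R).
Implicit Types (f g : R -> R) (L x y : R).

Lemma L2_measurable L f : L2 L f -> measurable_fun `]0, L[ f.
Proof.
rewrite /L2 inE => /andP[/[!inE] /= mf _].
have := (measurable_restrict f (measurable_itv `]0, L[) measurableT).2 mf.
by rewrite setTI.
Qed.

Lemma L2_integrable_sqr L f : L2 L f ->
  mu.-integrable `]0, L[ (EFin \o (fun t => f t ^+ 2)).
Proof.
move=> /Lfun2_integrable_sqr fi.
rewrite -[X in mu.-integrable X _]setTI.
apply/integrable_restrict => //; apply: eq_integrable fi => // t _ /=.
by rewrite !patchE; case: ifP => _ //=; rewrite expr0n.
Qed.

Lemma integrable_cst_itv (c x y : R) : mu.-integrable `]x, y[ (EFin \o cst c).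
Proof.
apply: (@integrableS _ _ _ mu `[x, y]%classic) => //.
  by apply: subset_itv; rewrite bnd_simp.
apply: continuous_compact_integrable; first exact: segment_compact.
by apply: continuous_subspaceT => t; exact: cvg_cst.
Qed.

(** As [(0, L)] has finite measure, [1 + f ^ 2], which dominates [f], is
    integrable. *)
Lemma L2_integrable L f : L2 L f -> mu.-integrable `]0, L[ (EFin \o f).
Proof.
move=> fL.
have : mu.-integrable `]0, L[ (fun t => (1%:E + (f t ^+ 2)%:E)%E).
  apply: integrableD => //; first exact: integrable_cst_itv.
  exact: L2_integrable_sqr.
apply: le_integrable; first exact: measurable_itv.
  by apply/measurable_EFinP; exact: L2_measurable.
move=> t _ /=; rewrite lee_fin [leRHS]ger0_norm; last first.
  by rewrite addr_ge0 // sqr_ge0.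
have := sqr_ge0 (`|f t| - 1); have := normr_ge0 (f t).
rewrite -[f t ^+ 2]real_normK ?num_real //; nra.
Qed.

Lemma sqr_L2_norm L f : L2 L f ->
  L2_norm L f ^+ 2 = \int[mu]_(t in `]0, L[) (f t ^+ 2).
Proof.
move=> fL; have fin : Lnorm mu 2%:E (EFin \o (f \_ `]0, L[)) \is a fin_num.
  move: fL; rewrite /L2 inE => /andP[_ /[!inE] /= fN].
  by rewrite ge0_fin_numE // Lnorm_ge0.
have := poweR_Lnorm mu (EFin \o (f \_ `]0, L[)) (r := 2).
rewrite -(fineK fin) -/(L2_norm L f) => /(_ _)/= h.
rewrite Rintegral_mkcond /Rintegral.
rewrite (_ : (\int[mu]_x _)%E = (L2_norm L f ^+ 2)%:E) //.
rewrite -powR_mulrn ?fine_ge0 ?Lnorm_ge0 // h; last first.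
  by rewrite pnatr_eq0.
apply: eq_integral => t _; rewrite /= !patchE; case: ifP => _ /=.
  by rewrite powR_mulrn // real_normK ?num_real.
by rewrite normr0 powR0 // pnatr_eq0.
Qed.

(** Cauchy-Schwarz, against the constant function [1]. *)
Lemma sqr_Rintegral_le f x y : x <= y ->
  mu.-integrable `]x, y[ (EFin \o f) ->
  mu.-integrable `]x, y[ (EFin \o (fun t => f t ^+ 2)) ->
  (\int[mu]_(t in `]x, y[) f t) ^+ 2 <=
  (y - x) * \int[mu]_(t in `]x, y[) (f t ^+ 2).
Proof.
rewrite le_eqVlt => /predU1P[->|xy] fi f2i.
  by rewrite set_itv_ge ?bnd_simp // !Rintegral_set0 mulr0 expr0n.
set I := \int[mu]_(t in _) f t; set m := I / (y - x).
have yx : 0 < y - x by rewrite subr_gt0.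
have i1 : mu.-integrable `]x, y[ (EFin \o (fun t => 2 * m * f t)).
  exact: (integrableZl _ (2 * m) fi).
have i2 := integrable_cst_itv (m ^+ 2) x y.
have : \int[mu]_(t in `]x, y[) (2 * m * f t - m ^+ 2) <=
    \int[mu]_(t in `]x, y[) (f t ^+ 2).
  apply: le_Rintegral => //; first exact: (integrableB _ i1 i2).
  by move=> t _; have := sqr_ge0 (f t - m); lra.
have -> : \int[mu]_(t in `]x, y[) (2 * m * f t - m ^+ 2) =
    2 * m * I - m ^+ 2 * (y - x).
  rewrite RintegralB; [|exact: measurable_itv|exact: i1|exact: i2].
  rewrite RintegralZl; [congr (_ - _)|exact: measurable_itv|exact: fi].
  rewrite Rintegral_cst; last exact: measurable_itv.
  by have /= -> := @lebesgue_measure_itv R `]x, y[; rewrite lte_fin xy.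
move=> h; have {}h := ler_wpM2l (ltW yx) h; apply: le_trans h.
rewrite /m le_eqVlt; apply/orP; left; apply/eqP; field.
by rewrite gt_eqF.
Qed.

End SquareIntegrable.
(** * Translating integrals *)

Section Translation.
Context (R : realType).
Notation mu := (@lebesgue_measure R).

Let tr (c : R) (t : measurableTypeR R) : measurableTypeR R := t - c.

Let measurable_tr c : measurable_fun [set: measurableTypeR R] (tr c).
Proof. by apply: measurable_funB => //; exact: measurable_cst. Qed.

Let pushforward_tr c (A : set (measurableTypeR R)) : measurable A ->
  pushforward mu (tr c) A = mu A.
Proof.
move=> mA; have mtr := @measurable_tr c; apply/esym/lebesgue_measure_unique => //=.
move=> _ [[a b]] _ <-; rewrite /pushforward /=.
rewrite (_ : tr c @^-1` _ = `]a + c, b + c]%classic); last first.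
  by apply/seteqP; split=> t; rewrite /tr /= !in_itv /= ltrBrDr lerBlDr.
by rewrite !lebesgue_measure_itv /= !lte_fin ltrD2r !EFinD; case: ifP => // _;
  rewrite -!EFinD; congr EFin; ring.
Qed.

(** By uniqueness of the Lebesgue measure, its image by a translation is
    itself; the change of variables applies to the positive and negative parts. *)
Lemma Rintegral_translate (f : R -> R) (x y c : R) :
  measurable_fun `]x - c, y - c[ f ->
  \int[mu]_(t in `]x, y[) f (t - c) = \int[mu]_(t in `]x - c, y - c[) f t.
Proof.
move=> mf; rewrite /Rintegral; congr fine.
set D := `]x - c, y - c[%classic in mf *.
have mfE : measurable_fun D (EFin \o f) by exact/measurable_EFinP.
have mD : measurable D by exact: measurable_itv.
have -> : `]x, y[%classic = tr c @^-1` D.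
  by apply/seteqP; split=> t; rewrite /tr /D /= !in_itv /= ltrD2r ltrD2r.
have ge0 (g : R -> \bar R) : measurable_fun D g -> (forall t, 0 <= g t)%E ->
    (\int[mu]_(t in D) g t = \int[mu]_(t in tr c @^-1` D) (g \o tr c) t)%E.
  move=> mg g0; rewrite -ge0_integral_pushforward //.
  by apply: eq_measure_integral => A mA _; apply/esym; exact: pushforward_tr.
rewrite [LHS]integralE [RHS]integralE; congr (_ - _)%E.
- rewrite ge0 //; last exact: measurable_funepos.
  by apply: eq_integral => t _; rewrite /= !funeposE.
- rewrite ge0 //; last exact: measurable_funeneg.
  by apply: eq_integral => t _; rewrite /= !funenegE.
Qed.

End Translation.
(** * Sobolev functions with vanishing traces as iterated primitives *)

Section Primitives.
Context (R : realType).
Notation mu := (@lebesgue_measure R).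
Implicit Types (f g h phi : R -> R) (L x y : R).

Lemma left_integrable_continuous_sqr f : continuous f ->
  (forall x, x <= 0 -> f x = 0) -> left_integrable (fun t => f t ^+ 2).
Proof.
move=> fc f0; apply: left_integrable_continuous => [x|x x0].
  by apply: cvgM; exact: fc.
by rewrite f0 // expr0n.
Qed.

Lemma primitive_continuous f : continuous f -> left_integrable f ->
  continuous (primitive f).
Proof.
move=> fc fi x; apply/differentiable_continuous/derivable1_diffP.
by have [] := is_derive_primitive x fc fi.
Qed.

Lemma primitive_le f x y : left_integrable f -> (forall t, 0 <= f t) -> x <= y ->
  primitive f x <= primitive f y.
Proof.
by move=> fi f0 xy; rewrite -subr_ge0 primitiveB // Rintegral_ge0.
Qed.

Lemma left_integrable_itv f x y : left_integrable f ->
  mu.-integrable `]x, y[ (EFin \o f).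
Proof.
by move=> fi; apply: integrableS (fi y) => //; apply: subset_itv; rewrite bnd_simp.
Qed.

Lemma sqr_primitiveB_le f x y : left_integrable f ->
  left_integrable (fun t => f t ^+ 2) -> x <= y ->
  (primitive f y - primitive f x) ^+ 2 <=
  (y - x) * (primitive (fun t => f t ^+ 2) y - primitive (fun t => f t ^+ 2) x).
Proof.
by move=> fi f2i xy; rewrite !primitiveB // sqr_Rintegral_le //;
  exact: left_integrable_itv.
Qed.

Lemma continuous_half_hoelder f (B : R) : 0 <= B ->
  (forall x y, x <= y -> (f y - f x) ^+ 2 <= (y - x) * B) -> continuous f.
Proof.
move=> B0 fB x; apply/cvgrPdist_lt => d d0.
have B1 : 0 < B + 1 by rewrite ltr_wpDl.
near=> y.
have xy : `|x - y| < d ^+ 2 / (B + 1).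
  by near: y; exists (d ^+ 2 / (B + 1)) => //=; rewrite divr_gt0 // exprn_gt0.
have {}fB : (f x - f y) ^+ 2 <= `|x - y| * B.
  have [yx|yx] := lerP y x; first exact: fB.
  by rewrite -sqrrN opprB fB // ltW.
rewrite -ltr_sqr ?nnegrE ?(ltW d0) // real_normK ?num_real //.
apply: le_lt_trans fB _; apply: le_lt_trans (_ : `|x - y| * (B + 1) < _).
  by rewrite ler_wpM2l // lerDl.
by rewrite -ltr_pdivlMr.
Unshelve. all: by end_near. Qed.

(** If [`|f x|] exceeded [2 * B], then [`|f|] would exceed [B] on an interval of
    length 1 containing [x], and as [1 <= L] there is one inside [[0, L]]. *)
Lemma norm_le_mean_square f L (B : R) : 1 <= L -> 0 <= B -> continuous f ->
  (forall x y, 0 <= x -> x <= y -> y <= L ->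
     (f y - f x) ^+ 2 <= (y - x) * B ^+ 2) ->
  \int[mu]_(t in `]0, L[) (f t ^+ 2) <= B ^+ 2 ->
  forall x, 0 <= x <= L -> `|f x| <= 2 * B.
Proof.
move=> L1 B0 fc fB fint x /andP[x0 xL].
rewrite leNgt; apply/negP => fx.
have [s [s0 sx xs sL]] : exists s : R, [/\ 0 <= s, s <= x, x <= s + 1 & s + 1 <= L].
  have [x1|x1] := lerP x 1; first by exists 0; split=> //; lra.
  by exists (x - 1); split; lra.
pose c := `|f x| - B.
have Bc : B < c by rewrite /c; lra.
have fc2 t : s <= t <= s + 1 -> c ^+ 2 <= f t ^+ 2.
  move=> /andP[st ts].
  have : `|f x - f t| <= B.
    rewrite -ler_sqr ?nnegrE // real_normK ?num_real //.
    have [xt|xt] := lerP x t.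
      rewrite -sqrrN opprB; apply: le_trans (fB _ _ _ xt _) _; try lra.
      by rewrite ler_piMl ?sqr_ge0 //; lra.
    apply: le_trans (fB _ _ _ (ltW xt) _) _; try lra.
    by rewrite ler_piMl ?sqr_ge0 //; lra.
  move=> h; have : c <= `|f t|.
    have := ler_normB (f x - f t) (- f t); rewrite opprK subrK normrN /c; lra.
  move=> h2; rewrite -[leRHS]real_normK ?num_real // ler_sqr ?nnegrE //.
  by rewrite /c; lra.
have f2c : continuous (fun t => f t ^+ 2) by move=> t; apply: cvgM; exact: fc.
have f2i : mu.-integrable `]0, L[ (EFin \o (fun t => f t ^+ 2)).
  by apply: continuous_itv_integrable; exact: continuous_subspaceT.
have sub : `]s, s + 1[%classic `<=` `]0, L[%classic.
  by apply: subset_itv; rewrite bnd_simp.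
have h1 : c ^+ 2 <= \int[mu]_(t in `]s, s + 1[) (f t ^+ 2).
  have -> : c ^+ 2 = \int[mu]_(t in `]s, s + 1[) (c ^+ 2).
    rewrite Rintegral_cst; last exact: measurable_itv.
    have /= -> := @lebesgue_measure_itv R `]s, s + 1[.
    by rewrite lte_fin ltrDl ltr01 /= addrAC subrr add0r mulr1.
  apply: le_Rintegral => //; first exact: integrable_cst_itv.
    by apply: integrableS f2i.
  by move=> t; rewrite /= in_itv /= => /andP[st ts]; apply: fc2; rewrite !ltW.
have h2 : \int[mu]_(t in `]s, s + 1[) (f t ^+ 2) <=
    \int[mu]_(t in `]0, L[) (f t ^+ 2).
  rewrite -(setIidr sub) Rintegral_mkcondr; apply: le_Rintegral => //.
    rewrite -restrict_EFin; apply/integrable_restrict => //.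
    by rewrite setIidr //; apply: integrableS f2i.
  by move=> t _; rewrite patchE; case: ifP => // _; exact: sqr_ge0.
have c2 : B ^+ 2 < c ^+ 2 by rewrite ltr_sqr ?nnegrE // (le_trans B0) // ltW.
by have := lt_le_trans c2 (le_trans h1 (le_trans h2 fint)); rewrite ltxx.
Qed.

Lemma aeS (P Q : R -> Prop) : (forall x, P x -> Q x) ->
  {ae mu, forall x, P x} -> {ae mu, forall x, Q x}.
Proof.
by move=> PQ; apply: filterS; first exact: (ae_filter_ringOfSetsType mu).
Qed.

Lemma ae_Rintegral L f g : {ae mu, forall x, x \in `]0, L[ -> g x = f x} ->
  measurable_fun `]0, L[ f -> measurable_fun `]0, L[ g ->
  \int[mu]_(t in `]0, L[) f t = \int[mu]_(t in `]0, L[) g t.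
Proof.
move=> fg mf mg; rewrite /Rintegral; congr fine.
apply: ae_eq_integral => //; try exact/measurable_EFinP.
by apply: aeS fg => t + tL; rewrite /= => ->.
Qed.

End Primitives.

Section Sobolev.
Context (R : realType).
Notation mu := (@lebesgue_measure R).
Implicit Types (f g h phi : R -> R) (x y : R).

Lemma weak_derivativeP s (L : R) f m : sobolev s L f -> (m <= s)%N ->
  L2 L (weak_derivative L m f) /\ is_weak_derivative L m f (weak_derivative L m f).
Proof.
move=> [_ fs] ms; rewrite /weak_derivative.
set P := [set g | _]; have : P (xget (fun=> 0) P); last by [].
by apply: xgetPex; have [g] := fs m ms; exists g.
Qed.

Lemma L2_norm_le_sobolev s (L : R) f m : (m <= s)%N ->
  L2_norm L (weak_derivative L m f) ^+ 2 <= sobolev_norm s L f ^+ 2.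
Proof.
move=> ms; rewrite /sobolev_norm sqr_sqrtr; last first.
  by apply: sumr_ge0 => i _; exact: sqr_ge0.
rewrite big_mkord (bigD1 (Ordinal (ms : (m < s.+1)%N))) //= lerDl.
by apply: sumr_ge0 => i _; exact: sqr_ge0.
Qed.

(** The continuous representatives of the successive weak derivatives are
    primitives of one another by [weak_primitive], and the vanishing traces fix
    the constants of integration. *)
Lemma trace0_primitive k (L : R) u0 : 0 < L -> sobolev k.+1 L u0 ->
  (forall m, (m <= k)%N -> trace0 L (weak_derivative L m u0) 0) ->
  exists g : nat -> R -> R, forall m, (m <= k)%N ->
  [/\ {within `[0, L], continuous (g m)}, g m 0 = 0,
      \int[mu]_(t in `]0, L[) (g m t ^+ 2) <= sobolev_norm k.+1 L u0 ^+ 2,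
      (m = 0%N -> forall x y, 0 <= x -> x < y -> y <= L ->
         \int[mu]_(t in `]x, y[) u0 t = \int[mu]_(t in `]x, y[) g 0%N t) &
      forall x, 0 <= x <= L -> g m x = \int[mu]_(t in `]0, x[)
        (if (m < k)%N then g m.+1 t else weak_derivative L k.+1 u0 t)].
Proof.
move=> L0 sob tr.
pose G m := weak_derivative L m u0.
have [g hg] : exists g : nat -> R -> R, forall m, (m <= k)%N ->
    [/\ {within `[0, L], continuous (g m)},
        {ae mu, forall x : R, x \in `]0, L[ -> g m x = G m x} & g m 0 = 0].
  have /choice[g hg] : forall m, exists g, (m <= k)%N ->
    [/\ {within `[0, L], continuous g},
        {ae mu, forall x : R, x \in `]0, L[ -> g x = G m x} & g 0 = 0].
    move=> m; have [mk|mk] := leqP m k; last by exists (fun=> 0).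
    by have [g] := tr m mk; exists g.
  by exists g.
have GP m : (m <= k.+1)%N -> L2 L (G m) /\ is_weak_derivative L m u0 (G m).
  by move=> mk; exact: weak_derivativeP sob mk.
have mG m : (m <= k.+1)%N -> measurable_fun `]0, L[ (G m).
  by move=> mk; apply: L2_measurable; have [] := GP m mk.
have gi m : (m <= k)%N -> mu.-integrable `]0, L[ (EFin \o g m).
  by move=> mk; apply: continuous_itv_integrable; have [] := hg m mk.
have mg m : (m <= k)%N -> measurable_fun `]0, L[ (g m).
  by move=> mk; apply/measurable_EFinP; case/integrableP: (gi m mk).
have cphi phi : test_function L phi -> continuous phi.
  move=> [dphi _ _] x; apply/differentiable_continuous/derivable1_diffP.
  exact: dphi 0%N x.
have mphi phi : test_function L phi -> measurable_fun `]0, L[ phi.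
  move=> tp; apply: measurable_funTS; apply: continuous_measurable_fun.
  exact: cphi.
have gG m phi : (m <= k)%N -> test_function L phi ->
    \int[mu]_(t in `]0, L[) (g m t * phi t) = \int[mu]_(t in `]0, L[) (G m t * phi t).
  move=> mk tp; apply/esym; apply: ae_Rintegral.
  - have [_ ae _] := hg m mk; apply: aeS ae => t + tL.
    by move=> /(_ tL) ->.
  - by apply: measurable_funM; [apply: mG; exact: leqW|exact: mphi].
  - by apply: measurable_funM; [exact: mg|exact: mphi].
have weakG m phi : (m <= k)%N -> test_function L phi ->
    test_function L (derive1 phi) ->
    \int[mu]_(t in `]0, L[) (g m t * derive1 phi t) =
    - \int[mu]_(t in `]0, L[) (G m.+1 t * phi t).
  move=> mk tp tp'; rewrite gG //.
  have [_ w1] := GP m (leqW mk); have [_ w2] := GP m.+1 mk.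
  have := w1 _ tp'; rewrite /derive1n -iterSr -[iter m.+1 _ _]/(derive1n m.+1 phi).
  rewrite (w2 _ tp) exprS mulN1r mulNr -mulrN => h.
  have s0 : (-1) ^+ m != 0 :> R by rewrite signr_eq0.
  by apply: (mulfI s0); rewrite -h.
exists g => m mk; have [gc ae g0] := hg m mk; split=> //.
- have -> : \int[mu]_(t in `]0, L[) (g m t ^+ 2) = \int[mu]_(t in `]0, L[) (G m t ^+ 2).
    apply/esym; apply: ae_Rintegral.
    + by apply: aeS ae => t + tL => /(_ tL) ->.
    + by apply: measurable_funX; apply: mG; exact: leqW.
    + by apply: measurable_funX; exact: mg.
  rewrite -sqr_L2_norm; last by have [] := GP m (leqW mk).
  by apply: L2_norm_le_sobolev; exact: leqW.
- move=> m0; rewrite m0 in mk gc *; apply: (weak_eq_Rintegral (L := L)).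
  + by case: sob => uL _; exact: L2_integrable uL.
  + exact: gi.
  + move=> phi tp; rewrite gG //; have [_ w] := GP 0%N isT.
    by have := w _ tp; rewrite expr0 mul1r.
- move=> x /andP[x0 xL]; have [->|x_neq0] := eqVneq x 0.
    by rewrite g0 set_itv_ge ?bnd_simp // Rintegral_set0.
  have {x_neq0}x0 : 0 < x by rewrite lt_neqAle eq_sym x_neq0.
  transitivity (g m x - g m 0); first by rewrite g0 subr0.
  apply: (weak_primitive (L := L)) => //.
    case: (ltnP m k) => mk'; first exact: gi.
    by have [GL _] := GP k.+1 (leqnn _); exact: L2_integrable GL.
  move=> phi tp tp'; rewrite weakG //; congr (- _).
  case: (ltnP m k) => mk'; first by rewrite gG.
  by have -> : m = k by lia.
Qed.

End Sobolev.
(** The successive primitives from the left of the weak derivative of order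
    [k.+1], extended by zero: [V i.+1] is then an extension to the whole line of
    the weak derivative of order [i], and [V 0] a primitive of the initial datum.
    [E] and [E0] are primitives of the squares of the weak derivatives of order
    [k.+1] and [0]. *)
Record primitive_chain (R : realType) (k : nat) (L B : R) (u0 : R -> R)
    (V : nat -> R -> R) (E E0 : R -> R) : Prop := PrimitiveChain {
  chain_left : forall (i : nat) (x : R), (i <= k.+1)%N -> x <= 0 -> V i x = 0;
  chain_is_derive : forall (i : nat) (x : R), (i <= k)%N -> is_derive x 1 (V i) (V i.+1 x);
  chain_hoelder : forall x y : R, x <= y ->
    (V k.+1 y - V k.+1 x) ^+ 2 <= (y - x) * (E y - E x);
  chain_nondecreasing : forall x y : R, x <= y -> E x <= E y;
  chain_energy_bound : forall x : R, 0 <= E x <= B ^+ 2;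
  chain_hoelder0 : forall x y : R, x <= y ->
    (V 0%N y - V 0%N x) ^+ 2 <= (y - x) * (E0 y - E0 x);
  chain_energy0_bound : forall x : R, x <= L -> 0 <= E0 x <= B ^+ 2;
  chain_bound : forall (i : nat) (x : R), (0 < i <= k.+1)%N -> x <= L -> `|V i x| <= 2 * B;
  chain_average : forall c x y : R, 0 <= c -> x <= y -> y <= L ->
    \int[@lebesgue_measure R]_(t in `]x, y[) extend0 u0 (t - c) =
    V 0%N (y - c) - V 0%N (x - c) }.

Section Chain.
Context (R : realType).
Notation mu := (@lebesgue_measure R).

Lemma left_integrable_restrict (f : R -> R) (L : R) :
  mu.-integrable `]0, L[ (EFin \o f) -> left_integrable (f \_ `]0, L[).
Proof.
move=> fi u; rewrite -restrict_EFin; apply/integrable_restrict => //.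
by apply: integrableS fi => //; exact: measurableI.
Qed.

(** [W d] is obtained by [d.+1] integrations from the derivative of order [k.+1]
    extended by zero.  It agrees on [(0, L)] with the continuous representative of
    the weak derivative of order [k - d], as both vanish at [0] and have the same derivative. *)
Lemma sobolev_primitive_chain (k : nat) (L : R) (u0 : R -> R) : 1 <= L ->
  sobolev k.+1 L u0 ->
  (forall m, (m <= k)%N -> trace0 L (weak_derivative L m u0) 0) ->
  exists V E E0, primitive_chain k L (sobolev_norm k.+1 L u0) u0 V E E0.
Proof.
move=> L1 sob tr; have L0 : 0 < L by apply: lt_le_trans L1.
set B := sobolev_norm k.+1 L u0.
have B0 : 0 <= B by exact: sqrtr_ge0.
have [g hg] := trace0_primitive L0 sob tr.
pose G := weak_derivative L k.+1 u0.
have [GL _] := weak_derivativeP sob (leqnn k.+1); rewrite -/G in GL.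
have Gi := left_integrable_restrict (L2_integrable GL).
have G2E : (fun t => (G \_ `]0, L[) t ^+ 2) = (fun t => G t ^+ 2) \_ `]0, L[.
  by apply/funext => t; rewrite !patchE; case: ifP => _ //=; rewrite expr0n.
have G2i : left_integrable (fun t => (G \_ `]0, L[) t ^+ 2).
  by rewrite G2E; exact: left_integrable_restrict (L2_integrable_sqr GL).
pose W d := iter d.+1 (@primitive R) (G \_ `]0, L[).
pose E := primitive (fun t => (G \_ `]0, L[) t ^+ 2).
have E_ge0 x : 0 <= E x by apply: Rintegral_ge0 => t _; exact: sqr_ge0.
have E_le x y : x <= y -> E x <= E y.
  by move=> xy; apply: primitive_le => // t; exact: sqr_ge0.
have E_bound x : E x <= B ^+ 2.
  apply: le_trans (E_le x (Num.max x L) _) _; first by rewrite le_max lexx.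
  rewrite /E G2E /primitive -Rintegral_mkcondr setIidr; last first.
    by apply: subset_itv; rewrite bnd_simp // le_max lexx orbT.
  by rewrite -sqr_L2_norm //; exact: L2_norm_le_sobolev.
have W0_hoelder x y : x <= y -> (W 0%N y - W 0%N x) ^+ 2 <= (y - x) * (E y - E x).
  by move=> xy; exact: sqr_primitiveB_le.
have WP d : continuous (W d) /\ forall x, x <= 0 -> W d x = 0.
  elim: d => [|d [IHc IH0]]; split.
  - apply: (continuous_half_hoelder (B := B ^+ 2)); first exact: sqr_ge0.
    move=> x y xy; apply: le_trans (W0_hoelder x y xy) _.
    rewrite ler_wpM2l ?subr_ge0 //; have := E_ge0 x; have := E_bound y; lra.
  - move=> x x0; apply: primitive_eq0 => y yx; rewrite patchE memNset //=.
    by rewrite in_itv /=; apply/negP; rewrite negb_and -leNgt (le_trans yx).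
  - by apply: primitive_continuous => //; exact: left_integrable_continuous.
  - move=> x x0; apply: primitive_eq0 => y yx; apply: IH0; exact: le_trans yx x0.
have Wi d : left_integrable (W d).
  by have [? ?] := WP d; exact: left_integrable_continuous.
have W2i d : left_integrable (fun t => W d t ^+ 2).
  by have [? ?] := WP d; exact: left_integrable_continuous_sqr.
have W0B d x : 0 <= x -> W d.+1 x = \int[mu]_(t in `]0, x[) W d t.
  move=> x0; have [_ Wd0] := WP d.+1.
  transitivity (W d.+1 x - W d.+1 0); first by rewrite (Wd0 0) // subr0.
  exact: (primitiveB (Wi d) x0).
have Wg d : (d <= k)%N -> forall x, 0 <= x <= L -> W d x = g (k - d)%N x.
  elim: d => [|d IH] dk x /andP[x0 xL].
    rewrite subn0; have [_ _ _ _ ->] := hg k (leqnn k); last by rewrite x0.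
    rewrite ltnn -/G; have [_ W00] := WP 0%N.
    transitivity (W 0%N x - W 0%N 0); first by rewrite (W00 0) // subr0.
    rewrite (primitiveB Gi x0 : W 0%N x - W 0%N 0 = _) -Rintegral_mkcondr.
    by rewrite setIidl //; apply: subset_itv; rewrite bnd_simp.
  have [_ _ _ _ ->] := hg (k - d.+1)%N (leq_subr _ _); last by rewrite x0.
  have mk : (k - d.+1 < k)%N by int_lia.
  rewrite mk W0B //; apply: eq_Rintegral => t; rewrite inE /= in_itv /= => /andP[t0 tx].
  rewrite IH; [|by int_lia|by rewrite ltW // ltW // (lt_le_trans tx)].
  by rewrite subnSK.
have W2_int d : (d <= k)%N -> \int[mu]_(t in `]0, L[) (W d t ^+ 2) <= B ^+ 2.
  move=> dk; have [_ _ gB _ _] := hg (k - d)%N (leq_subr _ _); apply: le_trans gB.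
  rewrite le_eqVlt; apply/orP; left; apply/eqP; apply: eq_Rintegral => t.
  by rewrite inE /= in_itv /= => /andP[t0 tL]; rewrite Wg // !ltW.
have W2_bound d x : (d <= k)%N -> x <= L -> 
    0 <= primitive (fun t => W d t ^+ 2) x <= B ^+ 2.
  move=> dk xL; apply/andP; split; first by apply: Rintegral_ge0 => t _; exact: sqr_ge0.
  apply: le_trans (primitive_le (W2i d) _ xL) _; first by move=> t; exact: sqr_ge0.
  have [_ Wd0] := WP d; rewrite -[leLHS]subr0.
  rewrite -(primitive_eq0 (f := fun t => W d t ^+ 2) (x := 0)); last first.
    by move=> y y0; rewrite Wd0 // expr0n.
  by rewrite primitiveB //; [exact: W2_int|exact: ltW].
have W_hoelder d x y : (d <= k)%N -> x <= y -> y <= L ->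
    (W d y - W d x) ^+ 2 <= (y - x) * B ^+ 2.
  case: d => [|d] dk xy yL.
    apply: le_trans (W0_hoelder x y xy) _.
    rewrite ler_wpM2l ?subr_ge0 //; have := E_ge0 x; have := E_bound y; lra.
  apply: le_trans (sqr_primitiveB_le (Wi d) (W2i d) xy) _.
  rewrite ler_wpM2l ?subr_ge0 //.
  have /andP[h1 _] := W2_bound d x (ltnW dk) (le_trans xy yL).
  have /andP[_ h2] := W2_bound d y (ltnW dk) yL.
  by apply: le_trans h2; rewrite gerBl.
exists (fun i => W (k.+1 - i)%N), E, (primitive (fun t => W k t ^+ 2)); split.
- by move=> i x _ x0; have [_ ->] := WP (k.+1 - i)%N.
- move=> i x ik; have [Wc _] := WP (k - i)%N.
  have := is_derive_primitive x Wc (Wi (k - i)%N).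
  by rewrite subSS -[primitive _]/(W (k - i).+1) -subSn.
- by move=> x y xy; rewrite subnn; exact: W0_hoelder.
- exact: E_le.
- by move=> x; rewrite E_ge0 E_bound.
- by move=> x y xy; rewrite subn0; exact: (sqr_primitiveB_le (Wi k) (W2i k) xy).
- by move=> x xL; exact: W2_bound.
- move=> i x /andP[i0 ik] xL; have dk : (k.+1 - i <= k)%N by int_lia.
  have [Wc Wx0] := WP (k.+1 - i)%N.
  have [x0|x0] := lerP x 0; first by rewrite Wx0 // normr0 mulr_ge0.
  apply: (norm_le_mean_square L1 B0 Wc) => //; last by rewrite xL (ltW x0).
    by move=> y z _ yz zL; exact: W_hoelder.
  exact: W2_int.
- move=> c x y c0 xy yL; rewrite subn0; have [_ Wx0] := WP k.+1.
  have [uL _] := sob.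
  have mu0 : measurable_fun setT (u0 \_ `]0, L[).
    by move: uL; rewrite /L2 inE => /andP[/[!inE] /= mf _].
  transitivity (\int[mu]_(t in `]x, y[) (u0 \_ `]0, L[) (t - c)).
    apply: eq_Rintegral => t; rewrite inE /= in_itv /= => /andP[xt ty].
    rewrite /extend0 patchE; case: ifP => t0.
      rewrite memNset //= in_itv /=; apply/negP; by rewrite negb_and -leNgt t0.
    rewrite mem_set //= in_itv /=; apply/andP; split; last by lra.
    by rewrite ltNge t0.
  rewrite Rintegral_translate; last exact: measurable_funS mu0.
  have := lerB xy (lexx c); set x' := x - c; set y' := y - c => xy'.
  have y'L : y' <= L by rewrite /y'; lra.
  rewrite -Rintegral_mkcondr.
  have -> : (`]x', y'[ `&` `]0, L[)%classic = `]Num.max x' 0, y'[%classic.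
    apply/seteqP; split=> t; rewrite /= !in_itv /= gt_max.
      by move=> [/andP[-> ->] /andP[-> _]].
    by move=> /andP[/andP[-> ->] ty]; rewrite ty (lt_le_trans ty).
  have -> : W k.+1 x' = W k.+1 (Num.max x' 0).
    by have [h|h] := leP x' 0; rewrite // !Wx0.
  have [hy|hy] := leP y' (Num.max x' 0).
    rewrite set_itv_ge ?bnd_simp -?leNgt // Rintegral_set0.
    have [hx|hx] := leP x' 0; move: hy.
      by rewrite max_r // => hy; rewrite !Wx0 ?subrr.
    rewrite max_l ?(ltW hx) // => hy.
    have -> : x' = y' by apply/eqP; rewrite eq_le xy'.
    by rewrite subrr.
  have m0 : 0 <= Num.max x' 0 by rewrite le_max lexx orbT.
  have [_ _ _ /(_ erefl _ _ m0 hy y'L) -> _] := hg 0%N isT.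
  rewrite -[W k.+1 y']/(primitive (W k) y') -[W k.+1 _]/(primitive (W k) _).
  rewrite primitiveB //; last exact: ltW.
  apply: eq_Rintegral => t; rewrite inE /= in_itv /= => /andP[t0 ty].
  rewrite Wg ?subnn //; apply/andP; split; apply: ltW.
    by rewrite (le_lt_trans m0).
  by rewrite (lt_le_trans ty).
Qed.

End Chain.
(** * Consistency of the scheme *)

Section Taylor.
Context (R : realType).
Implicit Types (f : nat -> R -> R) (x h M : R).

Definition taylor_poly f k x : {poly R} := \poly_(i < k.+1) (f i x / i`!%:R).

Lemma deriv_taylor_poly f k x :
  (taylor_poly f k.+1 x)^`() = taylor_poly (fun i => f i.+1) k x.
Proof.
apply/polyP => i; rewrite coef_deriv !coef_poly ltnS.
case: ifP => _; last by rewrite mul0rn.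
have i1 : i.+1%:R != 0 :> R by rewrite pnatr_eq0.
have i2 : i`!%:R != 0 :> R by rewrite pnatr_eq0 -lt0n fact_gt0.
rewrite -[LHS]mulr_natr factS natrM.
by rewrite [in LHS]mulrC invfM mulrCA mulVKf.
Qed.

Lemma taylor_remainder_le f k x h M :
  (forall (i : nat) (z : R), (i < k)%N -> is_derive z 1 (f i) (f i.+1 z)) ->
  (forall s, `|s| <= `|h| -> `|f k (x + s) - f k x| <= M) ->
  `|f 0%N (x + h) - (taylor_poly f k x).[h]| <= `|h| ^+ k * M.
Proof.
elim: k f h => [|k IH] f h fd fM.
  rewrite mul1r; have := fM h (lexx _); congr (`| _ - _ | <= _).
  by rewrite /taylor_poly poly_def big_ord1 expr0 fact0 divr1 hornerZ hornerE mulr1.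
pose phi t := f 0%N (x + t) - (taylor_poly f k.+1 x).[t].
pose dphi t := f 1%N (x + t) - (taylor_poly (fun i => f i.+1) k x).[t].
have phi_d (t : R) : is_derive t 1 phi (dphi t).
  rewrite /dphi -deriv_taylor_poly; apply: is_deriveB.
  have := is_derive_comp_affine (f := f 0%N) (c := 1) (d := x) (x := t) (fd 0%N _ isT).
  rewrite !mul1r addrC; congr (is_derive _ _ _ _); apply/funext => s.
  by rewrite mul1r addrC.
have dphi_le t : `|t| <= `|h| -> `|dphi t| <= `|t| ^+ k * M.
  move=> th; apply: IH => [i z ik|s st]; first exact: fd.
  by apply: fM; exact: le_trans th.
have phi0 : phi 0 = 0.
  rewrite /phi addr0 horner_coef0 coef_poly /= fact0 divr1 subrr //.
rewrite -/(phi h); have [z zh ->] : exists2 z, `|z| <= `|h| & phi h = dphi z * h.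
  have [h0|h0] := lerP 0 h.
    have [z /andP[z0 zh]] := MVT_le phi_d h0.
    by rewrite phi0 !subr0 => E; exists z; rewrite // !ger0_norm.
  have [z /andP[zh z0]] := MVT_le phi_d (ltW h0).
  rewrite phi0 !sub0r mulrN => /oppr_inj E; exists z => //.
  by rewrite ler0_norm // ler0_norm ?(ltW h0) // lerN2.
rewrite normrM exprSr mulrAC ler_wpM2r //.
apply: le_trans (dphi_le z zh) _; rewrite ler_wpM2r //.
  by apply: le_trans (fM 0 _) => //; rewrite normr0.
by rewrite lerXn2r ?nnegrE.
Qed.

(** Each backward difference of sampled values is the sampling of a difference
    over the distance [d], which the mean value theorem trades for a derivative
    and a factor [d]. *)
Lemma iter_backward_diff_sample_le (d c Z M : R) f m : 0 <= d ->
  (forall (i : nat) (z : R), (i < m)%N -> is_derive z 1 (f i) (f i.+1 z)) ->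
  (forall z, z <= Z -> `|f m z| <= M) ->
  forall j : int, j%:~R * d - c <= Z ->
  `|iter m (@backward_diff R) (fun j => f 0%N (j%:~R * d - c)) j| <= d ^+ m * M.
Proof.
move=> d0; elim: m f M => [|m IH] f M fd fM j jZ; first by rewrite mul1r fM.
pose g i z := f i z - f i (z + - d).
have gd (i : nat) (z : R) : (i < m.+1)%N -> is_derive z 1 (g i) (g i.+1 z).
  move=> im; apply: is_deriveB; first exact: fd.
  have := is_derive_comp_affine (f := f i) (c := 1) (d := - d) (x := z) (fd i _ im).
  by rewrite !mul1r; congr (is_derive _ _ _ _); apply/funext => s; rewrite mul1r.
rewrite iterSr (_ : backward_diff _ = fun j : int => g 0%N (j%:~R * d - c)).
  rewrite exprSr -mulrA; apply: IH => // [i z im|z zZ]; first exact/gd/ltnW.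
  have zd : z + - d <= z by rewrite gerDl oppr_le0.
  have [y /andP[y1 y2]] := MVT_le (fun y => fd m y (leqnn _)) zd.
  rewrite /g => ->; rewrite opprD addrA subrr sub0r opprK normrM mulrC.
  by rewrite (ger0_norm d0) ler_wpM2l // fM // (le_trans y2).
apply/funext => i; rewrite /backward_diff /g; congr (_ - f _ _).
by rewrite intrB; ring.
Qed.

End Taylor.

Lemma wsum_increments_le (R : realType) (e : int -> R) (x : int) (n h : nat) (b : R) :
  (forall j, 0 <= e j <= b) ->
  wsum (fun j => e (j + h%:Z) - e j) x n <= h%:R * b.
Proof.
move=> eb; have e0 j : 0 <= e j by have /andP[] := eb j.
have hE : wsum (fun j => e (j + h%:Z)) x n + wsum e x h = wsum e x n + wsum e (x + n%:Z) h.
  by rewrite wsum_shift addrC -!wsum_cat addnC.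
have -> : wsum (fun j => e (j + h%:Z) - e j) x n =
    wsum (fun j => e (j + h%:Z)) x n - wsum e x n.
  rewrite -mulN1r -wsumZ -wsumD.
  by apply: eq_wsum => j _; rewrite mulN1r.
apply: (@le_trans _ _ (wsum e (x + n%:Z) h)).
  by have := wsum_ge0 x h e0; lra.
by rewrite -(wsum_cst b (x + n%:Z)); apply: le_wsum => j _; have /andP[] := eb j.
Qed.

Section ChainEstimates.
Context (R : realType) (k : nat) (L B : R) (u0 : R -> R).
Context (V : nat -> R -> R) (E E0 : R -> R).
Hypothesis B_ge0 : 0 <= B.
Hypothesis chain : primitive_chain k L B u0 V E E0.

(** The ghost cells reach beyond [L].  There the bound on [V i] follows from that
    on [V i.+1] by the mean value theorem, starting from the Hoelder estimate on
    [V k.+1]. *)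
Lemma chain_bound_beyond (p i : nat) (x : R) : (0 < p)%N -> (0 < i <= k.+1)%N ->
  x <= L + p%:R -> `|V i x| <= (1 + p%:R) ^+ k * (2 + p%:R) * B.
Proof.
move=> p0 ik xL; have p1 : 1 <= p%:R :> R by rewrite ler1n.
have geo d : 1 <= (1 + p%:R) ^+ d :> R by apply: exprn_ege1; lra.
have split_bound i' x' b : (0 < i' <= k.+1)%N -> (L < x' -> `|V i' x' - V i' L| <= b) ->
    0 <= b -> `|V i' x'| <= 2 * B + b.
  move=> ik' hb b0; have [xL'|Lx] := leP x' L.
    by apply: le_trans (chain_bound chain ik' xL') _; rewrite lerDl.
  rewrite -[V i' x'](subrK (V i' L)) addrC; apply: le_trans (ler_normD _ _) _.
  by apply: lerD; [exact: (chain_bound chain)|exact: hb].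
suff claim d y : (d <= k)%N -> y <= L + p%:R ->
    `|V (k.+1 - d)%N y| <= (1 + p%:R) ^+ d * (2 + p%:R) * B.
  move: ik => /andP[i0 ik]; rewrite (_ : i = (k.+1 - (k.+1 - i))%N); last by int_lia.
  have dk : (k.+1 - i <= k)%N by int_lia.
  apply: le_trans (claim _ _ dk xL) _; rewrite ler_wpM2r //.
  by rewrite ler_pM2r; [apply: ler_weXn2l => //; lra|lra].
elim: d y {i x ik xL} => [|d IH] x dk xL.
  have pB0 : 0 <= p%:R * B by exact: mulr_ge0.
  rewrite subn0 mul1r mulrDl; apply: split_bound => //= Lx.
  rewrite -ler_sqr ?nnegrE ?normr_ge0 //.
  rewrite real_normK ?num_real //.
  apply: le_trans (chain_hoelder chain (ltW Lx)) _.
  have /andP[_ E1] := chain_energy_bound chain x.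
  have /andP[E2 _] := chain_energy_bound chain L.
  rewrite exprMn; apply: (@le_trans _ _ (p%:R * B ^+ 2)).
    have E3 := chain_nondecreasing chain (ltW Lx).
    by apply: ler_pM; rewrite ?subr_ge0 ?(ltW Lx) // ?lerBlDl //; lra.
  by rewrite ler_wpM2r ?sqr_ge0 // expr2 ler_peMl //; lra.
set X := (1 + p%:R) ^+ d * (2 + p%:R) * B.
have X2 : 2 * B <= X.
  have pB0 : 0 <= p%:R * B by exact: mulr_ge0.
  rewrite /X -mulrA; apply: (@le_trans _ _ ((2 + p%:R) * B)).
    by rewrite [leRHS]mulrDl lerDl.
  by rewrite ler_peMl // mulr_ge0 // addr_ge0.
rewrite exprS [leRHS](_ : _ = X + p%:R * X); last by rewrite /X; ring.
apply: (@le_trans _ _ (2 * B + p%:R * X)); last by rewrite lerD2r.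
have X0 : 0 <= X by rewrite (le_trans _ X2) // mulr_ge0.
apply: split_bound; [by int_lia| |by rewrite mulr_ge0].
move=> Lx; have ik : (k.+1 - d.+1 <= k)%N by int_lia.
have [z /andP[z1 z2] ->] := MVT_le (fun z => chain_is_derive chain z ik) (ltW Lx).
rewrite normrM mulrC (ger0_norm (_ : 0 <= x - L)); last by lra.
apply: ler_pM; rewrite ?subr_ge0 ?(ltW Lx) //; first by lra.
by rewrite subSS -subSn ?(ltnW dk) // IH ?(ltnW dk) ?(le_trans z2).
Qed.

Definition exact_average (d c : R) (j : int) : R :=
  (V 0%N (j%:~R * d - c) - V 0%N ((j - 1)%:~R * d - c)) / d.

Definition difference_quotient (d : R) (i : nat) (x : R) : R :=
  (V i x - V i (x - d)) / d.

Lemma is_derive_difference_quotient d i (x : R) : (i <= k)%N ->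
  is_derive x 1 (difference_quotient d i) (difference_quotient d i.+1 x).
Proof.
move=> ik; rewrite /difference_quotient.
have D1 := chain_is_derive chain x ik.
have D2 : is_derive x 1 (fun x => V i (x - d)) (V i.+1 (x - d)).
  have := @is_derive_comp_affine _ (V i) 1 (- d) x _ (chain_is_derive chain _ ik).
  by rewrite !mul1r; congr (is_derive _ _ _ _); apply/funext => s; rewrite mul1r.
rewrite [_ / d]mulrC; have := is_deriveZ d^-1 (is_deriveB D1 D2).
by congr (is_derive _ _ _ _); apply/funext => s; rewrite /= mulrC.
Qed.

Lemma exact_averageE d c j :
  exact_average d c j = difference_quotient d 0 (j%:~R * d - c).
Proof.
rewrite /exact_average /difference_quotient; congr ((_ - V _ _) / _).
by rewrite intrB; ring.
Qed.

Lemma difference_quotient_mean d i (x : R) : 0 < d -> (i <= k)%N ->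
  exists2 z, x - d <= z <= x & difference_quotient d i x = V i.+1 z.
Proof.
move=> d0 ik; have xd : x - d <= x by lra.
have [z hz e] := MVT_le (fun z => chain_is_derive chain z ik) xd.
exists z => //; rewrite /difference_quotient e opprB addrC subrK mulfK //.
by rewrite gt_eqF.
Qed.

(** The mean value theorem turns the two quotients into values of [V k.+1] at
    points that lie between [x - h.+1%:R * d] and [x + h%:R * d]. *)
Lemma difference_quotient_dist d h (x s : R) : 0 < d -> `|s| <= h%:R * d ->
  `|difference_quotient d k (x + s) - difference_quotient d k x| <=
  Num.sqrt (h.+1%:R * d * (E (x + h%:R * d) - E (x - h.+1%:R * d))).
Proof.
move=> d0 sh; have [z1 /andP[z1l z1r] ->] := difference_quotient_mean (x + s) d0 (leqnn k).
have [z2 /andP[z2l z2r] ->] := difference_quotient_mean x d0 (leqnn k).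
move: sh; rewrite ler_norml => /andP[s1 s2]; rewrite -natr1 mulrDl mul1r.
have hd : 0 <= h%:R * d by apply: mulr_ge0; rewrite // ltW.
have osc z z' : z <= z' -> x - (h%:R * d + d) <= z -> z' <= x + h%:R * d ->
    z' - z <= h%:R * d + d -> `|V k.+1 z' - V k.+1 z| <=
    Num.sqrt ((h%:R * d + d) * (E (x + h%:R * d) - E (x - (h%:R * d + d)))).
  move=> zz lz z'u dz; rewrite -sqrtr_sqr ler_wsqrtr //.
  apply: le_trans (chain_hoelder chain zz) _.
  have e1 := chain_nondecreasing chain z'u.
  have e2 := chain_nondecreasing chain lz.
  have e3 := chain_nondecreasing chain zz.
  by apply: ler_pM; rewrite ?subr_ge0 ?lerB.
have [zz|zz] := leP z1 z2; [rewrite distrC|move/ltW: zz => zz]; apply: osc => //; lra.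
Qed.

(** The moment conditions say that the stencil translates the polynomials of
    degree [k] by [- mu] cells. *)
Lemma stencil_taylor (r p : nat) (a_ : int -> R) (mu d x : R) (f : nat -> R -> R) :
  (forall m : nat, (m <= k)%N ->
    stencil_sum r p (fun l => l%:~R ^+ m * a_ l) = (- mu) ^+ m) ->
  stencil_sum r p (fun l => a_ l * (taylor_poly f k x).[l%:~R * d]) =
  (taylor_poly f k x).[- mu * d].
Proof.
move=> consistency; rewrite /taylor_poly horner_poly.
transitivity (\sum_(i < k.+1) f i x / i`!%:R * d ^+ i *
    stencil_sum r p (fun l => l%:~R ^+ i * a_ l)).
  rewrite /stencil_sum; under eq_bigr do rewrite horner_poly mulr_sumr.
  rewrite exchange_big; apply: eq_bigr => i _; rewrite mulr_sumr.
  by apply: eq_bigr => l _; rewrite exprMn; ring.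
by apply: eq_bigr => i _; rewrite consistency ?exprMn; [ring|rewrite -ltnS ltn_ord].
Qed.

(** The scheme is exact on polynomials of degree [k], so that only the Taylor
    remainders contribute. *)
Lemma truncation_le (r p : nat) (a_ : int -> R) (mu : R) (H : nat) (d c : R) (j : int) :
  (forall m : nat, (m <= k)%N ->
    stencil_sum r p (fun l => l%:~R ^+ m * a_ l) = (- mu) ^+ m) ->
  (r <= H)%N -> (p <= H)%N -> `|mu| <= H%:R -> 0 < d ->
  (stencil r p a_ (exact_average d c) j - exact_average d (c + mu * d) j) ^+ 2 <=
  (stencil_sum r p (fun l => `|a_ l|) + 1) ^+ 2 * (H%:R * d) ^+ (2 * k) *
  (H.+1%:R * d * (E ((j + H%:Z)%:~R * d - c) - E ((j - H.+1%:Z)%:~R * d - c))).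
Proof.
move=> consistency rH pH muH d0; set x := j%:~R * d - c.
set q := difference_quotient d.
have HE : E ((j + H%:Z)%:~R * d - c) - E ((j - H.+1%:Z)%:~R * d - c) =
    E (x + H%:R * d) - E (x - H.+1%:R * d).
  by congr (E _ - E _); rewrite /x ?intrD ?intrB -?pmulrn; ring.
rewrite HE; set M2 := H.+1%:R * d * _.
have d_ge0 := ltW d0.
have HdE : E (x - H.+1%:R * d) <= E (x + H%:R * d).
  apply: (chain_nondecreasing chain); rewrite lerD2l.
  by apply: (@le_trans _ _ 0); rewrite ?oppr_le0 mulr_ge0.
have M2_ge0 : 0 <= M2 by rewrite mulr_ge0 ?subr_ge0 // mulr_ge0.
pose P := taylor_poly q k x.
have remainder s : `|s| <= H%:R * d ->
    `|q 0%N (x + s) - P.[s]| <= (H%:R * d) ^+ k * Num.sqrt M2.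
  move=> sH; apply: (@le_trans _ _ (`|s| ^+ k * Num.sqrt M2)).
    apply: taylor_remainder_le => [i z ik|t ts].
      exact: is_derive_difference_quotient (ltnW ik).
    by apply: difference_quotient_dist => //; exact: le_trans sH.
  by rewrite ler_wpM2r ?sqrtr_ge0 // lerXn2r ?nnegrE ?mulr_ge0.
have -> : stencil r p a_ (exact_average d c) j - exact_average d (c + mu * d) j =
    stencil_sum r p (fun l => a_ l * (q 0%N (x + l%:~R * d) - P.[l%:~R * d])) +
    (- 1) * (q 0%N (x + - mu * d) - P.[- mu * d]).
  rewrite mulN1r opprB addrCA -(stencil_taylor d x q consistency) exact_averageE.
  rewrite (_ : j%:~R * d - (c + mu * d) = x + - mu * d); last by rewrite /x; ring.
  rewrite -/q [RHS]addrA; congr (_ - _).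
  rewrite -stencil_sumD; apply: eq_stencil_sum => l _; rewrite exact_averageE -/q.
  rewrite (_ : (j + l)%:~R * d - c = x + l%:~R * d); first by rewrite -mulrDr subrKC.
  by rewrite /x intrD; ring.
rewrite -(sqr_sqrtr M2_ge0) mulnC exprM -!exprMn -[leLHS]real_normK ?num_real //.
set A0 := stencil_sum r p (fun l => `|a_ l|); set Y := (H%:R * d) ^+ k.
have A0_ge0 : 0 <= A0 by exact: stencil_sum_ge0.
have Y_ge0 : 0 <= Y by rewrite exprn_ge0 ?mulr_ge0.
rewrite lerXn2r ?nnegrE ?normr_ge0 ?mulr_ge0 ?sqrtr_ge0 ?addr_ge0 //.
apply: le_trans (ler_normD _ _) _; rewrite -mulrA mulrDl mul1r; apply: lerD.
  apply: le_trans (ler_norm_stencil_sum _ _ _) _.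
  rewrite mulrC -stencil_sumZ; apply: le_stencil_sum => l hl.
  rewrite normrM mulrC ler_wpM2r //; apply: remainder.
  rewrite normrM (ger0_norm d_ge0) ler_wpM2r // -intr_norm.
  by rewrite pmulrn ler_int; int_lia.
rewrite normrM normrN1 mul1r; apply: remainder.
by rewrite normrM normrN (ger0_norm d_ge0) ler_wpM2r.
Qed.

(** The increments of [E] over the stencils of all the cells overlap at most
    [H + H.+1] times, so that their sum is bounded by that multiple of the
    supremum of [E], whatever the number of cells. *)
Lemma energy_truncation_le (r p : nat) (a_ : int -> R) (mu : R) (H : nat) (d c : R) n :
  (forall m : nat, (m <= k)%N ->
    stencil_sum r p (fun l => l%:~R ^+ m * a_ l) = (- mu) ^+ m) ->
  (r <= H)%N -> (p <= H)%N -> `|mu| <= H%:R -> 0 < d ->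
  energy (fun j => exact_average d (c + mu * d) j -
    stencil r p a_ (exact_average d c) j) 1 n <=
  (stencil_sum r p (fun l => `|a_ l|) + 1) ^+ 2 * H%:R ^+ (2 * k) * H.+1%:R *
  (H + H.+1)%:R * d ^+ (2 * k).+1 * B ^+ 2.
Proof.
move=> consistency rH pH muH d0.
pose e (j : int) := E ((j - H.+1%:Z)%:~R * d - c).
set A0 := stencil_sum r p (fun l => `|a_ l|).
pose K := (A0 + 1) ^+ 2 * (H%:R * d) ^+ (2 * k) * (H.+1%:R * d).
have K0 : 0 <= K.
  by rewrite /K mulrA mulr_ge0 ?(ltW d0) // mulr_ge0 // mulr_ge0 ?sqr_ge0 //
    exprn_ge0 // mulr_ge0 // ltW.
apply: (@le_trans _ _ (wsum (fun j => K * (e (j + (H + H.+1)%:Z) - e j)) 1 n)).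
  apply: le_wsum => j _; rewrite -sqrrN opprB.
  apply: le_trans (truncation_le c j consistency rH pH muH d0) _.
  rewrite -/A0 mulrA -/K /e.
  by rewrite (_ : j + (H + H.+1)%:Z - H.+1%:Z = j + H%:Z) // ; int_lia.
rewrite wsumZ [leRHS](_ : _ = K * ((H + H.+1)%:R * B ^+ 2)); last first.
  by rewrite /K exprMn (exprS d); ring.
rewrite ler_wpM2l //; apply: wsum_increments_le => j; exact: (chain_energy_bound chain).
Qed.

(** Only [minn k kb] of the differences gain a factor [d]; the other ones are
    bounded trivially. *)
Lemma iter_backward_diff_exact_average_le (p kb : nat) (d c : R) (j : int) :
  (0 < p)%N -> 0 < d -> j%:~R * d - c <= L + p%:R ->
  `|iter kb (@backward_diff R) (exact_average d c) j| <=
  2 ^+ (kb - minn k kb) * d ^+ minn k kb * ((1 + p%:R) ^+ k * (2 + p%:R) * B).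
Proof.
move=> p0 d0 jL; set m := minn k kb; have mk : (m <= k)%N by exact: geq_minl.
rewrite -{1}(subnK (geq_minr k kb : (m <= kb)%N)) iterD -mulrA.
apply: le_iter_backward_diff => i ij.
rewrite (_ : exact_average d c = fun j => difference_quotient d 0 (j%:~R * d - c)); last first.
  by apply/funext => i'; rewrite exact_averageE.
apply: (@iter_backward_diff_sample_le _ d c (L + p%:R)).
- exact: ltW.
- by move=> i' z im; apply: is_derive_difference_quotient; lia.
- move=> z zL; have [y /andP[_ yz] ->] := difference_quotient_mean z d0 mk.
  by apply: chain_bound_beyond => //; exact: le_trans zL.
- apply: le_trans jL; rewrite lerD2r ler_pM2r // ler_int; int_lia.
Qed.

End ChainEstimates.
(** * Error estimate *)

Section ExactAverages.
Context (R : realType) (k : nat) (L B : R) (u0 : R -> R).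
Context (V : nat -> R -> R) (E E0 : R -> R).
Hypothesis chain : primitive_chain k L B u0 V E E0.
Context (J : nat) (d : R) (d_gt0 : 0 < d) (Jd : J%:R * d = L).

Let cell_le (j : int) : (j - 1)%:~R * d <= j%:~R * d.
Proof. by rewrite ler_pM2r // ler_int; int_lia. Qed.

Let cell_end (j : int) : j <= J%:Z -> j%:~R * d <= L.
Proof. by move=> jJ; rewrite -Jd ler_pM2r // pmulrn ler_int. Qed.

Lemma cell_average_extend0 (c : R) (j : int) : 0 <= c -> j <= J%:Z ->
  cell_average d (fun y => extend0 u0 (y - c)) j = exact_average V d c j.
Proof.
move=> c0 jJ; rewrite /cell_average (chain_average chain c0 (cell_le j) (cell_end jJ)).
by rewrite mulrC.
Qed.

Lemma cell_average_initial (j : int) : 1 <= j <= J%:Z ->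
  cell_average d u0 j = exact_average V d 0 j.
Proof.
move=> /andP[j1 jJ]; rewrite -cell_average_extend0 // /cell_average; congr (_ * _).
apply: eq_Rintegral => t; rewrite inE /= in_itv /= => /andP[t0 _].
rewrite subr0 /extend0 leNgt (le_lt_trans _ t0) //.
by rewrite mulr_ge0 ?(ltW d_gt0) // ler0z; int_lia.
Qed.

Lemma exact_average_eq0 (c : R) (j : int) : 0 <= c -> j <= 0 ->
  exact_average V d c j = 0.
Proof.
move=> c0 j0; have V0 (i : int) : i <= 0 -> V 0%N (i%:~R * d - c) = 0.
  move=> i0; apply: (chain_left chain) => //; rewrite subr_le0.
  by apply: le_trans c0; rewrite pmulr_lle0 // lerz0.
by rewrite /exact_average !V0 ?subrr ?mul0r //; int_lia.
Qed.

Lemma sqr_exact_average_le (c : R) (j : int) :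
  exact_average V d c j ^+ 2 <= d^-1 * (E0 (j%:~R * d - c) - E0 ((j - 1)%:~R * d - c)).
Proof.
rewrite exprMn exprVn expr2 invfM mulrC -mulrA ler_pM2l ?invr_gt0 // ler_pdivrMl //.
apply: le_trans (chain_hoelder0 chain _) _; first by rewrite lerD2r.
by rewrite intrB opprB addrCA !addrA le_eqVlt; apply/orP; left; apply/eqP; ring.
Qed.

Lemma sqr_exact_average_le_norm (c : R) (j : int) : 0 <= c -> j <= J%:Z ->
  exact_average V d c j ^+ 2 <= B ^+ 2 / d.
Proof.
move=> c0 jJ; apply: le_trans (sqr_exact_average_le c j) _.
rewrite mulrC ler_pM2r ?invr_gt0 //.
have h (i : int) : i <= J%:Z -> 0 <= E0 (i%:~R * d - c) <= B ^+ 2.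
  move=> iJ; apply: (chain_energy0_bound chain).
  by rewrite lerBlDr (le_trans (cell_end iJ)) // lerDl.
have /andP[_ h1] := h j jJ; have /andP[h2 _] := h (j - 1) ltac:(int_lia).
by rewrite lerBlDr (le_trans h1) // lerDl.
Qed.

Lemma energy_exact_average_le : energy (exact_average V d 0) 1 J <= B ^+ 2 / d.
Proof.
pose e (j : int) := E0 (Num.min ((j - 1)%:~R * d) L).
apply: (@le_trans _ _ (d^-1 * wsum (fun j => e (j + 1%:Z) - e j) 1 J)).
  rewrite -wsumZ; apply: le_wsum => j jJ; apply: le_trans (sqr_exact_average_le 0 j) _.
  rewrite /e addrK !subr0 !min_l //; apply: cell_end; int_lia.
rewrite mulrC ler_pM2r ?invr_gt0 // -[leRHS]mul1r.
apply: wsum_increments_le => j; apply: (chain_energy0_bound chain).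
by rewrite ge_min lexx orbT.
Qed.

End ExactAverages.

Section Convergence.
Context (R : realType) (lambda mu : R) (k kb r p : nat) (a_ : int -> R).
Hypothesis lambda_gt0 : 0 < lambda.
Hypothesis mu_gt0 : 0 < mu.
Hypothesis k_gt0 : (0 < k)%N.
Hypothesis r_gt0 : (0 < r)%N.
Hypothesis p_gt0 : (0 < p)%N.
Hypothesis ar_neq0 : a_ (- r%:Z) != 0.
Hypothesis consistency : forall m : nat, (m <= k)%N ->
  stencil_sum r p (fun l => l%:~R ^+ m * a_ l) = (- mu) ^+ m.
Hypothesis stable : forall theta : R, 0 <= theta <= 2 * pi ->
  Normc.normc (symbol r p a_ theta) <= 1.
Local Notation D := (@backward_diff R).

Let sum_a : stencil_sum r p a_ = 1.
Proof.
rewrite -[RHS](consistency (leq0n k)).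
by apply: eq_stencil_sum => l _; rewrite mul1r.
Qed.

Let sum_la : stencil_sum r p (fun l => l%:~R * a_ l) = - mu.
Proof. exact: (consistency k_gt0). Qed.

(** The hypotheses shared by the estimates for fine and coarse grids.  The
    initial error vanishes, whence [0 < n], which in turn excludes final
    times shorter than one time step. *)
Definition run (T L B : R) (J : nat) (u0 : R -> R) (V : nat -> R -> R)
    (E E0 : R -> R) (u : nat -> int -> R) (n : nat) : Prop :=
  [/\ [/\ 0 < T, (0 < J)%N, (kb <= J + r)%N, 1 <= L & 0 <= B],
      primitive_chain k L B u0 V E E0,
      scheme_solution r p kb J a_ (L / J%:R) u0 u,
      (0 < n)%N & n%:R * (lambda * (L / J%:R)) <= T].

Let steps_le T L B J u0 V E E0 u n : run T L B J u0 V E E0 u n ->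
  n%:R / J%:R <= lambda^-1 * (T / L) /\ n%:R <= lambda^-1 * T / (L / J%:R).
Proof.
case=> -[T0 J0 _ L1 _] _ _ _ nT.
have J0' : 0 < J%:R :> R by rewrite ltr0n.
have L0 : 0 < L by apply: lt_le_trans L1.
have d0 : 0 < L / J%:R by exact: divr_gt0.
have h : n%:R <= lambda^-1 * T / (L / J%:R).
  by rewrite ler_pdivlMr // ler_pdivlMl // mulrCA.
split=> //; rewrite ler_pdivrMr //; apply: le_trans h _.
by rewrite invfM invrK !mulrA.
Qed.

(** The scheme holds for the error, with the truncation error as source and
    the differences of the exact averages as boundary data.  The power of [T] is
    the number of terms: [n] for the boundary data, and [n ^ 2] for the source,
    on which the stability estimate has a factor [N = n]. *)
Lemma error_fine : exists2 C : R, 0 < C & forall T L B J u0 V E E0 u n,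
  run T L B J u0 V E E0 u n -> L / J%:R <= 1 ->
  forall j : int, 1 <= j <= J%:Z ->
  (u n j - exact_average V (L / J%:R) (n%:R * (mu * (L / J%:R))) j) ^+ 2 <=
  C * expR (C * (T / L)) * (T + T ^+ 2) *
  ((L / J%:R) ^+ (2 * minn k kb) / (L / J%:R)) * B ^+ 2.
Proof.
have [C0 C0_gt0 stability] :=
  @scheme_stability R r p a_ kb stable r_gt0 ar_neq0 mu mu_gt0 sum_a sum_la.
pose H := (r + p + (Num.truncn mu).+1)%N.
have muH : `|mu| <= H%:R.
  by rewrite (gtr0_norm mu_gt0) ltW // (lt_le_trans (truncnS_gt mu)) // ler_nat leq_addl.
pose K := (stencil_sum r p (fun l => `|a_ l|) + 1) ^+ 2 * H%:R ^+ (2 * k) * H.+1%:R *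
  (H + H.+1)%:R.
have K_ge0 : 0 <= K by apply: mulr_ge0 => //; apply: mulr_ge0 => //; rewrite mulr_ge0 ?sqr_ge0 ?exprn_ge0.
pose K' : R := 2 ^+ (kb - minn k kb) * ((1 + p%:R) ^+ k * (2 + p%:R)).
have li_gt0 : 0 < lambda^-1 by rewrite invr_gt0.
pose C1 := C0 * (lambda^-1 * K' ^+ 2 + lambda^-1 ^+ 2 * K).
have C1_ge0 : 0 <= C1.
  by rewrite mulr_ge0 ?(ltW C0_gt0) // addr_ge0 // mulr_ge0 ?sqr_ge0 // ltW.
pose C2 := C0 * lambda^-1.
have C2_gt0 : 0 < C2 by exact: mulr_gt0.
exists (C1 + C2) => [|T L B J u0 V E E0 u n hrun]; first exact: ltr_wpDl.
have [nJ nd] := steps_le hrun.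
have [[T0 J0 kbJ L1 B0] chain sol n0 nT] := hrun.
have J0' : 0 < J%:R :> R by rewrite ltr0n.
have L0 : 0 < L by apply: lt_le_trans L1.
have Jd : J%:R * (L / J%:R) = L by rewrite mulrCA divff ?mulr1 // gt_eqF.
have d0 : 0 < L / J%:R by exact: divr_gt0.
move: (L / J%:R) => d in sol nd nT Jd d0 * => d1 j jJ.
pose c (m : nat) : R := m%:R * (mu * d).
have c_ge0 m : 0 <= c m by rewrite mulr_ge0 // mulr_ge0 // ltW.
have cS m : c m.+1 = c m + mu * d by rewrite /c -natr1 mulrDl mul1r.
pose w m := exact_average V d (c m).
pose e m (i : int) := if i <= 0 then 0 else u m i - w m i.
pose F m (i : int) := if i <= 0 then 0 else stencil r p a_ (w m) i - w m.+1 i.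
have e_le0 m i : i <= 0 -> e m i = 0 by rewrite /e => ->.
have F_le0 m i : i <= 0 -> F m i = 0 by rewrite /F => ->.
have uE m (i : int) : 1 - r%:Z <= i -> u m i = e m i + w m i.
  move=> ri; rewrite /e; case: ifP => i0; last by rewrite subrK.
  by rewrite (scheme_inflow sol) ?ri // /w (exact_average_eq0 chain d0) ?addr0.
have e_init : energy (e 0%N) 1 J = 0.
  transitivity (wsum (fun=> 0 : R) 1 J); last by rewrite wsum_cst mulr0.
  apply: eq_wsum => i iJ; have iJ' : 1 <= i <= J%:Z by int_lia.
  rewrite /e ifF; last by int_lia.
  rewrite (scheme_init sol iJ') (cell_average_initial chain d0 Jd iJ').
  by rewrite /w /c mul0r subrr expr0n.
pose m0 := minn k kb.
pose b (m : nat) : R := K' * d ^+ m0 * B.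
have K'_ge0 : 0 <= K' by rewrite mulr_ge0 // mulr_ge0 ?exprn_ge0 ?addr_ge0.
have d_ge0 := ltW d0.
have b_ge0 m : 0 <= b m by rewrite !mulr_ge0 ?exprn_ge0.
have e_step m (i : int) : 1 <= i <= J%:Z -> e m.+1 i = stencil r p a_ (e m) i + F m i.
  move=> iJ; have i0 : (i <= 0) = false by int_lia.
  rewrite /F /(e m.+1) i0 (scheme_step sol) // addrA; congr (_ - _).
  rewrite -/(stencil r p a_ (u m) i) -stencil_sumD.
  rewrite (@stencil_ext _ _ _ _ _ (fun l => e m l + w m l)); last first.
    by move=> l hl; apply: uE; int_lia.
  by apply: eq_stencil_sum => l _; rewrite mulrDr.
have e_boundary m (l : int) : 1 <= l <= p%:Z -> `|iter kb D (e m) (J%:Z + l)| <= b m.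
  move=> lp; have := scheme_outflow sol m lp.
  rewrite (@iter_backward_diff_local _ kb _ (fun i => e m i + w m i)); last first.
    by move=> i hi; apply: uE; int_lia.
  rewrite iter_backward_diffD => /eqP; rewrite addr_eq0 => /eqP ->; rewrite normrN.
  apply: le_trans (iter_backward_diff_exact_average_le B0 chain kb p_gt0 d0 _) _.
    apply: (@le_trans _ _ ((J%:Z + l)%:~R * d)); first by rewrite gerBl.
    rewrite intrD mulrDl -pmulrn Jd lerD2l.
    apply: (@le_trans _ _ (l%:~R * 1)).
      by rewrite ler_wpM2l // ler0z; int_lia.
    by rewrite mulr1 pmulrn ler_int; case/andP: lp.
  by rewrite /b /K' le_eqVlt; apply/orP; left; apply/eqP; ring.
have := stability J n e F b J0 n0 e_le0 F_le0 e_step e_boundary b_ge0 n (leqnn n).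
rewrite e_init add0r => en_le.
have F_le m : energy (F m) 1 J <= K * d ^+ (2 * k).+1 * B ^+ 2.
  rewrite /K; apply: le_trans (energy_truncation_le chain (c m) J consistency _ _ muH d0).
  - apply: le_wsum => i iJ; rewrite /F ifF; last by int_lia.
    by rewrite /w cS -sqrrN opprB.
  - by rewrite /H -addnA leq_addr.
  - by rewrite /H addnAC leq_addl.
apply: (@le_trans _ _ (energy (e n) 1 J)).
  move: jJ => /andP[j1 jJ]; have j0 : (j <= 0) = false by int_lia.
  have := @le_wsum_term _ (fun i => e n i ^+ 2) 1 J j (fun i => sqr_ge0 _).
  by rewrite /e j0; apply; int_lia.
apply: le_trans en_le _.
have m0k : (m0 <= k)%N by exact: geq_minl.
rewrite -/m0; clearbody K K' m0.
have d2_ge0 : 0 <= d ^+ (2 * m0) / d by rewrite mulr_ge0 ?invr_ge0 ?exprn_ge0.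
set Y := d ^+ (2 * m0) / d * B ^+ 2.
have Y_ge0 : 0 <= Y by rewrite mulr_ge0 ?sqr_ge0.
have sum_le : \sum_(0 <= i < n) (b i ^+ 2 + n%:R * energy (F i) 1 J) <=
    (lambda^-1 * K' ^+ 2 + lambda^-1 ^+ 2 * K) * (T + T ^+ 2) * Y.
  apply: (@le_trans _ _ (\sum_(0 <= i < n)
      (K' ^+ 2 * d * Y + n%:R * (K * d ^+ 2 * Y)))).
    apply: ler_sum => i _; apply: lerD.
      rewrite /b /Y mulnC exprM le_eqVlt; apply/orP; left; apply/eqP.
      by field; rewrite gt_eqF.
    rewrite ler_wpM2l //; apply: le_trans (F_le i) _.
    rewrite [leRHS](_ : _ = K * d ^+ (2 * m0).+1 * B ^+ 2); last first.
      by rewrite /Y (exprS d (2 * m0)); field; rewrite gt_eqF.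
    rewrite ler_wpM2r ?sqr_ge0 // ler_wpM2l //.
    by rewrite ler_wiXn2l // ltnS leq_mul2l.
  rewrite sumr_const_nat subn0 -mulr_natl.
  move: nd; rewrite ler_pdivlMr // => nd.
  have nd2 : (n%:R * d) ^+ 2 <= (lambda^-1 * T) ^+ 2.
    by rewrite lerXn2r ?nnegrE ?mulr_ge0 // ltW.
  rewrite [leLHS](_ : _ = (K' ^+ 2 * (n%:R * d) + K * (n%:R * d) ^+ 2) * Y); last by ring.
  rewrite ler_wpM2r //.
  apply: (@le_trans _ _ (K' ^+ 2 * (lambda^-1 * T) + K * (lambda^-1 * T) ^+ 2)).
    by apply: lerD; rewrite ler_wpM2l ?sqr_ge0.
  rewrite exprMn [leRHS](_ : _ = K' ^+ 2 * (lambda^-1 * T) + K * (lambda^-1 ^+ 2 * T ^+ 2) +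
    (lambda^-1 * K' ^+ 2 * T ^+ 2 + lambda^-1 ^+ 2 * K * T)); last by ring.
  by rewrite lerDl addr_ge0 // ?mulr_ge0 ?sqr_ge0 // ltW.
apply: (@le_trans _ _ (C0 * expR ((C1 + C2) * (T / L)) *
    ((lambda^-1 * K' ^+ 2 + lambda^-1 ^+ 2 * K) * (T + T ^+ 2) * Y))).
  apply: ler_pM => //.
  - by rewrite mulr_ge0 ?expR_ge0 // ltW.
  - apply: sumr_ge0 => i _; apply: addr_ge0; first exact: sqr_ge0.
    by apply: mulr_ge0 => //; exact: energy_ge0.
  rewrite ler_pM2l // ler_expR; apply: (@le_trans _ _ (C2 * (T / L))).
    by rewrite /C2 -mulrA ler_pM2l.
  by rewrite ler_wpM2r ?lerDr // divr_ge0 // ltW.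
have TT_ge0 : 0 <= T + T ^+ 2 by rewrite addr_ge0 ?sqr_ge0 // ltW.
rewrite [leLHS](_ : _ = C1 * (expR ((C1 + C2) * (T / L)) * (T + T ^+ 2) * Y)); last first.
  by rewrite /C1; ring.
rewrite [leRHS](_ : _ = (C1 + C2) * (expR ((C1 + C2) * (T / L)) * (T + T ^+ 2) * Y));
  last by rewrite /Y; ring.
by rewrite ler_wpM2r ?lerDl ?(ltW C2_gt0) // mulr_ge0 // mulr_ge0 ?expR_ge0.
Qed.

(** On coarse grids the numerical solution and the exact averages are bounded
    separately, by the square-integrability of the datum alone; the
    factor [T] comes for free as one time step already requires
    [lambda <= T]. *)
Lemma error_coarse : exists2 C : R, 0 < C & forall T L B J u0 V E E0 u n,
  run T L B J u0 V E E0 u n -> 1 < L / J%:R ->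
  forall j : int, 1 <= j <= J%:Z ->
  (u n j - exact_average V (L / J%:R) (n%:R * (mu * (L / J%:R))) j) ^+ 2 <=
  C * expR (C * (T / L)) * T * (B ^+ 2 / (L / J%:R)).
Proof.
have [C0 C0_gt0 stability] :=
  @scheme_stability R r p a_ kb stable r_gt0 ar_neq0 mu mu_gt0 sum_a sum_la.
have li_gt0 : 0 < lambda^-1 by rewrite invr_gt0.
pose C1 := (2 * C0 + 2) * lambda^-1.
have C1_gt0 : 0 < C1 by apply: mulr_gt0 => //; lra.
pose C2 := C0 * lambda^-1.
have C2_gt0 : 0 < C2 by exact: mulr_gt0.
exists (C1 + C2) => [|T L B J u0 V E E0 u n hrun]; first exact: addr_gt0.
have [nJ _] := steps_le hrun.
have [[T0 J0 kbJ L1 B0] chain sol n0 nT] := hrun.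
have J0' : 0 < J%:R :> R by rewrite ltr0n.
have L0 : 0 < L by apply: lt_le_trans L1.
have Jd : J%:R * (L / J%:R) = L by rewrite mulrCA divff ?mulr1 // gt_eqF.
have d0 : 0 < L / J%:R by exact: divr_gt0.
move: (L / J%:R) => d in sol nT Jd d0 * => d1 j jJ.
pose e m (i : int) := if i <= 0 then 0 else u m i.
have e_le0 m i : i <= 0 -> e m i = 0 by rewrite /e => ->.
have uE m (i : int) : 1 - r%:Z <= i -> u m i = e m i.
  by move=> ri; rewrite /e; case: ifP => // i0; rewrite (scheme_inflow sol) ?ri.
have e_step m (i : int) : 1 <= i <= J%:Z -> e m.+1 i = stencil r p a_ (e m) i + 0.
  move=> iJ; rewrite addr0 -uE; last by int_lia.
  rewrite (scheme_step sol) // -/(stencil r p a_ (u m) i).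
  by apply: stencil_ext => l hl; apply: uE; int_lia.
have e_boundary m (l : int) : 1 <= l <= p%:Z -> `|iter kb D (e m) (J%:Z + l)| <= 0.
  move=> lp; rewrite (_ : iter _ _ _ _ = 0) ?normr0 // -(scheme_outflow sol m lp).
  by apply: iter_backward_diff_local => i hi; rewrite uE //; int_lia.
have := stability J n e (fun _ _ => 0) (fun=> 0) J0 n0 e_le0 (fun _ _ _ => erefl)
  e_step e_boundary (fun=> lexx 0) n (leqnn n).
rewrite big1 => [|i _]; last first.
  by rewrite /energy expr0n wsum_cst !mulr0 addr0.
rewrite addr0 => en_le.
set Y := B ^+ 2 / d; have Y_ge0 : 0 <= Y by rewrite divr_ge0 ?sqr_ge0 // ltW.
have e_init : energy (e 0%N) 1 J <= Y.
  apply: le_trans (energy_exact_average_le chain d0 Jd).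
  apply: le_wsum => i iJ; have iJ' : 1 <= i <= J%:Z by int_lia.
  rewrite -uE; last by int_lia.
  by rewrite (scheme_init sol iJ') (cell_average_initial chain d0 Jd iJ').
set w := exact_average _ _ _ _; have wY : w ^+ 2 <= Y.
  apply: (sqr_exact_average_le_norm chain d0 Jd); last by case/andP: jJ.
  by rewrite mulr_ge0 // mulr_ge0 // ltW.
set X := expR ((C1 + C2) * (T / L)).
have TL0 : 0 <= T / L by rewrite divr_ge0 // ltW.
have X1 : 1 <= X by rewrite -expR0 ler_expR mulr_ge0 // ltW // addr_gt0.
have uY : u n j ^+ 2 <= C0 * X * Y.
  apply: (@le_trans _ _ (energy (e n) 1 J)).
    rewrite uE; last by int_lia.
    by apply: (@le_wsum_term _ (fun i => e n i ^+ 2)) => [i|]; [exact: sqr_ge0|int_lia].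
  apply: le_trans en_le _; apply: ler_pM => //.
  - by rewrite mulr_ge0 ?expR_ge0 // ltW.
  - exact: energy_ge0.
  rewrite ler_pM2l // ler_expR; apply: (@le_trans _ _ (C2 * (T / L))).
    by rewrite /C2 -mulrA ler_pM2l.
  by rewrite ler_wpM2r // lerDr ltW.
have T1 : 1 <= lambda^-1 * T.
  rewrite ler_pdivlMl // mulr1; apply: le_trans nT.
  have n1 : 1 <= n%:R :> R by rewrite ler1n.
  apply: (@le_trans _ _ (1 * (lambda * d))); last by rewrite ler_pM2r // mulr_gt0.
  by rewrite mul1r ler_peMr ?ltW.
apply: (@le_trans _ _ (2 * u n j ^+ 2 + 2 * w ^+ 2)).
  by have := sqr_ge0 (u n j + w); lra.
apply: (@le_trans _ _ ((2 * C0 + 2) * (X * Y))).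
  rewrite [leRHS](_ : _ = 2 * (C0 * X * Y) + 2 * (X * Y)); last by ring.
  apply: lerD; rewrite ler_pM2l //; apply: le_trans wY _.
  by rewrite ler_peMl.
have XY_ge0 : 0 <= X * Y by rewrite mulr_ge0 ?expR_ge0.
apply: (@le_trans _ _ ((2 * C0 + 2) * (lambda^-1 * T) * (X * Y))).
  by rewrite ler_wpM2r // ler_peMr //; lra.
rewrite [leLHS](_ : _ = C1 * (T * (X * Y))); last by rewrite /C1; ring.
rewrite [leRHS](_ : _ = (C1 + C2) * (T * (X * Y))); last by ring.
by rewrite ler_wpM2r ?lerDl ?(ltW C2_gt0) // mulr_ge0 // ltW.
Qed.

(** The largest error is bounded by the square root of the energy, and
    [T + T ^ 2] by the square of [Num.sqrt T + T]. *)
Lemma error_le : exists2 C : R, 0 < C & forall T L B J u0 V E E0 u n,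
  run T L B J u0 V E E0 u n ->
  forall j : int, 1 <= j <= J%:Z ->
  `|u n j - exact_average V (L / J%:R) (n%:R * (mu * (L / J%:R))) j| <=
  C * (Num.sqrt T + T) * expR (C * T / L) *
  (L / J%:R) `^ ((minn k kb)%:R - 2^-1) * B.
Proof.
have [C1 C1_gt0 fine] := error_fine; have [C2 C2_gt0 coarse] := error_coarse.
pose C := C1 + C2.
have C_gt0 : 0 < C by exact: addr_gt0.
exists (C + 1) => [|T L B J u0 V E E0 u n hrun j jJ]; first by lra.
have [[T0 J0 _ L1 B0] _ _ _ _] := hrun.
have J0' : 0 < J%:R :> R by rewrite ltr0n.
have L0 : 0 < L by apply: lt_le_trans L1.
have d0 : 0 < L / J%:R by exact: divr_gt0.
have TL0 : 0 <= T / L by rewrite divr_ge0 // ltW.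
have := fun h => coarse _ _ _ _ _ _ _ _ _ _ hrun h j jJ.
have := fun h => fine _ _ _ _ _ _ _ _ _ _ hrun h j jJ.
move: (L / J%:R) (exact_average _ _ _ _) d0 => d w d0 {}fine {}coarse.
set m := minn k kb; set S := Num.sqrt T + T.
have S_ge0 : 0 <= S by rewrite addr_ge0 ?sqrtr_ge0 // ltW.
have S2 : T + T ^+ 2 <= S ^+ 2.
  rewrite /S sqrrD (sqr_sqrtr (ltW T0)) -addrA lerD2l lerDr mulrn_wge0 //.
  by rewrite mulr_ge0 ?sqrtr_ge0 // ltW.
have Y_ge0 : 0 <= d ^+ (2 * m) / d * B ^+ 2.
  by rewrite mulr_ge0 ?sqr_ge0 // divr_ge0 ?exprn_ge0 // ltW.
have sqr_le : (u n j - w) ^+ 2 <= C * expR (C * (T / L)) * (T + T ^+ 2) *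
    (d ^+ (2 * m) / d * B ^+ 2).
  have T2_ge0 : 0 <= T ^+ 2 by exact: sqr_ge0.
  have mono C' : 0 < C' -> C' <= C -> C' * expR (C' * (T / L)) <= C * expR (C * (T / L)).
    move=> C'0 C'C; apply: ler_pM; rewrite ?expR_ge0 ?(ltW C'0) //.
    by rewrite ler_expR ler_wpM2r.
  have [d1|d1] := leP d 1.
    apply: le_trans (fine d1) _.
    rewrite -(mulrA _ _ (B ^+ 2)) ler_wpM2r // ler_wpM2r ?addr_ge0 ?(ltW T0) //.
    by apply: mono => //; rewrite /C lerDl ltW.
  apply: le_trans (coarse d1) _; apply: ler_pM.
  - by rewrite mulr_ge0 ?(ltW T0) // mulr_ge0 ?expR_ge0 // ltW.
  - by rewrite divr_ge0 ?sqr_ge0 // ltW.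
  - apply: ler_pM; rewrite ?(ltW T0) ?lerDl // ?mulr_ge0 ?expR_ge0 ?(ltW C2_gt0) //.
    by apply: mono => //; rewrite /C lerDr ltW.
  rewrite [leRHS](_ : _ = d ^+ (2 * m) * (B ^+ 2 / d)); last by rewrite mulrAC mulrA.
  by rewrite ler_peMl ?exprn_ege1 ?divr_ge0 ?sqr_ge0 // ltW.
have pow2 : (d `^ (m%:R - 2^-1)) ^+ 2 = d ^+ (2 * m) / d.
  rewrite -powR_mulrn ?powR_ge0 // -powRrM mulrBl mulVf // powRD; last first.
    by apply/implyP => _; rewrite gt_eqF.
  by rewrite -natrM mulnC powR_mulrn ?(ltW d0) // powR_inv1 // ltW.
have rhs_ge0 : 0 <= (C + 1) * S * expR ((C + 1) * T / L) * d `^ (m%:R - 2^-1) * B.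
  have C1_ge0 : 0 <= C + 1 by lra.
  by rewrite mulr_ge0 // mulr_ge0 ?powR_ge0 // mulr_ge0 ?expR_ge0 // mulr_ge0.
rewrite -ler_sqr ?nnegrE ?normr_ge0 // real_normK ?num_real //; apply: le_trans sqr_le _.
rewrite [leRHS](_ : _ = ((C + 1) ^+ 2 * expR ((C + 1) * T / L) ^+ 2) * S ^+ 2 *
    ((d `^ (m%:R - 2^-1)) ^+ 2 * B ^+ 2)); last by ring.
rewrite pow2 ler_wpM2r //; apply: ler_pM => //.
- by rewrite mulr_ge0 ?expR_ge0 // ltW.
- by rewrite addr_ge0 ?sqr_ge0 // ltW.
apply: ler_pM; rewrite ?expR_ge0 ?(ltW C_gt0) //; first by nra.
rewrite -mulrA; apply: (@le_trans _ _ (expR ((C + 1) * (T / L)))).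
  by rewrite ler_expR ler_wpM2r // lerDl.
by rewrite expr2 ler_peMr ?expR_ge0 // -[leLHS]expR0 ler_expR mulr_ge0 //; lra.
Qed.

End Convergence.
Theorem theorem2p2 (R : realType) (a : R) (k kb : nat) (lambda : R)
    (r p : nat) (a_ : int -> R)
    (a_gt0 : 0 < a) (k_gt0 : (0 < k)%N) (lambda_gt0 : 0 < lambda)
    (r_ge1 : (1 <= r)%N) (p_ge1 : (1 <= p)%N)
    (a_neq0 : a_ (- r%:Z) * a_ p%:Z != 0)
    (consistency : forall m : nat, (m <= k)%N ->
      stencil_sum r p (fun l => l%:~R ^+ m * a_ l) = (- (lambda * a)) ^+ m)
    (l2_stability :
      (ereal_sup [set (Normc.normc (symbol r p a_ theta) : R)%:E
                 | theta in `[0%R, (2 * pi)%R]%classic] <= 1)%E) :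
  exists2 C : R, 0 < C &
  forall (T : R) (J : nat) (L : R) (u0 : R -> R),
    0 < T -> (0 < J)%N -> (kb <= J + r)%N -> 1 <= L ->
    sobolev k.+1 L u0 ->
    (forall m : nat, (m <= k)%N -> trace0 L (weak_derivative L m u0) 0) ->
    let dx := L / J%:R in
    let dt := lambda * dx in
    forall u : nat -> int -> R,
      scheme_solution r p kb J a_ dx u0 u ->
      (ereal_sup [set (`| u n j
          - cell_average dx (fun y => extend0 u0 (y - a * (n%:R * dt))) j |%R)%:E
          | n in [set n : nat | (n%:R <= T / dt)%R]
          & j in [set j : int | (1 <= j <= J%:Z)%R]]
       <= (C * (Num.sqrt T + T) * expR (C * T / L)
           * dx `^ ((minn k kb)%:R - 2^-1)
           * sobolev_norm k.+1 L u0)%:E)%E.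
Proof.
have mu_gt0 : 0 < lambda * a by exact: mulr_gt0.
have ar_neq0 : a_ (- r%:Z) != 0 by apply: contraNneq a_neq0 => ->; rewrite mul0r.
have stable (theta : R) : 0 <= theta <= 2 * pi -> Normc.normc (symbol r p a_ theta) <= 1.
  move=> theta_le; rewrite -lee_fin; apply: le_trans l2_stability.
  by apply: ereal_sup_ubound; exists theta; rewrite //= in_itv.
have [C C_gt0 estimate] := error_le kb lambda_gt0 mu_gt0 k_gt0 r_ge1 p_ge1 ar_neq0
  consistency stable.
exists C => // T J L u0 T_gt0 J_gt0 kbJ L_ge1 sob traces dx dt u sol.
have L_gt0 : 0 < L by apply: lt_le_trans L_ge1.
have J_gt0' : 0 < J%:R :> R by rewrite ltr0n.
have dx_gt0 : 0 < dx by exact: divr_gt0.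
have Jdx : J%:R * dx = L by rewrite /dx mulrCA divff ?mulr1 // gt_eqF.
set B := sobolev_norm k.+1 L u0; have B_ge0 : 0 <= B by exact: sqrtr_ge0.
have [V [E [E0 chain]]] := sobolev_primitive_chain L_ge1 sob traces.
apply: ge_ereal_sup => _ [n /= nT [j jJ <-]]; rewrite lee_fin.
have [j1 jJ'] := andP jJ.
have cE : a * (n%:R * dt) = n%:R * (lambda * a * dx) by rewrite /dt; ring.
have c_ge0 : 0 <= n%:R * (lambda * a * dx) by rewrite mulr_ge0 // mulr_ge0 // ltW.
rewrite cE (cell_average_extend0 chain dx_gt0 Jdx) //.
case: (posnP n) => [n0|n_gt0].
  rewrite n0 mul0r (scheme_init sol jJ) (cell_average_initial chain dx_gt0 Jdx jJ).
  rewrite subrr normr0 mulr_ge0 // mulr_ge0 ?powR_ge0 // mulr_ge0 ?expR_ge0 //.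
  by rewrite mulr_ge0 ?(ltW C_gt0) // addr_ge0 ?sqrtr_ge0 // ltW.
apply: (estimate T L B J u0 V E E0 u n _ j jJ); split => //.
by rewrite -ler_pdivlMr // mulr_gt0.
Qed.
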